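(* Let $(b,o,c)$ be a magnetic Schrödinger graph over $(X,m)$ whose form $Q$ is positive and closable on $\ell^2$, and let $d$ be an intrinsic metric with finite jump size $s>0$. If the potential $c$ is form bounded and the graph has uniform subexponential volume growth, then, for all $1\le p\le\infty$, $$\sigma(H_2)=\sigma(H_p).$$
   Context: $X$ is a discrete set, $m:X\to(0,\infty)$ (extended to a measure $m(A)=\sum_Am$), $C_c(X)$ the finitely supported complex functions on $X$, $\ell^p=\ell^p(X,m)$. A graph $b$ over $(X,m)$ is a symmetric $b:X\times X\to[0,\infty)$ with zero diagonal and $\sum_yb(x,y)<\infty$ for all $x$; a magnetic potential is $o:X\times X\to\{z\in\mathbb C:|z|=1\}$ with $o(x,y)=\overline{o(y,x)}$; an electric potential is $c:X\to\mathbb R$. The triple $(b,o,c)$ is called a magnetic Schrödinger graph over $(X,m)$. With $\nabla_of(x,y)=f(x)-o(x,y)f(y)$, its form on $C_c(X)$ is $$Q(\varphi,\psi)=\tfrac12\sum_{X\times X}b\,\nabla_o\varphi\,\overline{\nabla_o\psi}+\sum_Xc\,\varphi\overline\psi .$$ $Q$ is positive if $Q(\varphi):=Q(\varphi,\varphi)\ge0$ for all $\varphi\in C_c(X)$. $H_2$ is the positive self-adjoint operator on $\ell^2$ associated with the closure of $Q$, and $S_2(t)=e^{-tH_2}$. $c$ is form bounded if there are $M,C\ge0$ with $\|\sqrt{c_-/m}\,\varphi\|_2^2\le MQ(\varphi)+C\|\varphi\|_2^2$ for all $\varphi\in C_c(X)$, where $c_-=-(c\wedge0)$. An intrinsic metric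 is a pseudo metric $d$ on $X$ with $\frac1{m(x)}\sum_yb(x,y)d(x,y)^2\le1$ for all $x$; its jump size is $s=\sup\{d(x,y):b(x,y)>0\}$. The graph has uniform subexponential volume growth if for all $\varepsilon>0$ there is $C_\varepsilon>0$ such that $m(B_r(x))<C_\varepsilon e^{\varepsilon r}m(x)$ for all $x\in X$, $r>0$, where $B_r(x)=\{y:d(x,y)\le r\}$. Under this growth assumption $S_2$ extends consistently (i.e. $S_p(t)=S_2(t)$ on $\ell^2\cap\ell^p$) to strongly continuous semigroups $S_p$ on $\ell^p$, $1\le p<\infty$. $-H_p$ denotes the generator of $S_p$, and $H_\infty=(H_1)^*$ is the adjoint with respect to the dual pairing $\sum_Xmf\overline g$ of $\ell^1$ and $\ell^\infty$. $\sigma(H_p)$ is the spectrum on $\ell^p$. *)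

(* Defs.v *)
From HB Require Import structures.
From mathcomp Require Import all_boot all_order all_algebra.
From mathcomp Require Import all_classical all_reals all_analysis.
From mathcomp Require Export complex.
Set Implicit Arguments.
Unset Strict Implicit.
Unset Printing Implicit Defensive.
Import Order.TTheory GRing.Theory Num.Theory.
Import numFieldNormedType.Exports.

Local Open Scope classical_set_scope.
Local Open Scope ring_scope.

(* Absolute values of complex numbers are [Normc.normc], which is R-valued; the
   generic norm `|z| on R[i] takes its values in R[i]. *)
Notation normc := Normc.normc.

(** Unordered sums over a discrete set: these are the usual values for
    absolutely summable functions, and junk otherwise. *)

Definition rsum (R : realType) (T : choiceType) (u : T -> R) : R :=
  fine (esum [set: T] (EFin \o u)^\+ - esum [set: T] (EFin \o u)^\-)%E.

Definition csum (R : realType) (T : choiceType) (u : T -> R[i]) : R[i] :=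
  (rsum (fun x => complex.Re (u x)) +i* rsum (fun x => complex.Im (u x)))%C.

Definition vol (R : realType) (X : choiceType) (m : X -> R) (A : set X)
  : \bar R := \esum_(x in A) (m x)%:E.

(* Since m > 0, the supremum is the essential supremum; the value at -oo is
   never used. *)
Definition lpnorm (R : realType) (X : choiceType) (m : X -> R) (p : \bar R)
    (f : X -> R[i]) : \bar R :=
  match p with
  | r%:E => (\esum_(x in [set: X]) (m x * normc (f x) `^ r)%:E) `^ r^-1
  | +oo => ereal_sup [set (normc (f x))%:E | x in [set: X]]
  | -oo => 0
  end%E.

Definition ell (R : realType) (X : choiceType) (m : X -> R) (p : \bar R)
  : set (X -> R[i]) := [set f | lpnorm m p f < +oo]%E.

Definition pairing (R : realType) (X : choiceType) (m : X -> R)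
    (f g : X -> R[i]) : R[i] :=
  csum (fun x => (m x)%:C * f x * conjc (g x))%C.

Definition Cc (R : realType) (X : choiceType) : set (X -> R[i]) :=
  [set f | finite_set [set x | f x != 0]].

Definition is_graph (R : realType) (X : choiceType) (b : X -> X -> R) : Prop :=
  [/\ forall x y, 0 <= b x y,
      forall x y, b x y = b y x,
      forall x, b x x = 0
    & forall x, (\esum_(y in [set: X]) (b x y)%:E < +oo)%E].

Definition is_magnetic_potential (R : realType) (X : choiceType)
    (o : X -> X -> R[i]) : Prop :=
  (forall x y, normc (o x y) = 1) /\ (forall x y, o x y = conjc (o y x)).

Definition nabla (R : realType) (X : choiceType) (o : X -> X -> R[i])
    (f : X -> R[i]) (z : X * X) : R[i] := f z.1 - o z.1 z.2 * f z.2.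

Definition Qform (R : realType) (X : choiceType) (b : X -> X -> R)
    (o : X -> X -> R[i]) (c : X -> R) (phi psi : X -> R[i]) : R[i] :=
  (2^-1 * csum (fun z : X * X =>
      (b z.1 z.2)%:C * nabla o phi z * conjc (nabla o psi z))
   + csum (fun x => (c x)%:C * phi x * conjc (psi x)))%C.

(* Q(phi, phi) is always real. *)
Definition Qquad (R : realType) (X : choiceType) (b : X -> X -> R)
    (o : X -> X -> R[i]) (c : X -> R) (phi : X -> R[i]) : R :=
  complex.Re (Qform b o c phi phi).

Definition Q_positive (R : realType) (X : choiceType) (b : X -> X -> R)
    (o : X -> X -> R[i]) (c : X -> R) : Prop :=
  forall phi, Cc phi -> 0 <= Qform b o c phi phi.

Definition Q_cauchy (R : realType) (X : choiceType) (b : X -> X -> R)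
    (o : X -> X -> R[i]) (c : X -> R) (phi : nat -> X -> R[i]) : Prop :=
  forall e : R, 0 < e -> exists N : nat, forall i j : nat,
    (N <= i)%N -> (N <= j)%N -> Qquad b o c (phi i - phi j) < e.

(* phi is a sequence in Cc, Cauchy for Q and converging to f in l^2. *)
Definition Q_approx (R : realType) (X : choiceType) (m : X -> R)
    (b : X -> X -> R) (o : X -> X -> R[i]) (c : X -> R)
    (phi : nat -> X -> R[i]) (f : X -> R[i]) : Prop :=
  [/\ forall n, Cc (phi n),
      Q_cauchy b o c phi
    & lpnorm m 2%:E (phi n - f) @[n --> \oo] --> 0%E].

Definition Q_closable (R : realType) (X : choiceType) (m : X -> R)
    (b : X -> X -> R) (o : X -> X -> R[i]) (c : X -> R) : Prop :=
  forall phi : nat -> X -> R[i], Q_approx m b o c phi (fun=> 0) ->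
    Qquad b o c (phi n) @[n --> \oo] --> (0 : R).

Definition Qbar_dom (R : realType) (X : choiceType) (m : X -> R)
    (b : X -> X -> R) (o : X -> X -> R[i]) (c : X -> R) : set (X -> R[i]) :=
  [set f | ell m 2%:E f /\ exists phi, Q_approx m b o c phi f].

(* The graph of the closure of Q: Qbar(f, g) = v. *)
Definition Qbar_eq (R : realType) (X : choiceType) (m : X -> R)
    (b : X -> X -> R) (o : X -> X -> R[i]) (c : X -> R)
    (f g : X -> R[i]) (v : R[i]) : Prop :=
  exists phi psi : nat -> X -> R[i],
    [/\ Q_approx m b o c phi f,
        Q_approx m b o c psi g
      & normc (Qform b o c (phi n) (psi n) - v) @[n --> \oo] --> (0 : R)].

(** Unbounded operators are represented by their graphs: [A f g] means that f
    lies in the domain of A and A f = g. *)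

Definition operator (R : realType) (X : choiceType) : Type :=
  (X -> R[i]) -> (X -> R[i]) -> Prop.

(* The self-adjoint operator on l^2 associated with the closure of Q. *)
Definition form_operator (R : realType) (X : choiceType) (m : X -> R)
    (b : X -> X -> R) (o : X -> X -> R[i]) (c : X -> R) : operator R X :=
  fun f g =>
    [/\ Qbar_dom m b o c f,
        ell m 2%:E g
      & forall psi, Qbar_dom m b o c psi ->
          Qbar_eq m b o c f psi (pairing m g psi)].

Definition opp_operator (R : realType) (X : choiceType) (A : operator R X)
  : operator R X := fun f g => A f (- g).

(* The adjoint, on l^oo, of an operator on l^1; for a densely defined A it is
   single-valued. *)
Definition adjoint_operator (R : realType) (X : choiceType) (m : X -> R)
    (A : operator R X) : operator R X :=
  fun g k =>
    [/\ ell m +oo%E g,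
        ell m +oo%E k
      & forall f h, A f h -> pairing m h g = pairing m f k].

Definition resolvent_set (R : realType) (X : choiceType) (m : X -> R)
    (p : \bar R) (A : operator R X) : set R[i] :=
  [set z |
    (forall g, ell m p g ->
       exists! f, exists2 h, A f h & (fun x => h x - z * f x) = g) /\
    exists K : R, forall f h, A f h ->
      (lpnorm m p f <= K%:E * lpnorm m p (fun x => h x - z * f x)%R)%E].

Definition spectrum (R : realType) (X : choiceType) (m : X -> R)
    (p : \bar R) (A : operator R X) : set R[i] := ~` resolvent_set m p A.

(** Semigroups; the values S t f are relevant for t >= 0 and f in l^p only. *)

Definition C0_semigroup (R : realType) (X : choiceType) (m : X -> R)
    (p : \bar R) (S : R -> (X -> R[i]) -> (X -> R[i])) : Prop :=
  [/\ (forall t : R, 0 <= t -> forall (a : R[i]) f g, ell m p f -> ell m p g ->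
         S t (fun x => a * f x + g x) = (fun x => a * S t f x + S t g x)),
      (forall t : R, 0 <= t -> exists K : R, forall f, ell m p f ->
         (lpnorm m p (S t f) <= K%:E * lpnorm m p f)%E),
      (forall f, ell m p f -> S 0 f = f),
      (forall (s t : R) f, 0 <= s -> 0 <= t -> ell m p f ->
         S (s + t) f = S s (S t f))
    & (forall f, ell m p f ->
         lpnorm m p (S t f - f) @[t --> (0 : R)^'+] --> 0%E)].

Definition generator (R : realType) (X : choiceType) (m : X -> R)
    (p : \bar R) (S : R -> (X -> R[i]) -> (X -> R[i])) : operator R X :=
  fun f g =>
    [/\ ell m p f,
        ell m p g
      & lpnorm m p (fun x => (t^-1)%:C%C * (S t f x - f x) - g x)
          @[t --> (0 : R)^'+] --> 0%E].

(* S = (e^{-tA})_{t >= 0} on l^p *)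
Definition is_exp_semigroup (R : realType) (X : choiceType) (m : X -> R)
    (p : \bar R) (A : operator R X) (S : R -> (X -> R[i]) -> (X -> R[i]))
  : Prop :=
  C0_semigroup m p S /\
  forall f g, generator m p S f g <-> opp_operator A f g.

(* S p, for 1 <= p < oo, are the consistent strongly continuous extensions to
   l^p of the semigroup e^{-tA} = S 2 on l^2. *)
Definition consistent_semigroups (R : realType) (X : choiceType) (m : X -> R)
    (A : operator R X) (S : R -> R -> (X -> R[i]) -> (X -> R[i])) : Prop :=
  [/\ is_exp_semigroup m 2%:E A (S 2),
      (forall p : R, 1 <= p -> C0_semigroup m p%:E (S p))
    & (forall (p t : R) f, 1 <= p -> 0 <= t -> ell m 2%:E f -> ell m p%:E f ->
         S p t f = S 2 t f)].

(* H_p, with -H_p the generator of S p for p < oo, and H_oo the adjoint of H_1;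
   the case -oo is never used. *)
Definition Hop (R : realType) (X : choiceType) (m : X -> R)
    (S : R -> R -> (X -> R[i]) -> (X -> R[i])) (p : \bar R) : operator R X :=
  match p with
  | r%:E => opp_operator (generator m r%:E (S r))
  | +oo => adjoint_operator m (opp_operator (generator m 1%:E (S 1%R)))
  | -oo => fun _ _ => False
  end%E.

Definition form_bounded (R : realType) (X : choiceType) (m : X -> R)
    (b : X -> X -> R) (o : X -> X -> R[i]) (c : X -> R) : Prop :=
  exists M C : R, [/\ 0 <= M, 0 <= C & forall phi, Cc phi ->
    (lpnorm m 2%:E
       (fun x => (Num.sqrt (- Num.min (c x) 0 / m x))%:C%C * phi x)%R ^+ 2
     <= M%:E * (Qquad b o c phi)%:E + C%:E * lpnorm m 2%:E phi ^+ 2)%E].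

Definition pseudo_metric (R : realType) (X : choiceType) (d : X -> X -> R)
  : Prop :=
  [/\ forall x y, 0 <= d x y,
      forall x, d x x = 0,
      forall x y, d x y = d y x
    & forall x y z, d x z <= d x y + d y z].

Definition intrinsic_metric (R : realType) (X : choiceType) (m : X -> R)
    (b : X -> X -> R) (d : X -> X -> R) : Prop :=
  pseudo_metric d /\
  forall x, (((m x)^-1)%:E *
             (\esum_(y in [set: X]) (b x y * d x y ^+ 2)%:E) <= 1)%E.

Definition jump_size (R : realType) (X : choiceType) (b : X -> X -> R)
    (d : X -> X -> R) : \bar R :=
  ereal_sup [set (d z.1 z.2)%:E | z in [set z : X * X | 0 < b z.1 z.2]].

Definition uniform_subexponential_growth (R : realType) (X : choiceType)
    (m : X -> R) (d : X -> X -> R) : Prop :=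
  forall e : R, 0 < e -> exists2 C : R, 0 < C & forall (x : X) (r : R), 0 < r ->
    (vol m [set y | (d x y <= r)%R] < (C * expR (e * r) * m x)%:E)%E.

(* Main.v *)
(** The resolvent of [H_2] at a point [z] of its resolvent set has the kernel
    [r(x, y) = ((H_2 - z)^-1 delta_y)(x)]. As the potential is form bounded and
    [d] is intrinsic with finite jump size, conjugating the form with the weight
    [exp (a d(., y))], [a] small, is a small form perturbation, and therefore
    [|r(x, y)| <= C exp (- a d(x, y)) sqrt (m y / m x)]. Subexponential growth
    makes the Schur sums of this kernel finite, so it defines a bounded operator
    on every [l^p]. This operator commutes with the semigroup [S_p] and inverts
    [H_p - z] (for [p = oo] by duality), which gives one inclusion.

    For the other one, all nonreal points belong to the resolvent set of [H_2].
    If a real [z] belongs to that of [H_p], then the resolvents at [z + i eta]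
    and [z - i eta] are bounded on [l^p] uniformly for small [eta]. They are
    adjoint to each other on [l^2], so Krein's symmetrization argument gives the
    same bound on [l^2], and a Neumann series reaches [z]. *)

From HB Require Import structures.
Require Import Defs.
From mathcomp Require Import all_boot all_order all_algebra.
From mathcomp Require Import finmap.
From mathcomp Require Import all_classical all_reals all_analysis.
From mathcomp Require Import ring lra.
Set Implicit Arguments.
Unset Strict Implicit.
Unset Printing Implicit Defensive.
Import Order.TTheory GRing.Theory Num.Theory.
Import numFieldNormedType.Exports.
Local Open Scope classical_set_scope.
Local Open Scope ring_scope.
Local Open Scope complex_scope.

(** At a real point of the resolvent set of [H_p] nothing relates the inverse on [l^p] to an
    operator on [l^2]. Hence the detour through nonreal points: there the first inclusion provides
    one kernel that is the resolvent on both spaces. Krein's argument then needs only bounds on the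
    same [l^p] for this operator and its [l^2] adjoint, so no interpolation theorem enters. The
    other delicate point is that the kernel operator maps into the domain of [H_p]. For
    [u = (H - z)^-1 f] with [f] finitely supported, the remainder [S t u - u - t g], which is the
    integral of [S s g - g] over [[0, t]], is controlled by definition in [l^2] but has to be
    estimated in [l^p]. Riemann sums converge in [l^2], hence at points, and their [l^p] bounds
    survive by a Fatou argument. In the decay estimate the weight must be bounded to preserve the
    form domain, while its bound must not enter the result. The perturbation is therefore made in an
    inf-sup inequality for the form norm, which is stable under small changes of the form. *)

Local Notation Re := complex.Re.
Local Notation Im := complex.Im.
Local Notation sqrt := Num.sqrt.

(** * Complex numbers and absolutely convergent sums *)

Section ComplexModulus.
Variable R : realType.
Implicit Types (z w : R[i]) (r : R).

Lemma normc_ge0 z : 0 <= normc z.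
Proof. by case: z => a b; exact: sqrtr_ge0. Qed.

Lemma normcE z : `|z| = (normc z)%:C.
Proof. by []. Qed.

Lemma normcD z w : normc (z + w) <= normc z + normc w.
Proof. by have := ler_normD z w; rewrite !normcE -rmorphD lecR. Qed.

Lemma normc_conj z : normc (conjc z) = normc z.
Proof. by case: z => a b /=; rewrite sqrrN. Qed.

Lemma normcM z w : normc (z * w) = normc z * normc w.
Proof. exact: Normc.normcM. Qed.

Lemma normcN z : normc (- z) = normc z.
Proof. by case: z => a b /=; rewrite !sqrrN. Qed.

Lemma normcB z w : normc (z - w) <= normc z + normc w.
Proof. by rewrite -(normcN w) normcD. Qed.

Lemma normcR r : normc r%:C = `|r|.
Proof. by rewrite /= expr0n /= addr0 sqrtr_sqr. Qed.

Lemma normcR0 r : 0 <= r -> normc r%:C = r.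
Proof. by move=> r0; rewrite normcR ger0_norm. Qed.

Lemma normc_eq0 z : (normc z == 0) = (z == 0).
Proof.
by apply/eqP/eqP => [/Normc.eq0_normc//|->]; exact: Normc.normc0.
Qed.

Lemma sqr_normc z : normc z ^+ 2 = Re z ^+ 2 + Im z ^+ 2.
Proof. by case: z => a b /=; rewrite sqr_sqrtr// addr_ge0 ?sqr_ge0. Qed.

Lemma mulcJ z : z * conjc z = (normc z ^+ 2)%:C.
Proof.
rewrite sqr_normc; case: z => a b /=.
by apply/eqP; rewrite eq_complex /=; apply/andP; split; apply/eqP; ring.
Qed.

Lemma normRe z : `|Re z| <= normc z.
Proof.
rewrite -(@ler_pXn2r _ 2) ?nnegrE ?normc_ge0// sqr_normc real_normK ?num_real//.
by rewrite lerDl sqr_ge0.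
Qed.

Lemma normIm z : `|Im z| <= normc z.
Proof.
rewrite -(@ler_pXn2r _ 2) ?nnegrE ?normc_ge0// sqr_normc real_normK ?num_real//.
by rewrite lerDr sqr_ge0.
Qed.

Lemma le_Re_normc z : Re z <= normc z.
Proof. exact: le_trans (ler_norm _) (normRe z). Qed.

Lemma normc_le_ReIm z : normc z <= `|Re z| + `|Im z|.
Proof.
rewrite -(@ler_pXn2r _ 2) ?nnegrE ?normc_ge0 ?addr_ge0//.
rewrite sqr_normc sqrrD !real_normK ?num_real// -subr_ge0.
by rewrite (_ : _ - _ = `|Re z| * `|Im z| *+ 2);
  [rewrite mulrn_wge0// mulr_ge0|ring].
Qed.

Lemma ReD z w : Re (z + w) = Re z + Re w.
Proof. by case: z w => ? ? []. Qed.
Lemma ImD z w : Im (z + w) = Im z + Im w.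
Proof. by case: z w => ? ? []. Qed.
Lemma ReN z : Re (- z) = - Re z. Proof. by case: z. Qed.
Lemma ImN z : Im (- z) = - Im z. Proof. by case: z. Qed.
Lemma ReZ r z : Re (r%:C * z) = r * Re z.
Proof. by case: z => a b /=; ring. Qed.
Lemma ImZ r z : Im (r%:C * z) = r * Im z.
Proof. by case: z => a b /=; ring. Qed.
Lemma Re_conjc z : Re (conjc z) = Re z. Proof. by case: z. Qed.
Lemma Im_conjc z : Im (conjc z) = - Im z. Proof. by case: z. Qed.

Lemma conjcD z w : conjc (z + w) = conjc z + conjc w. Proof. exact: rmorphD. Qed.
Lemma conjcB z w : conjc (z - w) = conjc z - conjc w. Proof. exact: rmorphB. Qed.
Lemma conjcN z : conjc (- z) = - conjc z. Proof. exact: rmorphN. Qed.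
Lemma conjcM z w : conjc (z * w) = conjc z * conjc w. Proof. exact: rmorphM. Qed.
Lemma conjcR r : conjc r%:C = r%:C. Proof. by rewrite /= oppr0. Qed.
Lemma normc_one : normc (1 : R[i]) = 1. Proof. exact: Normc.normc1. Qed.
Lemma normc_zero : normc (0 : R[i]) = 0. Proof. exact: Normc.normc0. Qed.

Lemma normc_sum (I : Type) (s : seq I) (u : I -> R[i]) :
  normc (\sum_(i <- s) u i) <= \sum_(i <- s) normc (u i).
Proof.
elim: s => [|a s ih]; first by rewrite !big_nil Normc.normc0.
by rewrite !big_cons (le_trans (normcD _ _))// lerD2l.
Qed.

Lemma le_all_eps (a b : R) : (forall e, 0 < e -> a <= b + e) -> a <= b.
Proof. by move=> h; apply/ler_addgt0Pr. Qed.

Lemma normc_eps_eq z w : (forall e, 0 < e -> normc (z - w) <= e) -> z = w.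
Proof.
move=> h; apply/eqP; rewrite -subr_eq0 -normc_eq0; apply/eqP/le_anti.
by rewrite normc_ge0 andbT; apply/ler_addgt0Pr => e e0; rewrite add0r h.
Qed.

End ComplexModulus.

(** * Sums over discrete sets through their finite partial sums *)

Section BoundedSums.
Variables (R : realType).
Implicit Types (T : choiceType).

(** A real bound stands in for the extended real value of the sum, so that comparing, adding and
    scaling need no finiteness side conditions. *)
Definition sumle T (u : T -> R) (B : R) : Prop :=
  forall A : {fset T}, \sum_(x <- A) u x <= B.

Lemma sumleP T (u : T -> R) B :
  (\esum_(x in [set: T]) (u x)%:E <= B%:E)%E <-> sumle u B.
Proof.
split=> [h A|h].
  rewrite -lee_fin; apply: le_trans h; apply: esum_ge.
  exists [set` A]; first by split; [exact: finite_fset|].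
  by rewrite fsbig_finite//= set_fsetK sumEFin.
apply: ge_ereal_sup => _ [A [finA _] <-].
by rewrite fsbig_finite//= sumEFin lee_fin.
Qed.

Lemma sumle_esum T (u : T -> R) : (forall x, 0 <= u x) ->
  (\esum_(x in [set: T]) (u x)%:E < +oo)%E ->
  sumle u (fine (\esum_(x in [set: T]) (u x)%:E)).
Proof.
move=> u0 h; apply/sumleP; rewrite fineK// ge0_fin_numE//.
by apply: esum_ge0 => x _; rewrite lee_fin.
Qed.

Lemma sumle_ge0 T (u : T -> R) B : sumle u B -> 0 <= B.
Proof. by move=> /(_ fset0); rewrite big_seq_fset0. Qed.

Lemma le_sumle T (u v : T -> R) B C : (forall x, u x <= v x) -> B <= C ->
  sumle v B -> sumle u C.
Proof.
move=> uv BC h A; apply: le_trans BC; apply: le_trans (h A).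
by apply: ler_sum.
Qed.

Lemma sumleD T (u v : T -> R) B C : sumle u B -> sumle v C ->
  sumle (fun x => u x + v x) (B + C).
Proof. by move=> hu hv A; rewrite big_split /= lerD. Qed.

Lemma sumleZ T (u : T -> R) B k : 0 <= k -> sumle u B ->
  sumle (fun x => k * u x) (k * B).
Proof. by move=> k0 hu A; rewrite -mulr_sumr ler_wpM2l. Qed.

Lemma sumle_pt T (u : T -> R) B x : sumle u B -> u x <= B.
Proof. by move=> /(_ [fset x]%fset); rewrite big_seq_fset1. Qed.

Lemma sub_sum_fset T (u : T -> R) (A B : {fset T}) : (forall x, 0 <= u x) ->
  (A `<=` B)%fset -> \sum_(x <- A) u x <= \sum_(x <- B) u x.
Proof.
move=> u0 AB.
rewrite [leRHS](big_fsetID _ (fun x => x \in A)) /=.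
have -> : [fset x in B | x \in A]%fset = A.
  by apply/fsetP => x; rewrite !inE /= andbC; case: (boolP (x \in A)) => //= /(fsubsetP AB).
by rewrite lerDl sumr_ge0.
Qed.

(** The bound half of Tonelli: a finite set of pairs lies in the product of its two projections,
    where the sum can be taken row by row. *)
Lemma sumle_pair T T' (k : T -> T' -> R) (f : T -> R) B :
  (forall x y, 0 <= k x y) -> (forall x, sumle (k x) (f x)) -> sumle f B ->
  sumle (fun z : T * T' => k z.1 z.2) B.
Proof.
move=> k0 kf fB A.
pose A1 := [fset z.1 | z in A]%fset; pose A2 := [fset z.2 | z in A]%fset.
apply: le_trans (fB A1).
have AA : (A `<=` [fset z | z in [seq (x, y) | x <- A1, y <- A2]])%fset.
  apply/fsubsetP => -[x y] h; rewrite !inE /=; apply/allpairsP; exists (x, y).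
  split=> //=; apply/imfsetP; by exists (x, y).
apply: le_trans (sub_sum_fset _ AA) _; first by move=> z.
rewrite (perm_big [seq (x, y) | x <- A1, y <- A2]) /=; last first.
  apply: uniq_perm; rewrite ?fset_uniq//.
    by rewrite allpairs_uniq ?fset_uniq// => -[? ?] [? ?] _ _ [-> ->].
  by move=> z; rewrite !inE.
by rewrite big_allpairs_dep /=; apply: ler_sum => x _; exact: kf.
Qed.

Lemma sumle_swap T T' (k : T * T' -> R) B :
  sumle k B -> sumle (fun z : T' * T => k (z.2, z.1)) B.
Proof.
move=> h A; apply: le_trans (h [fset (z.2, z.1) | z in A]%fset).
by rewrite big_imfset //= => -[? ?] [? ?] _ _ [-> ->].
Qed.

Definition summ T (u : T -> R[i]) : Prop := exists B, sumle (fun x => normc (u x)) B.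

(** Convergence of the net of finite partial sums. Algebraic rules are proved for this relation and
    carried to [csum] by [csum_eq], which keeps the junk values of [csum] out of the way. *)
Definition has_sum T (u : T -> R[i]) (L : R[i]) : Prop :=
  forall e : R, 0 < e -> exists A : {fset T}, forall B : {fset T},
    (A `<=` B)%fset -> normc (\sum_(x <- B) u x - L) <= e.

Lemma has_sum_uniq T (u : T -> R[i]) L L' : has_sum u L -> has_sum u L' -> L = L'.
Proof.
move=> h h'; apply: normc_eps_eq => e e0.
have e2 : 0 < e / 2 by rewrite divr_gt0.
have [A hA] := h _ e2; have [A' hA'] := h' _ e2.
have H := hA (A `|` A')%fset (fsubsetUl _ _).
have H' := hA' (A `|` A')%fset (fsubsetUr _ _).
rewrite (_ : L - L' = (\sum_(x <- (A `|` A')%fset) u x - L')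
   - (\sum_(x <- (A `|` A')%fset) u x - L)); last by ring.
by rewrite (le_trans (normcB _ _))// [leRHS](splitr e) lerD.
Qed.

Lemma has_sumD T (u v : T -> R[i]) L L' : has_sum u L -> has_sum v L' ->
  has_sum (fun x => u x + v x) (L + L').
Proof.
move=> h h' e e0.
have e2 : 0 < e / 2 by rewrite divr_gt0.
have [A hA] := h _ e2; have [A' hA'] := h' _ e2.
exists (A `|` A')%fset => B; rewrite fsubUset => /andP[AB AB'].
rewrite big_split /= opprD addrACA (le_trans (normcD _ _))//.
by rewrite [leRHS](splitr e) lerD ?hA ?hA'.
Qed.

Lemma has_sumZ T (u : T -> R[i]) L a : has_sum u L ->
  has_sum (fun x => a * u x) (a * L).
Proof.
move=> h e e0.
have n0 : 0 < normc a + 1 by rewrite ltr_wpDl ?normc_ge0.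
have [A hA] := h _ (divr_gt0 e0 n0).
exists A => B AB; rewrite -mulr_sumr -mulrBr normcM.
apply: le_trans (ler_wpM2l (normc_ge0 _) (hA _ AB)) _.
by rewrite mulrCA ler_piMr ?(ltW e0)// ler_pdivrMr// mul1r lerDl.
Qed.

Lemma has_sum_conj T (u : T -> R[i]) L : has_sum u L ->
  has_sum (fun x => conjc (u x)) (conjc L).
Proof.
move=> h e e0; have [A hA] := h _ e0; exists A => B AB.
by rewrite -rmorph_sum -rmorphB normc_conj hA.
Qed.

Lemma has_sum_le T (u : T -> R[i]) L B : has_sum u L ->
  sumle (fun x => normc (u x)) B -> normc L <= B.
Proof.
move=> h hB; apply: le_all_eps => e e0; have [A hA] := h _ e0.
rewrite (_ : L = \sum_(x <- A) u x - (\sum_(x <- A) u x - L)); last by ring.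
apply: le_trans (normcB _ _) _; apply: lerD; last exact: hA.
exact: le_trans (normc_sum _ _) (hB A).
Qed.

Lemma has_sum_finite T (u : T -> R[i]) (A : {fset T}) :
  (forall x, x \notin A -> u x = 0) -> has_sum u (\sum_(x <- A) u x).
Proof.
move=> h e e0; exists A => B AB; rewrite -(big_fset_incl _ AB) ?subrr ?Normc.normc0 ?(ltW e0)//.
by move=> x _ /h.
Qed.

Lemma esum_approx T (u : T -> R) B : (forall x, 0 <= u x) -> sumle u B ->
  forall e : R, 0 < e -> exists A : {fset T}, forall C : {fset T},
    (A `<=` C)%fset ->
    `|\sum_(x <- C) u x - fine (\esum_(x in [set: T]) (u x)%:E)| <= e.
Proof.
move=> u0 uB e e0.
have E0 : (0 <= \esum_(x in [set: T]) (u x)%:E)%E.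
  by apply: esum_ge0 => x _; rewrite lee_fin.
have Efin : (\esum_(x in [set: T]) (u x)%:E)%E \is a fin_num.
  by rewrite ge0_fin_numE//; apply: le_lt_trans (_ : (B%:E < +oo)%E);
    [apply/sumleP|rewrite ltry].
have le1 : sumle u (fine (\esum_(x in [set: T]) (u x)%:E)).
  by apply/sumleP; rewrite fineK.
have : exists A : {fset T},
    fine (\esum_(x in [set: T]) (u x)%:E) - e <= \sum_(x <- A) u x.
  apply: contrapT => /forallNP H.
  have : sumle u (fine (\esum_(x in [set: T]) (u x)%:E) - e).
    by move=> A; have /negP := H A; rewrite -ltNge => /ltW.
  by move=> /sumleP; rewrite -[X in (X <= _)%E](fineK Efin) lee_fin; lra.
move=> [A hA]; exists A => C AC.
rewrite ler_distl; apply/andP; split; last first.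
  by rewrite (le_trans (le1 C))// lerDl ltW.
by apply: le_trans hA _; exact: sub_sum_fset.
Qed.

(** Positive and negative parts are both bounded by [B], so the difference in [rsum] is one of
    finite numbers and each part can be approximated separately. *)
Lemma rsumE T (u : T -> R) B : sumle (fun x => `|u x|) B ->
  forall e : R, 0 < e -> exists A : {fset T}, forall C : {fset T},
    (A `<=` C)%fset -> `|\sum_(x <- C) u x - rsum u| <= e.
Proof.
move=> uB e e0.
pose up x : R := Num.max (u x) 0; pose um x : R := Num.max (- u x) 0.
have hp x : 0 <= up x by rewrite le_max lexx orbT.
have hm x : 0 <= um x by rewrite le_max lexx orbT.
have sp : sumle up B.
  by apply: le_sumle uB => // x; rewrite /up ge_max normr_ge0 ler_norm.
have sm : sumle um B.
  by apply: le_sumle uB => // x; rewrite /um ge_max normr_ge0 -normrN ler_norm.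
have e2 : 0 < e / 2 by rewrite divr_gt0.
have [A1 h1] := esum_approx hp sp e2; have [A2 h2] := esum_approx hm sm e2.
have fin (v : T -> R) : (forall x, 0 <= v x) -> sumle v B ->
    (\esum_(x in [set: T]) (v x)%:E)%E \is a fin_num.
  move=> v0 vB; rewrite ge0_fin_numE; last first.
    by apply: esum_ge0 => x _; rewrite lee_fin.
  by apply: le_lt_trans (_ : (B%:E < +oo)%E); [apply/sumleP|rewrite ltry].
have rE : rsum u = fine (\esum_(x in [set: T]) (up x)%:E)
                 - fine (\esum_(x in [set: T]) (um x)%:E).
  have Ep : esum [set: T] ((EFin \o u)^\+)%E = \esum_(x in [set: T]) (up x)%:E.
    by apply: eq_esum => x _; rewrite funeposE /= EFin_max.
  have Em : esum [set: T] ((EFin \o u)^\-)%E = \esum_(x in [set: T]) (um x)%:E.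
    by apply: eq_esum => x _; rewrite funenegE /= EFin_max.
  by rewrite /rsum Ep Em fineB//; exact: fin.
exists (A1 `|` A2)%fset => C; rewrite fsubUset => /andP[C1 C2]; rewrite rE.
have -> : \sum_(x <- C) u x = \sum_(x <- C) up x - \sum_(x <- C) um x.
  rewrite -sumrB; apply: eq_bigr => x _; rewrite /up /um.
  by case: (leP (u x) 0) => h; [rewrite max_l ?oppr_ge0//|rewrite max_r]; lra.
have := h1 _ C1; have := h2 _ C2; rewrite !ler_norml => /andP[? ?] /andP[? ?].
by apply/andP; split; lra.
Qed.

Lemma csum_has_sum T (u : T -> R[i]) : summ u -> has_sum u (csum u).
Proof.
move=> [B uB] e e0.
have e2 : 0 < e / 2 by rewrite divr_gt0.
have [|A1 h1] := @rsumE _ (fun x => Re (u x)) B _ _ e2.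
  by apply: le_sumle uB => // x; exact: normRe.
have [|A2 h2] := @rsumE _ (fun x => Im (u x)) B _ _ e2.
  by apply: le_sumle uB => // x; exact: normIm.
exists (A1 `|` A2)%fset => C; rewrite fsubUset => /andP[C1 C2].
apply: le_trans (normc_le_ReIm _) _; rewrite [leRHS](splitr e).
have rRe : Re (\sum_(x <- C) u x) = \sum_(x <- C) Re (u x).
  by elim/big_rec2: _ => //= x a b _ <-; rewrite ReD.
have rIm : Im (\sum_(x <- C) u x) = \sum_(x <- C) Im (u x).
  by elim/big_rec2: _ => //= x a b _ <-; rewrite ImD.
by apply: lerD; rewrite ?ReD ?ImD ?ReN ?ImN /= ?rRe ?rIm ?h1 ?h2.
Qed.

Lemma csum_eq T (u : T -> R[i]) L : summ u -> has_sum u L -> csum u = L.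
Proof. by move=> su; apply: has_sum_uniq; exact: csum_has_sum. Qed.

Lemma summD T (u v : T -> R[i]) : summ u -> summ v -> summ (fun x => u x + v x).
Proof.
move=> [B hB] [C hC]; exists (B + C); apply: le_sumle (sumleD hB hC) => // x /=.
exact: normcD.
Qed.

Lemma summZ T (u : T -> R[i]) a : summ u -> summ (fun x => a * u x).
Proof.
move=> [B hB]; exists (normc a * B).
by apply: le_sumle (sumleZ (normc_ge0 a) hB) => // x /=; rewrite normcM.
Qed.

Lemma summ_conj T (u : T -> R[i]) : summ u -> summ (fun x => conjc (u x)).
Proof.
by move=> [B hB]; exists B; apply: le_sumle hB => // x /=; rewrite normc_conj.
Qed.

Lemma summ_finite T (u : T -> R[i]) (A : {fset T}) :
  (forall x, x \notin A -> u x = 0) -> summ u.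
Proof.
move=> h; exists (\sum_(x <- A) normc (u x)) => B.
rewrite (big_fsetID _ (fun x => x \in A)) /= [X in _ + X]big1_fset; last first.
  by move=> x; rewrite !inE /= => /andP[_ /h ->]; rewrite Normc.normc0.
rewrite addr0; apply: sub_sum_fset => [x|]; first exact: normc_ge0.
by apply/fsubsetP => x; rewrite !inE /= => /andP[].
Qed.

Lemma csumD T (u v : T -> R[i]) : summ u -> summ v ->
  csum (fun x => u x + v x) = csum u + csum v.
Proof.
move=> su sv; apply: csum_eq; first exact: summD.
by apply: has_sumD; exact: csum_has_sum.
Qed.

Lemma csumZ T (u : T -> R[i]) a : summ u ->
  csum (fun x => a * u x) = a * csum u.
Proof.
move=> su; apply: csum_eq; first exact: summZ.
by apply: has_sumZ; exact: csum_has_sum.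
Qed.

Lemma csum_conj T (u : T -> R[i]) : summ u ->
  csum (fun x => conjc (u x)) = conjc (csum u).
Proof.
move=> su; apply: csum_eq; first exact: summ_conj.
by apply: has_sum_conj; exact: csum_has_sum.
Qed.

Lemma csum_le T (u : T -> R[i]) B : sumle (fun x => normc (u x)) B ->
  normc (csum u) <= B.
Proof.
by move=> h; apply: (has_sum_le _ h); apply: csum_has_sum; exists B.
Qed.

Lemma csum_finite T (u : T -> R[i]) (A : {fset T}) :
  (forall x, x \notin A -> u x = 0) -> csum u = \sum_(x <- A) u x.
Proof.
move=> h; apply: csum_eq; first exact: summ_finite h.
exact: has_sum_finite.
Qed.

Lemma csum1 T (u : T -> R[i]) x : (forall y, y != x -> u y = 0) -> csum u = u x.
Proof.
move=> h; rewrite (@csum_finite _ _ [fset x]%fset) ?big_seq_fset1// => y.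
by rewrite inE; exact: h.
Qed.

Lemma eq_csum T (u v : T -> R[i]) : u =1 v -> csum u = csum v.
Proof. by move=> /funext ->. Qed.

(** Replaces an arbitrary bound by the sharp one; this recovers the [l^2] norm and the energy from
    [csum]. *)
Lemma sumle_csum T (v : T -> R) B : (forall x, 0 <= v x) -> sumle v B ->
  sumle v (Re (csum (fun x => (v x)%:C))).
Proof.
move=> v0 vB A; apply: le_all_eps => e e0.
have [|D hD] := @csum_has_sum _ (fun x => (v x)%:C) _ _ e0.
  by exists B; apply: le_sumle vB => // x; rewrite /= expr0n addr0 sqrtr_sqr ger0_norm.
have := hD (A `|` D)%fset (fsubsetUr _ _).
have -> : \sum_(x <- (A `|` D)%fset) (v x)%:C = (\sum_(x <- (A `|` D)%fset) v x)%:C.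
  by rewrite rmorph_sum.
move=> /(le_trans (le_Re_normc _)); rewrite ReD ReN /= => h.
have := sub_sum_fset v0 (fsubsetUl A D); lra.
Qed.

End BoundedSums.

(** * Convexity of powers *)

Section PowerInequalities.
Variable R : realType.

Lemma powR_tangent (r a t : R) : 1 <= r -> 0 < a -> 0 <= t ->
  r * a `^ (r - 1) * t <= t `^ r + (r - 1) * a `^ r.
Proof.
rewrite le_eqVlt => /orP[/eqP<-|r1] a0 t0.
  by rewrite subrr powRr0 powRr1// mul0r addr0 !mul1r.
have r0 : 0 < r by lra.
have r10 : 0 < r - 1 by lra.
have q0 : 0 < r / (r - 1) by rewrite divr_gt0.
have := @conjugate_powR _ t (a `^ (r - 1)) r (r / (r - 1)) t0 (powR_ge0 _ _) r0 q0.
have -> : r^-1 + (r / (r - 1))^-1 = 1 by field; rewrite !gt_eqF.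
rewrite -powRrM (_ : (r - 1) * (r / (r - 1)) = r); last by field; rewrite gt_eqF.
move=> /(_ erefl) h; have := ler_wpM2l (ltW r0) h.
rewrite (_ : r * (t * _) = r * a `^ (r - 1) * t); last by ring.
move=> /le_trans; apply; rewrite le_eqVlt; apply/orP; left; apply/eqP.
by field; rewrite !gt_eqF.
Qed.

(** Average the tangent inequalities of [u] and [v] taken at their mean [a]; the case [a = 0], where
    there is no tangent inequality, is separate. *)
Lemma powR_convex (r l u v : R) : 1 <= r -> 0 <= l -> l <= 1 ->
  0 <= u -> 0 <= v ->
  (l * u + (1 - l) * v) `^ r <= l * u `^ r + (1 - l) * v `^ r.
Proof.
move=> r1 l0 l1 u0 v0; set a := l * u + (1 - l) * v.
have a0 : 0 <= a by rewrite addr_ge0// mulr_ge0// subr_ge0.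
have r0 : r != 0 by rewrite gt_eqF//; lra.
move: a0; rewrite le_eqVlt => /orP[/eqP a0|a0].
  by rewrite -a0 powR0// addr_ge0// mulr_ge0// ?powR_ge0// subr_ge0.
have h1 := ler_wpM2l l0 (powR_tangent r1 a0 u0).
have l10 : 0 <= 1 - l by rewrite subr_ge0.
have h2 := ler_wpM2l l10 (powR_tangent r1 a0 v0).
have e : a `^ r = a `^ (r - 1) * a.
  by rewrite mulrC mulr_powRB1 ?(ltW a0)//; lra.
have := lerD h1 h2; rewrite e; move: (a `^ (r - 1)) => P.
rewrite /a => h; lra.
Qed.

End PowerInequalities.

(** * Limits in epsilon-delta form *)

Section EpsilonDelta.
Variable R : realType.

Lemma ecvg0P (T : Type) (F : set_system T) {FF : Filter F} (u : T -> \bar R) :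
  (forall t, (0 <= u t)%E) ->
  (u @ F --> 0%E) <-> (forall e : R, 0 < e -> \forall t \near F, (u t <= e%:E)%E).
Proof.
move=> u0; split=> [/fine_cvgP[fin cv] e e0|h].
  move/cvgrPdist_le: cv => /(_ e e0) cv.
  near=> t; have ft : u t \is a fin_num by near: t.
  rewrite -(fineK ft) lee_fin.
  suff : `|0 - fine (u t)| <= e by rewrite sub0r normrN; apply: le_trans; exact: ler_norm.
  by near: t.
apply/fine_cvgP; split.
  have := h _ ltr01; apply: filterS => t ut; rewrite ge0_fin_numE//.
  by rewrite (le_lt_trans ut)// ltry.
apply/cvgrPdist_le => e e0; have := h _ e0; apply: filterS => t ut /=.
have ft : u t \is a fin_num by rewrite ge0_fin_numE// (le_lt_trans ut)// ltry.
rewrite sub0r normrN ger0_norm; last exact: fine_ge0.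
by rewrite -lee_fin fineK.
Unshelve. all: by end_near.
Qed.

Lemma near_right0 (P : R -> Prop) : (\forall t \near (0 : R)^'+, P t) <->
  exists2 d, 0 < d & forall t, 0 < t -> t < d -> P t.
Proof.
split=> [|[d d0 h]].
  rewrite near_withinE => /nbhs_ballP[d /= d0 h]; exists d => // t t0 td.
  by apply: h => //; rewrite /ball /= sub0r normrN gtr0_norm.
near=> t; apply: h; near: t; [exact: nbhs_right_gt|exact: nbhs_right_lt].
Unshelve. all: by end_near.
Qed.

Lemma near_oo (P : nat -> Prop) : (\forall n \near \oo, P n) <->
  exists N, forall n, (N <= n)%N -> P n.
Proof. by split=> [[N _ h]|[N h]]; [exists N|exists N]. Qed.

Lemma exp_small (q c : R) : 0 <= q -> q < 1 -> 0 < c -> exists n, q ^+ n <= c.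
Proof.
move=> q0 q1 c0; have : `|q| < 1 by rewrite ger0_norm.
move=> /cvg_expr /cvgrPdist_le /(_ _ c0) /near_oo[N hN]; exists N.
by have := hN N (leqnn N); rewrite sub0r normrN; apply: le_trans; exact: ler_norm.
Qed.

Lemma expr_unbounded (q c : R) : 1 < q -> exists n, c < q ^+ n.
Proof.
move=> q1; have q0 : 0 < q by lra.
have c0 : 0 < `|c| + 1 by rewrite ltr_wpDl.
have qi : 0 <= q^-1 by rewrite invr_ge0 ltW.
have qi1 : q^-1 < 1 by rewrite invf_lt1.
have [n] : exists n, q^-1 ^+ n <= (`|c| + 1)^-1.
  by apply: exp_small; rewrite ?invr_gt0.
rewrite exprVn lef_pV2 ?posrE ?exprn_gt0// => h; exists n.
by apply: lt_le_trans h; rewrite (le_lt_trans (ler_norm c))// ltrDl.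
Qed.

End EpsilonDelta.

Section Discriminant.
Variable R : realType.

(* Cauchy-Schwarz in the form needed for almost minimizers: if [F f] is within
   [D] of the infimum over the line f + t g, then its derivative is small. *)
Lemma quad_discriminant (L : R[i]) (D a : R) : 0 <= a ->
  (forall t : R[i], 0 <= D + 2 * Re (conjc t * L) + normc t ^+ 2 * a) ->
  normc L ^+ 2 <= D * a.
Proof.
(* Only [t = - r L] with [r] real matters. Below, [r = 1 / a] is optimal if [a > 0]; if [a = 0], the
   choice [r = (D + 1) / |L|^2] contradicts [L <> 0]. *)
move=> a0 h; have key r : 0 <= D - 2 * r * normc L ^+ 2 + r ^+ 2 * normc L ^+ 2 * a.
  have := h (- r%:C * L); rewrite conjcM conjcN conjcR -mulrA (mulrC (conjc L)).
  rewrite mulcJ normcM normcN normcR exprMn real_normK ?num_real// mulNr.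
  rewrite ReN ReZ /=; lra.
have D0 : 0 <= D by have := key 0; rewrite expr0n /=; lra.
move: a0; rewrite le_eqVlt => /orP[/eqP a00|a0].
  rewrite -a00 mulr0; have := key ((D + 1) / normc L ^+ 2).
  have [->|n0] := eqVneq (normc L) 0; first by rewrite expr0n.
  have n1 : normc L ^+ 2 != 0 by rewrite expf_neq0.
  rewrite -a00 mulr0 addr0 -mulrA divfK//; lra.
have := key a^-1; rewrite exprVn.
have -> : a ^- 2 * normc L ^+ 2 * a = normc L ^+ 2 / a by field; rewrite gt_eqF.
have -> : 2 * a^-1 * normc L ^+ 2 = 2 * (normc L ^+ 2 / a) by field; rewrite gt_eqF.
move=> h1; have : normc L ^+ 2 / a <= D by lra.
by rewrite ler_pdivrMr.
Qed.

End Discriminant.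

(** * Cauchy sequences of numbers, uniformity on finite sets *)

Section CauchySequences.
Variable R : realType.

Lemma real_cauchy (v : nat -> R) :
  (forall e, 0 < e -> exists N, forall i j, (N <= i)%N -> (N <= j)%N ->
     `|v i - v j| <= e) ->
  exists l, forall e, 0 < e -> exists N, forall i, (N <= i)%N -> `|v i - l| <= e.
Proof.
(* The limit is the supremum of the eventual lower bounds, that is, the lower limit. *)
move=> h; pose S := [set a | exists N, forall i, (N <= i)%N -> a <= v i].
have key e N : (forall i j, (N <= i)%N -> (N <= j)%N -> `|v i - v j| <= e) ->
    S (v N - e) /\ ubound S (v N + e).
  move=> H; split.
    by exists N => i Ni; have := H _ _ (leqnn N) Ni; rewrite ler_norml => /andP[]; lra.
  move=> a [M hM]; have := hM _ (leq_maxr N M).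
  have := H _ _ (leq_maxl N M) (leqnn N); rewrite ler_norml => /andP[]; lra.
have supS : has_sup S.
  have [N hN] := h 1 ltr01; have [h1 h2] := key _ _ hN.
  by split; [exists (v N - 1)|exists (v N + 1)].
exists (sup S) => e e0; have e2 : 0 < e / 2 by rewrite divr_gt0.
have [N hN] := h _ e2; have [h1 h2] := key _ _ hN; exists N => i Ni.
have a1 : v N - e / 2 <= sup S by exact: sup_upper_bound.
have a2 : sup S <= v N + e / 2 by exact: ge_sup supS.1 _.
have := hN _ _ Ni (leqnn N); rewrite !ler_norml => /andP[? ?].
by apply/andP; split; lra.
Qed.

Lemma complex_cauchy (v : nat -> R[i]) :
  (forall e, 0 < e -> exists N, forall i j, (N <= i)%N -> (N <= j)%N ->
     normc (v i - v j) <= e) ->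
  exists l, forall e, 0 < e -> exists N, forall i, (N <= i)%N ->
     normc (v i - l) <= e.
Proof.
move=> h.
have [|a ha] := @real_cauchy (fun n => Re (v n)).
  move=> e /h[N hN]; exists N => i j Ni Nj; apply: le_trans (hN _ _ Ni Nj).
  by rewrite -ReN -ReD normRe.
have [|b hb] := @real_cauchy (fun n => Im (v n)).
  move=> e /h[N hN]; exists N => i j Ni Nj; apply: le_trans (hN _ _ Ni Nj).
  by rewrite -ImN -ImD normIm.
exists (a +i* b)%C => e e0; have e2 : 0 < e / 2 by rewrite divr_gt0.
have [N hN] := ha _ e2; have [M hM] := hb _ e2.
exists (maxn N M) => i; rewrite geq_max => /andP[Ni Mi].
apply: le_trans (normc_le_ReIm _) _; rewrite [leRHS](splitr e).
by apply: lerD; rewrite ?ReD ?ImD ?ReN ?ImN /= ?hN ?hM.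
Qed.

Lemma ptwise_fset (T : choiceType) (u : nat -> T -> R[i]) f :
  (forall x e, 0 < e -> exists N, forall i, (N <= i)%N -> normc (u i x - f x) <= e) ->
  forall (A : {fset T}) e, 0 < e -> exists N, forall i, (N <= i)%N ->
    forall x, x \in A -> normc (u i x - f x) <= e.
Proof.
move=> h A e e0; elim/fset1U_rect: A => [|y A yA [N hN]]; first by exists 0%N.
have [M hM] := h y _ e0; exists (maxn N M) => i; rewrite geq_max => /andP[Ni Mi] x.
by rewrite !inE => /orP[/eqP->|]; [exact: hM|exact: hN].
Qed.

End CauchySequences.

(** * The spaces [l^p(X, m)] *)

Section WeightedSpace.
Variables (R : realType) (X : choiceType) (m : X -> R).
Hypothesis m_gt0 : forall x, 0 < m x.
(* On the empty type the l^oo norm would be [-oo]. *)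
Variable x0 : X.
Local Notation fn := (X -> R[i]).
Local Notation ell2 := (ell m 2%:E).

Let le12 : (1 <= 2%:E :> \bar R)%E. Proof. by rewrite lee_fin ler1n. Qed.

Implicit Types (f g h phi psi : X -> R[i]) (p : \bar R) (r B C : R).

(** Norms are handled through real upper bounds; [nb_rE] and [nb_yE] turn them into bounds of finite
    sums or of values, and membership in [l^p] is the existence of a bound. *)
Definition nb p f B : Prop := (lpnorm m p f <= B%:E)%E.
Local Notation nb2 := (nb 2%:E).

Lemma nb_rE r f B : 1 <= r -> 0 <= B ->
  nb r%:E f B <-> sumle (fun x => m x * normc (f x) `^ r) (B `^ r).
Proof.
move=> r1 B0; have r0 : 0 < r by lra.
have E0 : (0 <= \esum_(x in [set: X]) (m x * normc (f x) `^ r)%:E)%E.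
  by apply: esum_ge0 => x _; rewrite lee_fin mulr_ge0 ?powR_ge0// ltW.
rewrite -sumleP /nb /lpnorm; set E := (\esum_(x in _) _)%E in E0 *.
have ir0 : 0 <= r^-1 by rewrite invr_ge0 ltW.
split=> h.
  have := gt0_ler_poweR (ltW r0) _ _ h.
  rewrite !in_itv/= !leey !andbT poweR_ge0 lee_fin B0 => /(_ isT isT).
  by rewrite -poweRrM mulVf ?gt_eqF// poweRe1.
have := gt0_ler_poweR ir0 _ _ h.
rewrite !in_itv/= !leey !andbT E0 lee_fin powR_ge0 => /(_ isT isT).
by rewrite -powRrM mulfV ?gt_eqF// powRr1.
Qed.

Lemma nb_yE f B : nb +oo%E f B <-> forall x, normc (f x) <= B.
Proof.
split=> [h x|h].
  by rewrite -lee_fin; apply: le_trans h; apply: ereal_sup_ubound; exists x.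
by apply: ge_ereal_sup => _ [x _ <-]; rewrite lee_fin.
Qed.

Lemma lpnorm_ge0 p f : (0 <= lpnorm m p f)%E.
Proof.
case: p => [r| |] /=; [exact: poweR_ge0| |by []].
apply: le_trans (_ : ((normc (f x0))%:E <= _)%E); first by rewrite lee_fin normc_ge0.
by apply: ereal_sup_ubound; exists x0.
Qed.

Lemma nb_ge0 p f B : nb p f B -> 0 <= B.
Proof. by move=> h; rewrite -lee_fin (le_trans (lpnorm_ge0 p f)). Qed.

Lemma ellP p f : ell m p f <-> exists B, nb p f B.
Proof.
split=> [h|[B h]]; last by rewrite /ell /= (le_lt_trans h)// ltry.
exists (fine (lpnorm m p f)); rewrite /nb fineK// ge0_fin_numE//.
exact: lpnorm_ge0.
Qed.

Lemma nb_norm p f B : nb p f B -> lpnorm m p f = (fine (lpnorm m p f))%:E.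
Proof.
move=> h; rewrite fineK// ge0_fin_numE ?lpnorm_ge0//.
by rewrite (le_lt_trans h)// ltry.
Qed.

Lemma nb_self p f : ell m p f -> nb p f (fine (lpnorm m p f)).
Proof. by move=> /ellP[B /nb_norm h]; rewrite /nb -h. Qed.

Lemma nbW p f B C : B <= C -> nb p f B -> nb p f C.
Proof. by move=> BC /le_trans; apply; rewrite lee_fin. Qed.

Lemma nb_closed p f B : (forall e, 0 < e -> nb p f (B + e)) -> nb p f B.
Proof.
move=> h; rewrite /nb; have := nb_norm (h _ ltr01) => E; rewrite E lee_fin.
by apply/ler_addgt0Pr => e /h; rewrite /nb E lee_fin.
Qed.

Section fixed_exponent.
Variable p : \bar R.
Hypothesis p1 : (1 <= p)%E.

Lemma pP : (exists2 r, p = r%:E & 1 <= r) \/ p = +oo%E.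
Proof. by case: p p1 => [r| |]// h; [left; exists r; rewrite -?lee_fin|right]. Qed.

Lemma le_nb f g B : (forall x, normc (f x) <= normc (g x)) ->
  nb p g B -> nb p f B.
Proof.
move=> fg h; have B0 := nb_ge0 h; move: h; case: pP => [[r -> r1]| ->].
  move=> /(nb_rE _ r1 B0) h; apply/(nb_rE _ r1 B0); apply: le_sumle h => // x.
  rewrite ler_wpM2l ?(ltW (m_gt0 _))// ge0_ler_powR ?nnegrE ?normc_ge0//; lra.
by move=> /nb_yE h; apply/nb_yE => x; exact: le_trans (fg x) (h x).
Qed.

Lemma eq_nb f g B : (forall x, f x = g x) -> nb p g B -> nb p f B.
Proof. by move=> /funext ->. Qed.

Lemma nb0 : nb p (fun=> 0) 0.
Proof.
case: pP => [[r -> r1]| ->]; last by apply/nb_yE => x; rewrite Normc.normc0.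
apply/(nb_rE _ r1) => // A; rewrite Normc.normc0 powR0; last by rewrite gt_eqF//; lra.
by rewrite big1// => x _; rewrite mulr0.
Qed.

Lemma nbZ f B a : nb p f B -> nb p (fun x => a * f x) (normc a * B).
Proof.
move=> h; have B0 := nb_ge0 h; move: h; case: pP => [[r -> r1]| ->]; last first.
  move=> /nb_yE h; apply/nb_yE => x; rewrite normcM.
  by rewrite ler_wpM2l// normc_ge0.
have aB0 : 0 <= normc a * B by rewrite mulr_ge0// normc_ge0.
move=> /(nb_rE _ r1 B0) h; apply/(nb_rE _ r1 aB0).
rewrite powRM ?normc_ge0//; apply: le_sumle (sumleZ (powR_ge0 _ _) h) => // x.
by rewrite normcM powRM ?normc_ge0// mulrCA.
Qed.

Lemma nbN f B : nb p f B -> nb p (fun x => - f x) B.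
Proof. by apply: le_nb => x; rewrite normcN. Qed.

(** Minkowski: [(f + g) / (B + C)] is the convex combination of [f / B] and [g / C], both in the
    unit ball, with weights [B / (B + C)] and [C / (B + C)]. Dividing requires positive bounds;
    [nbD] removes this by enlarging them. *)
Let nbD_pos f g B C : 0 < B -> 0 < C -> nb p f B -> nb p g C ->
  nb p (fun x => f x + g x) (B + C).
Proof.
move=> B0 C0; case: pP => [[r -> r1]| ->]; last first.
  move=> /nb_yE hf /nb_yE hg; apply/nb_yE => x.
  by rewrite (le_trans (normcD _ _))// lerD.
have S0 : 0 < B + C by rewrite addr_gt0.
move=> /(nb_rE _ r1 (ltW B0)) hf /(nb_rE _ r1 (ltW C0)) hg.
apply/(nb_rE _ r1 (ltW S0)).
pose l := B / (B + C).
have l0 : 0 <= l by rewrite divr_ge0 ?ltW.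
have l1 : l <= 1 by rewrite ler_pdivrMr// mul1r lerDl ltW.
have l10 : 0 <= 1 - l by rewrite subr_ge0.
have lE : 1 - l = C / (B + C) by rewrite /l; field; rewrite gt_eqF.
have Sr : 0 <= (B + C) `^ r by exact: powR_ge0.
have lB : 0 <= l / B `^ r by rewrite divr_ge0 ?powR_ge0.
have lC : 0 <= (1 - l) / C `^ r by rewrite divr_ge0 ?powR_ge0.
have cf := sumleZ lB hf.
have cg := sumleZ lC hg.
apply: le_sumle (sumleZ Sr (sumleD cf cg)); last first.
  by rewrite !divfK ?gt_eqF ?powR_gt0// subrKC mulr1.
move=> x /=; have r0 : 0 <= r by lra.
have h1 : normc (f x + g x) `^ r <= (normc (f x) + normc (g x)) `^ r.
  by rewrite ge0_ler_powR ?nnegrE ?addr_ge0 ?normc_ge0// normcD.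
have h2 := @powR_convex R r l (normc (f x) / B) (normc (g x) / C) r1 l0 l1.
have {}h2 := h2 (divr_ge0 (normc_ge0 _) (ltW B0)) (divr_ge0 (normc_ge0 _) (ltW C0)).
have e : normc (f x) + normc (g x) =
    (B + C) * (l * (normc (f x) / B) + (1 - l) * (normc (g x) / C)).
  by rewrite lE /l; field; rewrite !gt_eqF.
have s0 : 0 <= l * (normc (f x) / B) + (1 - l) * (normc (g x) / C).
  by rewrite addr_ge0// mulr_ge0// divr_ge0 ?normc_ge0 ?ltW.
rewrite e (powRM _ (ltW S0) s0) in h1.
apply: le_trans (ler_wpM2l (ltW (m_gt0 x)) h1) _.
rewrite mulrCA ler_wpM2l//; apply: le_trans (ler_wpM2l (ltW (m_gt0 x)) h2) _.
have dE a b : 0 <= a -> 0 < b -> (a / b) `^ r = a `^ r / b `^ r.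
  move=> a0 b0; apply: (@mulIf _ (b `^ r)); first by rewrite gt_eqF ?powR_gt0.
  rewrite -(powRM _ (divr_ge0 a0 (ltW b0)) (ltW b0)) divfK ?gt_eqF//.
  by rewrite divfK// gt_eqF// powR_gt0.
by rewrite !dE ?normc_ge0// le_eqVlt; apply/orP; left; apply/eqP; ring.
Qed.

Lemma nbD f g B C : nb p f B -> nb p g C -> nb p (fun x => f x + g x) (B + C).
Proof.
move=> hf hg; have B0 := nb_ge0 hf; have C0 := nb_ge0 hg.
apply: nb_closed => e e0.
rewrite (_ : B + C + e = (B + e / 2) + (C + e / 2)); last by field.
have e2 : 0 < e / 2 by rewrite divr_gt0.
by apply: nbD_pos; rewrite ?ltr_wpDl//; [apply: nbW hf|apply: nbW hg];
  rewrite lerDl ltW.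
Qed.

Lemma nbB f g B C : nb p f B -> nb p g C -> nb p (fun x => f x - g x) (B + C).
Proof. by move=> hf hg; apply: nbD => //; exact: nbN. Qed.

Lemma nb_sum (F : nat -> X -> R[i]) (b : R) n :
  (forall k, (k < n)%N -> nb p (F k) b) ->
  nb p (fun x => \sum_(k < n) F k x) (n%:R * b).
Proof.
elim: n => [|n ih] h.
  by rewrite mul0r; apply: eq_nb nb0 => x; rewrite big_ord0.
rewrite -natr1 mulrDl mul1r.
have h1 : nb p (fun x => \sum_(k < n) F k x) (n%:R * b).
  by apply: ih => k kn; apply: h; rewrite ltnS ltnW.
by apply: eq_nb (nbD h1 (h n (ltnSn n))) => x; rewrite big_ord_recr.
Qed.

(** Point evaluations are bounded since [x] has positive mass. Limits taken in different [l^p] are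
    compared through their values. *)
Lemma nb_pt x : exists2 c : R, 0 < c & forall f B, nb p f B -> normc (f x) <= c * B.
Proof.
case: pP => [[r -> r1]| ->]; last first.
  by exists 1 => // f B /nb_yE h; rewrite mul1r.
have r0 : 0 < r by lra.
have ir0 : 0 <= r^-1 by rewrite invr_ge0 ltW.
exists (m x `^ (- r^-1)); first by rewrite powR_gt0.
move=> f B h; have B0 := nb_ge0 h; move: h.
move=> /(nb_rE _ r1 B0) /(@sumle_pt _ _ _ _ x) h.
have := ge0_ler_powR ir0 _ _ h.
rewrite !nnegrE powR_ge0 mulr_ge0 ?powR_ge0 ?(ltW (m_gt0 _))// => /(_ isT isT).
rewrite powRM ?powR_ge0 ?(ltW (m_gt0 _))// -!powRrM mulfV ?gt_eqF//.
rewrite !powRr1 ?normc_ge0// => {}h.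
by rewrite powRN mulrC ler_pdivlMr ?powR_gt0// mulrC.
Qed.

Definition cutoff (A : {fset X}) f : X -> R[i] := fun x => if x \in A then f x else 0.

Lemma nb_cut_le A f B : nb p f B -> nb p (cutoff A f) B.
Proof.
apply: le_nb => x; rewrite /cutoff; case: ifP => // _.
by rewrite Normc.normc0 normc_ge0.
Qed.

Lemma nb_of_cut f B : 0 <= B -> (forall A, nb p (cutoff A f) B) -> nb p f B.
Proof.
move=> B0; case: pP => [[r -> r1]| ->] h; last first.
  apply/nb_yE => x; have := h [fset x]%fset => /nb_yE /(_ x).
  by rewrite /cutoff inE eqxx.
apply/(nb_rE _ r1 B0) => A; have := h A => /(nb_rE _ r1 B0) /(_ A).
apply: le_trans; rewrite le_eqVlt; apply/orP; left; apply/eqP.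
rewrite big_seq [RHS]big_seq; apply: eq_bigr => x xA; by rewrite /cutoff xA.
Qed.

Lemma nb_delta y : exists B, nb p (fun x => if x == y then 1 else 0) B.
Proof.
case: pP => [[r -> r1]| ->]; last first.
  exists 1; apply/nb_yE => x; case: ifP => _; rewrite ?Normc.normc1 ?Normc.normc0//.
have r0 : 0 < r by lra.
exists (m y `^ r^-1); apply/(nb_rE _ r1 (powR_ge0 _ _)).
rewrite -powRrM mulVf ?gt_eqF// powRr1 ?(ltW (m_gt0 _))// => A.
rewrite (@le_trans _ _ (\sum_(x <- (A `|` [fset y])%fset)
   m x * normc ((if x == y then 1 else 0) : R[i]) `^ r))//.
  apply: sub_sum_fset (fsubsetUl _ _) => x.
  by rewrite mulr_ge0 ?powR_ge0// ltW.
have yA : y \in (A `|` [fset y])%fset by rewrite !inE eqxx orbT.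
rewrite (bigD1_seq y) ?fset_uniq //=.
have -> : normc ((if y == y then 1 else 0) : R[i]) = 1.
  by rewrite eqxx; exact: Normc.normc1.
rewrite powR1 mulr1 big1 ?addr0// => x /negPf ->; rewrite Normc.normc0 powR0 ?mulr0//.
by rewrite gt_eqF.
Qed.

Lemma nb_cut A f : exists B, nb p (cutoff A f) B.
Proof.
elim/fset1U_rect: A => [|y A yA [B hB]].
  by exists 0; apply: eq_nb nb0 => x; rewrite /cutoff inE.
have [D hD] := nb_delta y.
exists (normc (f y) * D + B); apply: eq_nb (nbD (nbZ (f y) hD) hB) => x.
rewrite /cutoff !inE; case: eqP => [->|_] /=.
  by rewrite (negPf yA) mulr1 addr0.
by rewrite mulr0 add0r.
Qed.

(** The approximants may depend on the finite set and need to be close to [f] only there, so they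
    may come from convergence in another [l^q]. On [A] the error is at most a small constant times
    the indicator of [A], whose norm [K] determines that constant. *)
Lemma nb_fatou f B : 0 <= B ->
  (forall (A : {fset X}) e, 0 < e -> exists2 g, nb p g (B + e) &
     forall x, x \in A -> normc (f x - g x) <= e) ->
  nb p f B.
Proof.
move=> B0 h; apply: nb_of_cut => // A.
have [K hK] := nb_cut A (fun=> 1); have K0 := nb_ge0 hK.
apply: nb_closed => e e0.
have e'0 : 0 < e / (1 + K) by rewrite divr_gt0// ltr_wpDr.
have [g hg hx] := h A _ e'0.
have h1 : nb p (cutoff A (fun x => f x - g x)) (e / (1 + K) * K).
  rewrite -[X in X * K](normcR0 (ltW e'0)).
  apply: le_nb (nbZ (e / (1 + K))%:C hK) => x.
  rewrite /cutoff; case: ifP => [xA|_]; last by rewrite mulr0.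
  by rewrite mulr1 (normcR0 (ltW e'0)) hx.
have := nbD (nb_cut_le A hg) h1.
rewrite -addrA (_ : e / (1 + K) + e / (1 + K) * K = e); last first.
  by field; rewrite gt_eqF// ltr_wpDr.
by apply: eq_nb => x; rewrite /cutoff; case: ifP => _; rewrite ?addr0// addrC subrK.
Qed.

Lemma nb_dense f B e : p != +oo%E -> nb p f B -> 0 < e ->
  exists A, nb p (fun x => f x - cutoff A f x) e.
Proof.
move=> py hB e0; have B0 := nb_ge0 hB; move: hB py.
case: pP => [[r -> r1]| ->]; last by rewrite eqxx.
move=> /(nb_rE _ r1 B0) hf _.
have u0 x : 0 <= m x * normc (f x) `^ r by rewrite mulr_ge0 ?powR_ge0// ltW.
have [|A hA] := esum_approx u0 hf (e := e `^ r / 2).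
  by rewrite divr_gt0// powR_gt0.
exists A; apply/(nb_rE _ r1 (ltW e0)) => C.
have r0 : r != 0 by rewrite gt_eqF//; lra.
have H1 := hA _ (fsubset_refl A); have H2 := hA _ (fsubsetUl A C).
pose w x := m x * normc (f x - cutoff A f x) `^ r.
have w0 x : 0 <= w x by rewrite mulr_ge0 ?powR_ge0// ltW.
have : \sum_(x <- (A `|` C)%fset) m x * normc (f x) `^ r =
   \sum_(x <- A) m x * normc (f x) `^ r + \sum_(x <- (A `|` C)%fset) w x.
  rewrite (big_fsetID _ (fun x => x \in A)) /=.
  rewrite [X in _ = _ + X](big_fsetID _ (fun x => x \in A)) /=.
  have -> : [fset x in (A `|` C)%fset | x \in A]%fset = A.
    by apply/fsetP => x; rewrite !inE /=; case: (x \in A) => //=; rewrite andbF.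
  congr (_ + _); rewrite [X in _ = X + _]big1_fset ?add0r => [|x xA _]; last first.
    by rewrite /w /cutoff xA subrr Normc.normc0 powR0 ?mulr0.
  apply: eq_big_seq => x; rewrite !inE /= => /andP[_ /negPf xA].
  by rewrite /w /cutoff xA subr0.
have := sub_sum_fset w0 (fsubsetUr A C).
move: H1 H2; rewrite !ler_norml => /andP[? ?] /andP[? ?]; rewrite -/w.
lra.
Qed.

End fixed_exponent.

Section Completeness.
Variable p : \bar R.
Hypothesis p1 : (1 <= p)%E.

(** The pointwise limit is the norm limit: bounds of [u i - u j] pass to [u i - f] by [nb_fatou]. *)
Lemma nb_complete (u : nat -> X -> R[i]) :
  (forall e, 0 < e -> exists N, forall i j, (N <= i)%N -> (N <= j)%N ->
     nb p (fun x => u i x - u j x) e) ->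
  exists f, forall e, 0 < e -> exists N, forall i, (N <= i)%N ->
     nb p (fun x => u i x - f x) e.
Proof.
move=> h.
have pt x : exists l, forall e, 0 < e -> exists N, forall i, (N <= i)%N ->
    normc (u i x - l) <= e.
  apply: complex_cauchy => e e0; have [c c0 hc] := nb_pt p1 x.
  have [N hN] := h _ (divr_gt0 e0 c0); exists N => i j Ni Nj.
  by have := hc _ _ (hN _ _ Ni Nj); rewrite mulrC divfK ?gt_eqF.
have [f hf] := choice pt; exists f => e e0.
have [N hN] := h _ e0; exists N => i Ni.
apply: (nb_fatou p1 (ltW e0)) => A e' e'0.
have [M hM] := ptwise_fset hf A e'0.
exists (fun x => u i x - u (maxn N M) x).
  by apply: nbW (hN _ _ Ni (leq_maxl _ _)); rewrite lerDl ltW.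
move=> x xA; rewrite (_ : _ - _ = u (maxn N M) x - f x); last by ring.
by apply: hM xA; exact: leq_maxr.
Qed.

End Completeness.

(** * The Schur test *)

Section Schur.
Variable p : \bar R.
Hypothesis p1 : (1 <= p)%E.
Variables (K : X -> X -> R) (C : R).
Hypothesis C0 : 0 < C.
Hypothesis K0 : forall x y, 0 <= K x y.
Hypothesis Krow : forall x, sumle (K x) C.
Hypothesis Kcol : forall y, sumle (fun x => m x * K x y) (C * m y).

Lemma schur_entry x y : m x * K x y <= C * m y.
Proof. exact: (sumle_pt x (Kcol y)). Qed.

Let T r (f : X -> R[i]) x : R :=
  fine (\esum_(y in [set: X]) (m x * (K x y * normc (f y) `^ r))%:E).

(** A single entry of a column already gives finite row sums; summing over [x] first and using the
    column bound gives the total. *)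
Let T_sum r f B : 1 <= r -> 0 <= B -> nb r%:E f B ->
  (forall x, sumle (fun y => m x * (K x y * normc (f y) `^ r)) (T r f x)) /\
  sumle (T r f) (C * B `^ r).
Proof.
move=> r1 B0 /(nb_rE f r1 B0) hf.
have u0 x y : 0 <= m x * (K x y * normc (f y) `^ r).
  by rewrite mulr_ge0 ?mulr_ge0 ?powR_ge0// ltW.
have s1 x : sumle (fun y => m x * (K x y * normc (f y) `^ r)) (C * B `^ r).
  apply: le_sumle (sumleZ (ltW C0) hf) => // y.
  by rewrite !mulrA ler_wpM2r ?powR_ge0// schur_entry.
have fin x : (\esum_(y in [set: X]) (m x * (K x y * normc (f y) `^ r))%:E)%E \is a fin_num.
  rewrite ge0_fin_numE; last by apply: esum_ge0 => y _; rewrite lee_fin.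
  by apply: le_lt_trans (_ : ((C * B `^ r)%:E < +oo)%E); [apply/sumleP|rewrite ltry].
split=> [x|A]; first by apply/sumleP; rewrite fineK.
rewrite -lee_fin -sumEFin.
under eq_bigr do rewrite /T fineK//.
rewrite -esum_sum; last by move=> y x _ _; rewrite lee_fin.
under eq_esum do rewrite sumEFin.
apply/sumleP; apply: le_sumle (sumleZ (ltW C0) hf) => // y.
rewrite mulrA; under eq_bigr do rewrite mulrA.
by rewrite -mulr_suml ler_wpM2r ?powR_ge0//; exact: Kcol.
Qed.

(** The tangent inequality for [normc (f y)] at a level [a], summed against the row of [x]; the
    level is still free. *)
Let young r f x a : 1 <= r -> 0 < a ->
  sumle (fun y => m x * (K x y * normc (f y) `^ r)) (T r f x) ->
  sumle (fun y => K x y * normc (f y))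
    ((T r f x / m x + (r - 1) * a `^ r * C) / (r * a `^ (r - 1))).
Proof.
move=> r1 a0 hT; have d0 : 0 < r * a `^ (r - 1).
  by rewrite mulr_gt0 ?powR_gt0//; lra.
have mi : 0 <= (m x)^-1 by rewrite invr_ge0 ltW.
have rc : 0 <= (r - 1) * a `^ r by rewrite mulr_ge0 ?powR_ge0// subr_ge0.
have di : 0 <= (r * a `^ (r - 1))^-1 by rewrite invr_ge0 ltW.
apply: le_sumle (sumleZ di (sumleD (sumleZ mi hT) (sumleZ rc (@Krow x)))).
  move=> y; have -> : (m x)^-1 * (m x * (K x y * normc (f y) `^ r)) =
    K x y * normc (f y) `^ r by rewrite mulKf// gt_eqF.
  rewrite ler_pdivlMl// mulrCA.
  rewrite [X in _ <= _ + X]mulrC -mulrDr ler_wpM2l//.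
  exact: powR_tangent (normc_ge0 _).
by rewrite mulrC (mulrC (m x)^-1).
Qed.

Lemma schur_summ f B x : nb p f B -> exists b, sumle (fun y => K x y * normc (f y)) b.
Proof.
move=> h; have B0 := nb_ge0 h; case: (pP p1) h => [[r -> r1]|->] h.
  have [h1 _] := T_sum r1 B0 h.
  by have := young r1 ltr01 (h1 x) => hy; eexists; exact: hy.
exists (B * C); apply: le_sumle (sumleZ B0 (@Krow x)) => // y.
by rewrite mulrC ler_wpM2r//; move/nb_yE: h.
Qed.

(** The function [g] is only required to be dominated by every bound of the kernel sums, so that
    signed or complex kernels are covered as well. *)
Lemma schur f g B : nb p f B ->
  (forall x b, sumle (fun y => K x y * normc (f y)) b -> normc (g x) <= b) ->
  nb p g (C * B).
Proof.
move=> h hg; have B0 := nb_ge0 h; have CB0 : 0 <= C * B by rewrite mulr_ge0// ltW.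
case: (pP p1) h => [[r -> r1]|->] h; last first.
  apply/nb_yE => x; apply: hg.
  rewrite mulrC; apply: le_sumle (sumleZ B0 (@Krow x)) => // y.
  by rewrite mulrC ler_wpM2r//; move/nb_yE: h.
have [h1 h2] := T_sum r1 B0 h.
apply/(nb_rE _ r1 CB0); rewrite powRM ?(ltW C0)//.
have r0 : 0 < r by lra.
have CE : C `^ r = C `^ (r - 1) * C by rewrite mulrC mulr_powRB1// ltW.
rewrite CE -mulrA.
apply: le_sumle (sumleZ (powR_ge0 _ _) h2) => // x.
have Tx0 : 0 <= T r f x by exact: (sumle_ge0 (h1 x)).
have [g0|g0] := eqVneq (normc (g x)) 0.
  by rewrite g0 powR0 ?gt_eqF// mulr0 mulr_ge0// powR_ge0.
have gx0 : 0 < normc (g x) by rewrite lt_def g0 normc_ge0.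
(* With the level [a = |g x| / C] the term of [young] that carries [r - 1] is a multiple of
   [a^(r - 1) |g x|]. It is absorbed on the left, which leaves [m x a^(r - 1) |g x| <= T r f x]. *)
have a0 : 0 < normc (g x) / C by rewrite divr_gt0.
have := hg _ _ (young r1 a0 (h1 x)).
have d0 : 0 < r * (normc (g x) / C) `^ (r - 1).
  by rewrite mulr_gt0 ?powR_gt0//; lra.
rewrite ler_pdivlMr//.
have -> : (normc (g x) / C) `^ r = (normc (g x) / C) `^ (r - 1) * (normc (g x) / C).
  by rewrite [RHS]mulrC mulr_powRB1// ltW.
have -> : normc (g x) `^ r = C `^ (r - 1) * ((normc (g x) / C) `^ (r - 1) * normc (g x)).
  rewrite mulrA -powRM ?(ltW C0) ?(ltW a0)// mulrC (mulrC C) divfK ?gt_eqF//.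
  by rewrite mulr_powRB1 ?normc_ge0.
move: ((normc (g x) / C) `^ (r - 1)) => P h3.
rewrite mulrCA ler_wpM2l ?powR_ge0//.
have : P * normc (g x) <= T r f x / m x.
  have e : (r - 1) * (P * (normc (g x) / C)) * C = (r - 1) * (P * normc (g x)).
    by field; rewrite gt_eqF.
  by rewrite e in h3; lra.
by rewrite ler_pdivlMr// mulrC.
Qed.

End Schur.

(** * The dual pairing on [l^2] and between [l^1] and [l^oo] *)

Section Pairing.

Definition psum f g b := sumle (fun x => m x * (normc (f x) * normc (g x))) b.
Definition psumm f g := exists b, psum f g b.
Definition delta (y : X) : X -> R[i] := fun x => if x == y then 1 else 0.

Let normc_term f g x :
  normc ((m x)%:C * f x * conjc (g x)) = m x * (normc (f x) * normc (g x)).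
Proof. by rewrite !normcM normc_conj normcR0 ?ltW// mulrA. Qed.

Lemma psumm_summ f g : psumm f g ->
  summ (fun x => (m x)%:C * f x * conjc (g x)).
Proof. by move=> [b hb]; exists b; apply: le_sumle hb => // x; rewrite normc_term. Qed.

Lemma pairing_le f g b : psum f g b -> normc (pairing m f g) <= b.
Proof. by move=> h; apply: csum_le; apply: le_sumle h => // x; rewrite normc_term. Qed.

Lemma psumC f g b : psum f g b -> psum g f b.
Proof. by apply: le_sumle => // x; rewrite (mulrC (normc (g x))). Qed.

Lemma pairing_conj f g : psumm f g -> pairing m g f = conjc (pairing m f g).
Proof.
move=> /psumm_summ h; rewrite /pairing -csum_conj//; apply: eq_csum => x.
rewrite !rmorphM /= conjcK (_ : (m x -i* 0)%C = (m x)%:C) ?oppr0//.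
by rewrite mulrAC.
Qed.

Lemma psummD f g h : psumm f h -> psumm g h -> psumm (fun x => f x + g x) h.
Proof.
move=> [b hb] [c hc]; exists (b + c); apply: le_sumle (sumleD hb hc) => // x.
by rewrite -mulrDr -mulrDl ler_wpM2l ?(ltW (m_gt0 x))// ler_wpM2r ?normc_ge0 ?normcD.
Qed.

Lemma psummZ a f h : psumm f h -> psumm (fun x => a * f x) h.
Proof.
move=> [b hb]; exists (normc a * b).
apply: le_sumle (sumleZ (normc_ge0 a) hb) => // x.
by rewrite normcM; lra.
Qed.

Lemma psummC f g : psumm f g -> psumm g f.
Proof. by move=> [b /psumC h]; exists b. Qed.

Lemma pairingDl f g h : psumm f h -> psumm g h ->
  pairing m (fun x => f x + g x) h = pairing m f h + pairing m g h.
Proof.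
move=> hf hg; rewrite /pairing -csumD; [|exact: psumm_summ..].
by apply: eq_csum => x; rewrite mulrDr mulrDl.
Qed.

Lemma pairingZl a f h : psumm f h ->
  pairing m (fun x => a * f x) h = a * pairing m f h.
Proof.
move=> hf; rewrite /pairing -csumZ; last exact: psumm_summ.
by apply: eq_csum => x; ring.
Qed.

Lemma pairingBl f g h : psumm f h -> psumm g h ->
  pairing m (fun x => f x - g x) h = pairing m f h - pairing m g h.
Proof.
move=> hf hg; rewrite -[- pairing m g h]mulN1r -pairingZl// -pairingDl//; last exact: psummZ.
by congr (pairing m _ h); apply/funext => x; rewrite mulN1r.
Qed.

Lemma pairingDr f g h : psumm h f -> psumm h g ->
  pairing m h (fun x => f x + g x) = pairing m h f + pairing m h g.
Proof.
move=> hf hg; have hf' := psummC hf; have hg' := psummC hg.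
rewrite (pairing_conj (psummD hf' hg')) pairingDl// rmorphD /=.
by rewrite (pairing_conj hf') (pairing_conj hg').
Qed.

Lemma pairingZr a f h : psumm h f ->
  pairing m h (fun x => a * f x) = conjc a * pairing m h f.
Proof.
move=> hf; have hf' := psummC hf.
by rewrite (pairing_conj (psummZ a hf')) pairingZl// rmorphM /= (pairing_conj hf').
Qed.

Lemma pairingBr f g h : psumm h f -> psumm h g ->
  pairing m h (fun x => f x - g x) = pairing m h f - pairing m h g.
Proof.
move=> hf hg; have hf' := psummC hf; have hg' := psummC hg.
have hB : psumm (fun x => f x - g x) h.
  have := psummD hf' (psummZ (-1) hg'); congr (psumm _ h).
  by apply/funext => x; rewrite mulN1r.
by rewrite (pairing_conj hB) pairingBl// rmorphB /= (pairing_conj hf') (pairing_conj hg').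
Qed.

Lemma nb2E f B : 0 <= B ->
  nb 2%:E f B <-> sumle (fun x => m x * normc (f x) ^+ 2) (B ^+ 2).
Proof.
move=> B0; rewrite (nb_rE f _ B0); last by rewrite ler1n.
rewrite powR_mulrn//; under eq_fun do rewrite powR_mulrn ?normc_ge0//.
by [].
Qed.

Lemma nb1E f B : 0 <= B ->
  nb 1%:E f B <-> sumle (fun x => m x * normc (f x)) B.
Proof.
move=> B0; rewrite (nb_rE f (lexx _) B0).
by rewrite powRr1//; under eq_fun do rewrite powRr1 ?normc_ge0//.
Qed.

Lemma nb_eq0 (p : \bar R) f : (1 <= p)%E -> nb p f 0 -> forall x, f x = 0.
Proof.
move=> p1 h x; have [c c0 hc] := nb_pt p1 x.
apply/eqP; rewrite -normc_eq0; apply/eqP/le_anti; rewrite normc_ge0 andbT.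
by have := hc _ _ h; rewrite mulr0.
Qed.

(** Cauchy-Schwarz from the termwise inequality [2 u v <= (B / A) u^2 + (A / B) v^2], hence the
    separate treatment of vanishing bounds. *)
Lemma psum22 f g A B : nb 2%:E f A -> nb 2%:E g B -> psum f g (A * B).
Proof.
move=> hf hg; have A0 := nb_ge0 hf; have B0 := nb_ge0 hg.
have [A00|An0] := eqVneq A 0.
  rewrite A00 mul0r; move: hf; rewrite A00 => /(nb_eq0 le12) f0 S.
  by rewrite big1// => x _; rewrite f0 Normc.normc0 mul0r mulr0.
have [B00|Bn0] := eqVneq B 0.
  rewrite B00 mulr0; move: hg; rewrite B00 => /(nb_eq0 le12) g0 S.
  by rewrite big1// => x _; rewrite g0 Normc.normc0 !mulr0.
have {}A0 : 0 < A by rewrite lt_def An0.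
have {}B0 : 0 < B by rewrite lt_def Bn0.
move: hf hg => /(nb2E _ (ltW A0)) hf /(nb2E _ (ltW B0)) hg.
have c1 : 0 <= B / A / 2 by rewrite !divr_ge0// ltW.
have c2 : 0 <= A / B / 2 by rewrite !divr_ge0// ltW.
apply: le_sumle (sumleD (sumleZ c1 hf) (sumleZ c2 hg)) => [x|]; last first.
  by rewrite le_eqVlt; apply/orP; left; apply/eqP; field; rewrite !gt_eqF.
rewrite -subr_ge0.
rewrite (_ : _ - _ = m x * ((B * normc (f x) - A * normc (g x)) ^+ 2 / (A * B * 2))).
  by rewrite mulr_ge0 ?(ltW (m_gt0 x))// divr_ge0 ?sqr_ge0// !mulr_ge0 ?ltW.
by field; rewrite !gt_eqF.
Qed.

Lemma psum1y f g A B : nb 1%:E f A -> nb +oo%E g B -> psum f g (A * B).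
Proof.
move=> hf hg; have A0 := nb_ge0 hf; have B0 := nb_ge0 hg.
move: hf => /(nb1E _ A0) hf; move: hg => /nb_yE hg.
rewrite mulrC; apply: le_sumle (sumleZ B0 hf) => // x.
by rewrite mulrA (mulrC B) ler_wpM2l ?hg// mulr_ge0 ?normc_ge0// ltW.
Qed.

Lemma psumm22 f g : ell m 2%:E f -> ell m 2%:E g -> psumm f g.
Proof.
move=> /(ellP)[A hA] /(ellP)[B hB]; exists (A * B); exact: psum22.
Qed.

Lemma psumm1y f g : ell m 1%:E f -> ell m +oo%E g -> psumm f g.
Proof.
move=> /(ellP)[A hA] /(ellP)[B hB]; exists (A * B); exact: psum1y.
Qed.

Lemma pairing_delta f y : pairing m f (delta y) = (m y)%:C * f y.
Proof.
rewrite /pairing (@csum1 _ _ _ y) /delta ?eqxx ?rmorph1 ?mulr1// => x /negPf ->.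
by rewrite rmorph0 mulr0.
Qed.

Lemma pairing_delta_l f y : pairing m (delta y) f = (m y)%:C * conjc (f y).
Proof.
rewrite /pairing (@csum1 _ _ _ y) /delta ?eqxx ?mulr1// => x /negPf ->.
by rewrite mulr0 mul0r.
Qed.

Lemma pairing_self_ge f : ell m 2%:E f ->
  nb 2%:E f (sqrt (Re (pairing m f f))).
Proof.
move=> /(ellP)[A hA]; have A0 := nb_ge0 hA; move: hA => /(nb2E _ A0) hA.
apply/(nb2E _ (sqrtr_ge0 _)).
have u0 x : 0 <= m x * normc (f x) ^+ 2 by rewrite mulr_ge0 ?sqr_ge0// ltW.
have h := sumle_csum u0 hA.
have E : csum (fun x => (m x * normc (f x) ^+ 2)%:C) = pairing m f f.
  by apply: eq_csum => x; rewrite -mulrA mulcJ rmorphM.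
rewrite E in h; rewrite sqr_sqrtr//; exact: (sumle_ge0 h).
Qed.

Lemma Re_pairing_self_le f B : nb 2%:E f B -> Re (pairing m f f) <= B ^+ 2.
Proof.
by move=> h; apply: le_trans (le_Re_normc _) (pairing_le _); exact: psum22.
Qed.

Lemma Im_pairing_self f : ell m 2%:E f -> Im (pairing m f f) = 0.
Proof.
move=> h; have := pairing_conj (psumm22 h h); move: (pairing m f f) => z /eqP.
by case: z => a b; rewrite eq_complex /= => /andP[_ /eqP]; lra.
Qed.

End Pairing.

(** * Bounded operators and semigroups *)

Section UniformBoundedness.
Variable p : \bar R.
Hypothesis p1 : (1 <= p)%E.

Definition bnd (T : fn -> fn) (K : R) : Prop :=
  forall f B, nb p f B -> nb p (T f) (K * B).

Definition lin (T : fn -> fn) : Prop :=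
  forall (a : R[i]) f g, ell m p f -> ell m p g ->
    T (fun x => a * f x + g x) = (fun x => a * T f x + T g x).

Lemma ellZ a f : ell m p f -> ell m p (fun x => a * f x).
Proof. by move=> /(ellP)[B h]; apply/(ellP); eexists; exact: (nbZ p1 a h). Qed.

Lemma ellD f g : ell m p f -> ell m p g -> ell m p (fun x => f x + g x).
Proof.
move=> /(ellP)[B h] /(ellP)[C k]; apply/(ellP); eexists.
exact: (nbD p1 h k).
Qed.

Lemma ellB f g : ell m p f -> ell m p g -> ell m p (fun x => f x - g x).
Proof.
move=> /(ellP)[B h] /(ellP)[C k]; apply/(ellP); eexists.
exact: (nbB p1 h k).
Qed.

Lemma ell0 : ell m p (fun=> 0).
Proof. by apply/(ellP); exists 0; exact: nb0. Qed.

Lemma nb_ell f B : nb p f B -> ell m p f.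
Proof. by move=> h; apply/(ellP); exists B. Qed.

Lemma lin0 T : lin T -> T (fun=> 0) = (fun=> 0).
Proof.
move=> /(_ (-1) _ _ ell0 ell0).
rewrite [X in T X](_ : _ = (fun=> 0)); last by apply/funext => x; rewrite mulr0 addr0.
by move=> h; rewrite h; apply/funext => x; rewrite mulN1r addNr.
Qed.

Lemma linZ T a f : lin T -> ell m p f -> T (fun x => a * f x) = (fun x => a * T f x).
Proof.
move=> lT ef; have := lT a f _ ef ell0; rewrite (lin0 lT).
rewrite [X in T X](_ : _ = (fun x => a * f x)).
  by move=> ->; apply/funext => x; rewrite addr0.
by apply/funext => x; rewrite addr0.
Qed.

Lemma linD T f g : lin T -> ell m p f -> ell m p g ->
  T (fun x => f x + g x) = (fun x => T f x + T g x).
Proof.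
move=> lT ef eg; have := lT 1 f g ef eg.
rewrite [X in T X](_ : _ = (fun x => f x + g x)); last by apply/funext => x; rewrite mul1r.
by move=> ->; apply/funext => x; rewrite mul1r.
Qed.

Lemma linB T f g : lin T -> ell m p f -> ell m p g ->
  T (fun x => f x - g x) = (fun x => T f x - T g x).
Proof.
move=> lT ef eg; have := lT (-1) g f eg ef.
rewrite [X in T X](_ : _ = (fun x => f x - g x)).
  by move=> ->; apply/funext => x; rewrite mulN1r addrC.
by apply/funext => x; rewrite mulN1r addrC.
Qed.

Lemma bndW T K L : K <= L -> bnd T K -> bnd T L.
Proof.
move=> KL h f B hB; have B0 := nb_ge0 hB; apply: nbW (h _ _ hB).
by rewrite ler_wpM2r.
Qed.

Lemma bnd_ell T K f : bnd T K -> ell m p f -> ell m p (T f).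
Proof. by move=> h /(ellP)[B /h hB]; exact: nb_ell hB. Qed.

(** The absolute value is taken because the constants in the definitions may be negative. *)
Lemma bndP T (K : R) : (forall f, ell m p f -> (lpnorm m p (T f) <= K%:E * lpnorm m p f)%E) ->
  bnd T `|K|.
Proof.
move=> h f B hB; have B0 := nb_ge0 hB; have N := nb_norm hB.
apply: le_trans (h _ (nb_ell hB)) _; rewrite N -EFinM lee_fin.
have h1 : fine (lpnorm m p f) <= B by rewrite -lee_fin -N.
have h0 : 0 <= fine (lpnorm m p f) by rewrite fine_ge0// lpnorm_ge0.
by rewrite (le_trans (ler_wpM2r h0 (ler_norm K)))// ler_wpM2l.
Qed.

(** A substitute for the operator norm: a bound is multiplied by [2 / 3] until it fails for the
    first time. This happens because every bound exceeds [c]. *)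
Lemma near_maximizer T K c : lin T -> bnd T K -> 0 < c -> ~ bnd T c ->
  exists N g, [/\ c < N, bnd T N, nb p g 1 & ~ nb p (T g) (2 / 3 * N)].
Proof.
move=> lT bT c0 nb_c.
have cN N : bnd T N -> c < N.
  by move=> bN; rewrite ltNge; apply/negP => Nc; exact: nb_c (bndW Nc bN).
have K0 := cN _ bT; have q0 : 0 <= 2 / 3 :> R by rewrite divr_ge0.
have [j [bj nbj]] : exists j, bnd T (K * (2 / 3) ^+ j) /\ ~ bnd T (K * (2 / 3) ^+ j.+1).
  apply: contrapT => /forallNP H.
  have all j : bnd T (K * (2 / 3) ^+ j).
    elim: j => [|j ih]; first by rewrite expr0 mulr1.
    by have /not_andP[//|/contrapT] := H j.
  have [||j hj] := @exp_small R (2 / 3) (c / K) q0; [lra|by rewrite divr_gt0//; lra|].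
  have := cN _ (all j); rewrite ltNge => /negP; apply.
  by rewrite mulrC -ler_pdivlMr//; lra.
pose N := K * (2 / 3) ^+ j.
have [f [B [hB nB]]] : exists f B, nb p f B /\ ~ nb p (T f) (2 / 3 * N * B).
  apply: contrapT => H; apply: nbj => f B hB; apply: contrapT => hn; apply: H.
  by exists f, B; split=> //; rewrite /N mulrCA -exprS.
have N0 : 0 < N by apply: lt_trans (cN _ bj).
have Bp : 0 < B.
  rewrite lt_def (nb_ge0 hB) andbT; apply/eqP => B0; apply: nB.
  by have := bj _ _ hB; rewrite B0 !mulr0.
exists N, (fun x => (B^-1)%:C * f x); split=> //; first exact: cN.
  have := nbZ p1 (B^-1)%:C hB.
  by rewrite normcR0 ?invr_ge0 ?(ltW Bp)// mulVf ?gt_eqF.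
rewrite (linZ _ lT (nb_ell hB)) => h; apply: nB.
have := nbZ p1 B%:C h; rewrite normcR0 ?(ltW Bp)// mulrC.
by apply: eq_nb => x; rewrite mulrA -rmorphM divff ?gt_eqF// mul1r.
Qed.

(* Gliding hump (Sokal), to avoid Baire category: either [T n (f + g)] or
   [T n (f - g)] is at least as large as [T n g]. *)
Lemma uniform_boundedness (T : nat -> fn -> fn) :
  (forall n, lin (T n)) -> (forall n, exists K, bnd (T n) K) ->
  (forall f, ell m p f -> exists C, forall n, nb p (T n f) C) ->
  exists M, forall n, bnd (T n) M.
Proof.
move=> lT bT pT; apply: contrapT => /forallNP H.
(* Step [k] moves by [r k = 3^-k] and makes [T (n k)] at least [2/3 r k N]. All later steps together
   move by at most [3/2 r (k + 1) = r k / 2], which costs [1/2 r k N]. What remains is [r k N / 6],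
   which exceeds [k + 1] once [N > c k]. *)
pose c k : R := 6 * k.+1%:R * 3 ^+ k.
have c0 k : 0 < c k by rewrite /c !mulr_gt0// exprn_gt0.
have /choice[n hn] : forall k, exists n, ~ bnd (T n) (c k).
  by move=> k; apply/existsNP => h; apply: (H (c k)).
have /choice[Ng hNg] : forall k, exists Ng : R * fn,
    [/\ c k < Ng.1, bnd (T (n k)) Ng.1, nb p Ng.2 1
      & ~ nb p (T (n k) Ng.2) (2 / 3 * Ng.1)].
  move=> k; have [K bK] := bT (n k).
  by have [N [g hg]] := near_maximizer (lT _) bK (c0 k) (hn k); exists (N, g).
pose r k : R := (3^-1) ^+ k.
have r0 k : 0 < r k by rewrite exprn_gt0// invr_gt0.
have step k x : exists y, nb p (fun z => y z - x z) (r k) /\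
    (ell m p x -> ~ nb p (T (n k) y) (r k * (2 / 3 * (Ng k).1))).
  have [_ _ g1 ng] := hNg k; set g := (Ng k).2 in g1 ng; set N := (Ng k).1 in ng *.
  have eg := nb_ell g1.
  have hp : nb p (fun z => (r k)%:C * g z) (r k).
    by have := nbZ p1 (r k)%:C g1; rewrite normcR0 ?(ltW (r0 k))// mulr1.
  pose yp z := x z + (r k)%:C * g z; pose ym z := x z - (r k)%:C * g z.
  (* If the images of [x + r g] and [x - r g] were both small, so would be half their difference,
     [r T g], against the choice of [g]. *)
  have [hyp|] := pselect (nb p (T (n k) yp) (r k * (2 / 3 * N))); last first.
    move=> h; exists yp; split=> //.
    by apply: eq_nb hp => z; rewrite /yp addrC addKr.
  exists ym; split.
    by apply: eq_nb (nbN p1 hp) => z; rewrite /ym addrC addKr.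
  move=> ex hym; apply: ng.
  have h2 := nbB p1 hyp hym.
  have i0 : 0 <= (2 * r k)^-1 by rewrite invr_ge0 mulr_ge0// ltW.
  have := nbZ p1 ((2 * r k)^-1)%:C h2; rewrite normcR0//.
  rewrite [X in nb p _ X](_ : _ = 2 / 3 * N); last by field; rewrite gt_eqF.
  have eg' := ellZ (r k)%:C eg.
  apply: eq_nb => z; rewrite /yp /ym (linD (lT _) ex eg') (linB (lT _) ex eg').
  rewrite (linZ _ (lT _) eg); move: (T _ x z) (T _ g z) => a b.
  have rC : (r k)%:C != 0 by rewrite fmorph_eq0 gt_eqF.
  by rewrite fmorphV rmorphM rmorph_nat /=; field.
have /choice[nx hnx] : forall kx : nat * fn, exists y, nb p (fun z => y z - kx.2 z) (r kx.1) /\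
    (ell m p kx.2 -> ~ nb p (T (n kx.1) y) (r kx.1 * (2 / 3 * (Ng kx.1).1))).
  by move=> [k x]; exact: step.
pose u := fix u k := if k is k'.+1 then nx (k', u k') else (fun=> 0) : fn.
have u1 k : nb p (fun z => u k.+1 z - u k z) (r k) by have [] := hnx (k, u k).
have eu k : ell m p (u k).
  elim: k => [|k ih]; first exact: ell0.
  have := ellD ih (nb_ell (u1 k)); congr (ell m p _); apply/funext => z.
  by rewrite addrC subrK.
have u2 k : ~ nb p (T (n k) (u k.+1)) (r k * (2 / 3 * (Ng k).1)).
  by have [_] := hnx (k, u k); apply; exact: eu.
(* The exact value of the geometric sum of the steps makes the induction close. *)
have u3 k j : nb p (fun z => u (k + j)%N z - u k z) (3 / 2 * r k - 3 / 2 * r (k + j)%N).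
  elim: j => [|j ih].
    by rewrite addn0 subrr; apply: eq_nb (nb0 p1) => z; rewrite subrr.
  have := nbD p1 (u1 (k + j)%N) ih; rewrite -addnS.
  rewrite [X in nb p _ X](_ : _ = 3 / 2 * r k - 3 / 2 * r (k + j).+1); last first.
    by rewrite ?addnS /r exprS; field.
  by rewrite addnS; apply: eq_nb => z; rewrite addrA subrK.
have u4 k i : (k <= i)%N -> nb p (fun z => u i z - u k z) (3 / 2 * r k).
  move=> /subnKC <-; apply: nbW (u3 k _).
  by rewrite lerBlDr lerDl mulr_ge0// ?divr_ge0// ltW.
have [|x hx] := nb_complete p1 (u := u).
  move=> e e0; have e3 : 0 < e / 3 by rewrite divr_gt0.
  have q0 : 0 <= 3^-1 :> R by rewrite invr_ge0.
  have q1 : 3^-1 < 1 :> R by rewrite invf_lt1 ?ltr1n.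
  have [N hN] := exp_small q0 q1 e3.
  exists N => i j Ni Nj.
  have := nbB p1 (u4 _ _ Ni) (u4 _ _ Nj).
  move=> /(nbW (C := e)) h; apply: eq_nb (h _); last by rewrite /r in h *; lra.
  by move=> z; ring.
have x4 k : nb p (fun z => x z - u k z) (3 / 2 * r k).
  apply: (nb_closed) => e e0; have [N hN] := hx _ e0.
  have h1 := hN _ (leq_maxr k N); have h2 := u4 k _ (leq_maxl k N).
  have := nbB p1 h2 h1; apply: eq_nb => z.
  by ring.
have ex : ell m p x.
  have := ellD (eu 0%N) (nb_ell (x4 0%N)); congr (ell m p _).
  by apply/funext => z; rewrite addrC subrK.
have [C hC] := pT _ ex; have C0 : 0 <= C := nb_ge0 (hC 0%N).
have key k : k.+1%:R <= C.
  have [cN bN _ _] := hNg k; set N := (Ng k).1 in cN bN.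
  rewrite leNgt; apply/negP => Ck; apply: (u2 k); rewrite -/N.
  have h1 := bN _ _ (x4 k.+1).
  rewrite (linB (lT _) ex (eu _)) in h1.
  have := nbB p1 (hC (n k)) h1.
  have rr : r k * 3 ^+ k = 1 by rewrite /r exprVn mulVf// expf_neq0.
  have : 6 * k.+1%:R < r k * N.
    have rc : r k * c k = 6 * k.+1%:R by rewrite /c mulrCA rr mulr1.
    by rewrite -rc ltr_pM2l.
  rewrite /r exprS -/(r k) => hN h2; apply: eq_nb (nbW _ h2).
    by move=> z; ring.
  by lra.
have := truncnS_gt C; have := key (Num.truncn C); lra.
Qed.

End UniformBoundedness.

(** * Strongly continuous semigroups and generators *)

Section Semigroups.

Section one_exponent.
Variable p : \bar R.
Hypothesis p1 : (1 <= p)%E.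
Variable S : R -> fn -> fn.
Hypothesis S_C0 : C0_semigroup m p S.

Lemma C0_lin t : 0 <= t -> lin p (S t).
Proof. by move=> t0 a f g ef eg; case: S_C0 => h _ _ _ _; exact: h. Qed.

Lemma C0_bnd t : 0 <= t -> exists K, bnd p (S t) K.
Proof.
move=> t0; case: S_C0 => _ h _ _ _; have [K hK] := h _ t0.
by exists `|K|; apply: bndP.
Qed.

Lemma C0_ell t f : 0 <= t -> ell m p f -> ell m p (S t f).
Proof. by move=> /C0_bnd[K hK]; exact: (bnd_ell hK). Qed.

Lemma C0_cont f e : ell m p f -> 0 < e -> exists2 d, 0 < d &
  forall t, 0 <= t -> t < d -> nb p (fun x => S t f x - f x) e.
Proof.
move=> ef e0; case: S_C0 => _ _ S0 _ /(_ _ ef).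
move=> /(ecvg0P (fun t => lpnorm_ge0 p _)) /(_ _ e0).
move=> /near_right0[d d0 h]; exists d => // t; rewrite le_eqVlt => /orP[/eqP<- _|t0 td].
  rewrite S0//; apply: nbW (ltW e0) _.
  by apply: eq_nb (nb0 p1) => x; rewrite subrr.
exact: h.
Qed.

Lemma C0_add s t f : 0 <= s -> 0 <= t -> ell m p f -> S (s + t) f = S s (S t f).
Proof. by move=> s0 t0 ef; case: S_C0 => _ _ _ h _; exact: h. Qed.

Lemma C0_zero f : ell m p f -> S 0 f = f.
Proof. by move=> ef; case: S_C0 => _ _ h _ _; exact: h. Qed.

(** Otherwise there are [t n <= 1 / (n + 1)] at which [n + 1] is not a bound. Every orbit is bounded
    along this sequence, being convergent as [t n] tends to [0], so uniform boundedness gives a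
    contradiction. *)
Lemma C0_locally_bounded : exists d M, [/\ 0 < d, 0 <= M &
  forall t, 0 <= t -> t <= d -> bnd p (S t) M].
Proof.
apply: contrapT => H.
have /choice[t ht] : forall n : nat, exists t, [/\ 0 <= t, t <= (n.+1%:R)^-1 &
    ~ bnd p (S t) n.+1%:R].
  move=> n; apply: contrapT => /forallNP h; apply: H.
  exists (n.+1%:R)^-1, n.+1%:R; split=> // t t0 tn; apply: contrapT => hb.
  by apply: (h t).
have t0 n : 0 <= t n by have [] := ht n.
have [M hM] : exists M, forall n, bnd p (S (t n)) M; first apply: uniform_boundedness => //.
- by move=> n; exact: C0_lin.
- by move=> n; exact: C0_bnd.
- move=> f ef; have [d d0 hd] := C0_cont ef ltr01.
  have [B hB] := (ellP p f).1 ef.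
  have fin N : exists C, forall n, (n < N)%N -> nb p (S (t n) f) C.
    elim: N => [|N [C hC]]; first by exists 0.
    have [K hK] := C0_bnd (t0 N).
    exists (Num.max C (K * B)) => n; rewrite ltnS leq_eqVlt => /orP[/eqP->|nN].
      by apply: nbW (hK _ _ hB); rewrite le_max lexx orbT.
    by apply: nbW (hC _ nN); rewrite le_max lexx.
  have := truncnS_gt d^-1; set N := (Num.truncn _).+1 => dN.
  have [C hC] := fin N; exists (Num.max C (1 + B)) => n.
  have [nN|Nn] := ltnP n N; first by apply: nbW (hC _ nN); rewrite le_max lexx.
  have [_ tn _] := ht n.
  have td : t n < d.
    apply: le_lt_trans tn _; rewrite invf_plt ?posrE ?ltr0n//.
    by apply: lt_le_trans dN _; rewrite ler_nat (leq_trans Nn).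
  apply: nbW (_ : 1 + B <= _) _; first by rewrite le_max lexx orbT.
  by apply: eq_nb (nbD p1 (hd _ (t0 n) td) hB) => x; rewrite subrK.
have := truncnS_gt `|M|; set N := Num.truncn _ => MN.
have [_ _] := ht N; apply; apply: bndW (hM N) => //.
exact: le_trans (ler_norm M) (ltW MN).
Qed.

Lemma C0_generatorP f g : generator m p S f g <-> [/\ ell m p f, ell m p g &
  forall e, 0 < e -> exists2 d, 0 < d & forall t, 0 < t -> t < d ->
    nb p (fun x => S t f x - f x - t%:C * g x) (t * e)].
Proof.
have scale t e : 0 < t ->
   nb p (fun x => (t^-1)%:C * (S t f x - f x) - g x) e <->
   nb p (fun x => S t f x - f x - t%:C * g x) (t * e).
  move=> t0; have tC : t%:C != 0 by rewrite fmorph_eq0 gt_eqF.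
  split=> h.
    have := nbZ p1 t%:C h; rewrite normcR0 ?(ltW t0)//.
    by apply: eq_nb => x; rewrite fmorphV /=; field.
  have := nbZ p1 (t^-1)%:C h; rewrite normcR0 ?invr_ge0 ?(ltW t0)//.
  by rewrite mulKf ?gt_eqF//; apply: eq_nb => x; rewrite fmorphV /=; field.
split=> [[ef eg /(ecvg0P (fun t => lpnorm_ge0 p _)) h]|[ef eg h]].
  split=> // e e0; have /near_right0[d d0 hd] := h _ e0.
  by exists d => // t t0 td; apply/(scale _ _ t0); exact: hd.
split=> //; apply/(ecvg0P (fun t => lpnorm_ge0 p _)) => e e0.
have [d d0 hd] := h _ e0; apply/near_right0; exists d => // t t0 td.
by apply/(scale _ _ t0); exact: hd.
Qed.

Lemma generator_uniq f g h : generator m p S f g -> generator m p S f h ->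
  g = h.
Proof.
move=> /C0_generatorP[_ _ hg] /C0_generatorP[_ _ hh].
apply/funext => x; apply: normc_eps_eq => e e0.
have [c c0 hc] := nb_pt p1 x.
have e'0 : 0 < e / c / 2 by rewrite !divr_gt0.
have [d d0 hd] := hg _ e'0; have [d' d'0 hd'] := hh _ e'0.
pose t := Num.min d d' / 2.
have mn : 0 < Num.min d d' by rewrite lt_min d0.
have t0 : 0 < t by rewrite divr_gt0.
have tm : t < Num.min d d' by rewrite /t; lra.
move: tm; rewrite lt_min => /andP[td td'].
have := nbB p1 (hd' _ t0 td') (hd _ t0 td).
move=> /(nbZ p1 (t^-1)%:C) /hc.
rewrite normcR0 ?invr_ge0 ?(ltW t0)//.
rewrite (_ : c * _ = e); last by field; rewrite !gt_eqF.
have tC : t%:C != 0 by rewrite fmorph_eq0 gt_eqF.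
rewrite (_ : _ * _ = g x - h x)//; rewrite fmorphV; field.
exact: tC.
Qed.

Lemma C0_generator_commute f g t : 0 <= t -> generator m p S f g ->
  generator m p S (S t f) (S t g).
Proof.
move=> t0 /C0_generatorP[ef eg h]; apply/C0_generatorP; split.
- exact: C0_ell.
- exact: C0_ell.
have [K hK] := C0_bnd t0; have lS := C0_lin t0.
have K1 : 0 < `|K| + 1 by rewrite ltr_wpDl.
move=> e e0; have [d d0 hd] := h _ (divr_gt0 e0 K1); exists d => // s s0 sd.
have s0' := ltW s0.
have e1 := C0_ell s0' ef; have e2 := ellZ p1 s%:C eg.
have e3 := ellB p1 e1 ef.
have := hK _ _ (hd _ s0 sd).
rewrite (linB lS e3 e2) (linB lS e1 ef).
rewrite (linZ p1 _ lS eg) -(C0_add t0 s0' ef) addrC (C0_add s0' t0 ef).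
apply: nbW; rewrite mulrCA ler_wpM2l// mulrCA ler_piMr ?(ltW e0)//.
rewrite ler_pdivrMr// mul1r (le_trans (ler_norm K))// lerDl//.
Qed.

Lemma generator_bnd_commute (G : fn -> fn) K f g : lin p G -> bnd p G K ->
  (forall t h, 0 <= t -> ell m p h -> S t (G h) = G (S t h)) ->
  generator m p S f g -> generator m p S (G f) (G g).
Proof.
move=> lG bG com /C0_generatorP[ef eg h]; apply/C0_generatorP.
have K1 : 0 < `|K| + 1 by rewrite ltr_wpDl.
split; [exact: bnd_ell bG _|exact: bnd_ell bG _|].
move=> e e0; have [d d0 hd] := h _ (divr_gt0 e0 K1); exists d => // s s0 sd.
have s0' := ltW s0.
have e1 := C0_ell s0' ef; have e2 := ellZ p1 s%:C eg.
have e3 := ellB p1 e1 ef.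
have := bG _ _ (hd _ s0 sd).
rewrite (linB lG e3 e2) (linB lG e1 ef).
rewrite (linZ p1 _ lG eg) -com//.
apply: nbW; rewrite mulrCA ler_wpM2l// mulrCA ler_piMr ?(ltW e0)//.
rewrite ler_pdivrMr// mul1r (le_trans (ler_norm K))// lerDl//.
Qed.

End one_exponent.

Section two_exponents.
Variables p q : \bar R.
Hypotheses (p1 : (1 <= p)%E) (q1 : (1 <= q)%E).
Variables S T : R -> fn -> fn.
Hypotheses (S_C0 : C0_semigroup m p S) (T_C0 : C0_semigroup m q T).
Hypothesis ST : forall t f, 0 <= t -> ell m p f -> ell m q f -> S t f = T t f.

(* If [g] is the derivative of the orbit of [f] in l^q then
   [S t f - f = \int_0^t S s g ds], which is estimated in l^p through Riemann
   sums converging in l^q. *)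
Lemma generator_transfer_bound : exists2 d, 0 < d &
  forall f g, ell m p f -> ell m p g -> generator m q T f g ->
  forall t W, 0 <= t -> t < d -> 0 <= W ->
    (forall s, 0 <= s -> s <= t -> nb p (fun x => S s g x - g x) W) ->
    nb p (fun x => S t f x - f x - t%:C * g x) (t * W).
Proof.
have [d [M [d0 M0 hM]]] := C0_locally_bounded q1 T_C0.
exists d => // f g efp egp; rewrite (C0_generatorP q1) => -[ef eg hgen] t W t0 td W0 hW.
have [t00|tn0] := eqVneq t 0.
  rewrite t00 mul0r (C0_zero S_C0 efp).
  by apply: eq_nb (nb0 p1) => x; rewrite subrr mul0r subrr.
have {}t0 : 0 < t by rewrite lt_def tn0.
apply: (nb_fatou p1) => [|A e e0]; first by rewrite mulr_ge0// ltW.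
have [c c0 hc] : exists2 c : R, 0 < c & forall h B, nb q h B ->
    forall x, x \in A -> normc (h x) <= c * B.
  elim/fset1U_rect: A => [|y A yA [c c0 hc]]; first by exists 1.
  have [c' c'0 hc'] := nb_pt q1 y.
  exists (c + c') => [|h B hB x]; first by rewrite addr_gt0.
  have B0 := nb_ge0 hB; rewrite mulrDl !inE => /orP[/eqP->|xA].
    by rewrite (le_trans (hc' _ _ hB))// lerDr mulr_ge0// ltW.
  by rewrite (le_trans (hc _ _ hB _ xA))// lerDl mulr_ge0// ltW.
(* There are [n = t / h] errors of size [M h eps], in total [M t eps <= e / c], which becomes [e] at
   the points of [A]. *)
have eps0 : 0 < e / c / t / (M + 1) by rewrite !divr_gt0// ltr_wpDl.
have [d1 d10 hd1] := hgen _ eps0.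
have := truncnS_gt (t / d1); set n := (Num.truncn _).+1 => tn.
have n0 : 0 < n%:R :> R by rewrite ltr0n.
pose h := t / n%:R; have h0 : 0 < h by rewrite divr_gt0.
have hd : h < d1 by rewrite ltr_pdivrMr// mulrC -ltr_pdivrMr.
have kh k : (k <= n)%N -> k%:R * h <= t.
  by move=> kn; rewrite /h mulrCA ler_piMr ?(ltW t0)// ler_pdivrMr// mul1r ler_nat.
have kh0 k : 0 <= k%:R * h by rewrite mulr_ge0// ltW.
(* [D k] is the error of the [k]-th step, transported by the semigroup and small in [l^q]. [E k]
   below is the sample [S (k h) g - g] of the integrand, bounded in [l^p]. It is introduced
   abstractly so that it stays folded. *)
pose D k x := T (k%:R * h) (fun y => T h f y - f y - h%:C * g y) x.
have [E EE] : exists E : nat -> fn, forall k x, E k x = S (k%:R * h) g x - g x.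
  by eexists.
have hD : nb q (fun x => \sum_(k < n) D k x) (e / c).
  apply: nbW (nb_sum q1 (b := M * (h * (e / c / t / (M + 1)))) _); last first.
    move=> k kn; apply: hM => //; last exact: hd1.
    by apply: le_trans (kh k (ltnW kn)) (ltW td).
  rewrite (_ : n%:R * _ = e / c * (M / (M + 1))); last first.
    have M1 : M + 1 != 0 by rewrite gt_eqF// ltr_wpDl.
    by rewrite /h; move: (n%:R : R) n0 => N N0; field; rewrite M1 !gt_eqF.
  rewrite ler_piMr ?divr_ge0 ?(ltW e0) ?(ltW c0)//.
  by rewrite ler_pdivrMr ?ltr_wpDl// mul1r lerDl.
have hE : nb p (fun x => h%:C * \sum_(k < n) E k x) (t * W).
  have := nbZ p1 h%:C (nb_sum p1 (b := W) (F := E) (n := n) _).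
  rewrite normcR0 ?(ltW h0)// mulrA (_ : h * n%:R = t); last first.
    by rewrite /h divfK ?gt_eqF.
  by apply=> k kn; apply: eq_nb (hW _ (kh0 k) (kh k (ltnW kn))) => x; rewrite EE.
exists (fun x => h%:C * \sum_(k < n) E k x); first by apply: nbW hE; rewrite lerDl ltW.
move=> x xA.
(* Telescoping over the steps: the remainder minus its Riemann sum is exactly the sum of the step
   errors. *)
suff -> : S t f x - f x - t%:C * g x - h%:C * (\sum_(k < n) E k x) =
    \sum_(k < n) D k x.
  by apply: le_trans (hc _ _ hD _ xA) _; rewrite mulrC divfK ?gt_eqF.
have Dk k : D k x = T (k.+1%:R * h) f x - T (k%:R * h) f x - h%:C * (E k x + g x).
  have lT := C0_lin T_C0 (kh0 k).
  have e1 := C0_ell T_C0 (ltW h0) ef.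
  have e2 := ellZ q1 h%:C eg.
  have e3 := ellB q1 e1 ef.
  rewrite /D (linB lT e3 e2) (linB lT e1 ef).
  rewrite (linZ q1 _ lT eg) -(C0_add T_C0 (kh0 k) (ltW h0) ef).
  by rewrite EE (ST (kh0 k) egp eg) subrK -natr1 mulrDl mul1r.
under [RHS]eq_bigr do rewrite Dk.
rewrite [RHS]sumrB -mulr_sumr.
rewrite -(big_mkord xpredT (fun k => T (k.+1%:R * h) f x - T (k%:R * h) f x)).
rewrite (telescope_sumr (fun k => T (k%:R * h) f x))// mul0r (C0_zero T_C0 ef).
rewrite big_split /= sumr_const card_ord.
have nh : n%:R * h = t by rewrite /h mulrC divfK ?gt_eqF.
have tE : t%:C = n%:R * h%:C by rewrite -nh rmorphM rmorph_nat.
rewrite nh -(ST (ltW t0) efp ef) tE -[g x *+ n]mulr_natl.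
by move: (\sum_(k < n) E k x) (S t f x) (n%:R : R[i]) => a b N; ring.
Qed.

End two_exponents.
End Semigroups.

(** * Resolvents *)

Section Resolvents.

(* [A f (g + z f)] says that [(A - z) f = g]. *)
Definition resolves (p : \bar R) (A : operator R X) (z : R[i]) (K : R) : Prop :=
  [/\ 0 <= K,
   forall g, ell m p g -> exists f, A f (fun x => g x + z * f x) &
   forall f h B, A f h -> nb p (fun x => h x - z * f x) B -> nb p f (K * B)].

(** Uniqueness of solutions comes from the lower bound applied to the difference of two of them,
    which is why the graph has to be closed under differences. *)
Lemma resolvent_setP p A z : (1 <= p)%E ->
  (forall f h, A f h -> ell m p f /\ ell m p h) ->
  (forall f h f' h', A f h -> A f' h' ->
     A (fun x => f x - f' x) (fun x => h x - h' x)) ->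
  resolvent_set m p A z <-> exists K, resolves p A z K.
Proof.
move=> p1 Aell Asub; split=> [[sur [K hK]]|[K [K0 sur low]]].
  exists `|K|; split=> //.
    move=> g eg; have [f [[h Afh hg] _]] := sur _ eg; exists f.
    by rewrite -hg (_ : (fun x => _) = h)//; apply/funext => x; rewrite subrK.
  move=> f h B Afh hB; have B0 := nb_ge0 hB; have N := nb_norm hB.
  apply: le_trans (hK _ _ Afh) _; rewrite N -EFinM lee_fin.
  set n := fine _ in N *.
  have n0 : 0 <= n by rewrite fine_ge0// lpnorm_ge0.
  have nB : n <= B by rewrite -lee_fin -N.
  by apply: le_trans (ler_wpM2r n0 (ler_norm K)) _; rewrite ler_wpM2l.
split=> [g eg|]; last first.
  exists K => f h Afh; have [ef eh] := Aell _ _ Afh.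
  have ez := ellB p1 eh (ellZ p1 z ef).
  have := low _ _ _ Afh (nb_self ez); rewrite /nb EFinM fineK//.
  by rewrite ge0_fin_numE ?lpnorm_ge0.
have [f Af] := sur _ eg; exists f; split.
  by exists (fun x => g x + z * f x) => //; apply/funext => x; rewrite addrK.
move=> f' [h' Af' hg]; apply/funext => x.
have H B := low _ _ B (Asub _ _ _ _ Af Af').
have /(nb_eq0 p1)/(_ x) : nb p (fun x => f x - f' x) 0.
  rewrite -(mulr0 K); apply: H; apply: eq_nb (nb0 p1) => y.
  have := congr1 (fun u : fn => u y) hg => /= <-; ring.
by move=> /eqP; rewrite subr_eq0 => /eqP.
Qed.

Lemma banach_fixpoint p (T : fn -> fn) k : (1 <= p)%E -> 0 <= k -> k < 1 ->
  (forall u, ell m p u -> ell m p (T u)) ->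
  (forall u v B, ell m p u -> ell m p v ->
     nb p (fun x => u x - v x) B -> nb p (fun x => T u x - T v x) (k * B)) ->
  exists2 f, ell m p f & T f = f.
Proof.
move=> p1 k0 k1 eT cT; have k10 : 0 < 1 - k by lra.
pose u := fix u n := if n is n'.+1 then T (u n') else (fun=> 0) : fn.
have eu n : ell m p (u n) by elim: n => [|n ih]; [exact: ell0|exact: eT].
have [D hD] := (ellP _ _).1 (ellB p1 (eu 1%N) (eu 0%N)).
have D0 := nb_ge0 hD.
have step n : nb p (fun x => u n.+1 x - u n x) (k ^+ n * D).
  elim: n => [|n ih]; first by rewrite expr0 mul1r.
  by rewrite exprS -mulrA; exact: (cT (u n.+1) (u n)).
(* Again the exact geometric sum, for the sake of the induction. *)
have tail n j : nb p (fun x => u (n + j)%N x - u n x) ((k ^+ n - k ^+ (n + j)) * (D / (1 - k))).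
  elim: j => [|j ih].
    by rewrite addn0 subrr mul0r; apply: eq_nb (nb0 p1) => x; rewrite subrr.
  have := nbD p1 (step (n + j)%N) ih; rewrite addnS.
  rewrite [X in nb _ _ X](_ : _ = (k ^+ n - k ^+ (n + j).+1) * (D / (1 - k))); last first.
    by rewrite exprS; field; rewrite gt_eqF.
  by apply: eq_nb => x; ring.
have tail' n i : (n <= i)%N -> nb p (fun x => u i x - u n x) (k ^+ n * (D / (1 - k))).
  move=> /subnKC <-; apply: nbW (tail n _).
  by rewrite ler_wpM2r ?divr_ge0 ?(ltW k10)// gerDl oppr_le0 exprn_ge0.
have small (e : R) : 0 < e -> exists N, k ^+ N * (D / (1 - k)) <= e.
  move=> e0; have M0 : 0 < D / (1 - k) + 1 by rewrite ltr_wpDl// divr_ge0// ltW.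
  have [N hN] := exp_small k0 k1 (divr_gt0 e0 M0); exists N.
  have d0 : 0 <= D / (1 - k) by rewrite divr_ge0 ?(ltW k10).
  apply: le_trans (ler_wpM2r d0 hN) _.
  by rewrite mulrAC -mulrA ler_piMr ?(ltW e0)// ler_pdivrMr// mul1r lerDl.
have [|f hf] := nb_complete p1 (u := u).
  move=> e e0; have [N hN] := small _ (divr_gt0 e0 (ltr0Sn R 1)); exists N => i j Ni Nj.
  have := nbB p1 (tail' _ _ Ni) (tail' _ _ Nj) => /(nbW (C := e)) h.
  by apply: eq_nb (h _); [move=> x; ring|lra].
have ef : ell m p f.
  have [N hN] := hf 1 ltr01.
  have := ellB p1 (eu N) (nb_ell (hN _ (leqnn N))).
  by congr (ell m _ _); apply/funext => x; ring.
exists f => //; apply/funext => x.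
have /(nb_eq0 p1)/(_ x) : nb p (fun x => T f x - f x) 0.
  apply: (nb_closed) => e e0; rewrite add0r.
  have e2 : 0 < e / 2 by rewrite divr_gt0.
  have [N hN] := hf _ e2.
  have h1 := hN _ (leqnSn N); have h2 := cT _ _ _ (eu N) ef (hN _ (leqnn N)).
  have := nbB p1 h1 h2 => /(nbW (C := e)) h.
  apply: eq_nb (h _); first by move=> y /=; ring.
  have : k * (e / 2) <= e / 2 by rewrite ler_piMl ?ltW.
  lra.
by move=> /eqP; rewrite subr_eq0 => /eqP.
Qed.

End Resolvents.

(** * The magnetic form and its operator *)

Section FiniteSupport.

Lemma CcP f : Cc f <-> exists A : {fset X}, forall x, x \notin A -> f x = 0.
Proof.
split=> [fin|[A hA]].
  exists (fset_set [set x | f x != 0]) => x; rewrite in_fset_set// => h.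
  by apply/eqP; apply: contraNT h => h; rewrite inE.
apply: (sub_finite_set (B := [set` A])); last exact: finite_fset.
by move=> x /= fx; apply: contraNT fx => /hA ->.
Qed.

Lemma CcD f g : Cc f -> Cc g -> Cc (fun x => f x + g x).
Proof.
move=> /CcP[A hA] /CcP[B hB]; apply/CcP; exists (A `|` B)%fset => x.
by rewrite inE negb_or => /andP[/hA -> /hB ->]; rewrite addr0.
Qed.

Lemma CcMl (a : X -> R[i]) f : Cc f -> Cc (fun x => a x * f x).
Proof.
by move=> /CcP[A hA]; apply/CcP; exists A => x /hA ->; rewrite mulr0.
Qed.

Lemma CcB f g : Cc f -> Cc g -> Cc (fun x => f x - g x).
Proof.
move=> hf hg; have := CcD hf (CcMl (fun=> -1) hg).
by congr (Cc _); apply/funext => x; rewrite mulN1r.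
Qed.

Lemma Cc0 : Cc ((fun=> 0) : X -> R[i]).
Proof. by apply/CcP; exists fset0. Qed.

Lemma Cc_cutoff (A : {fset X}) f : Cc (cutoff A f).
Proof. by apply/CcP; exists A => x /negPf h; rewrite /cutoff h. Qed.

Lemma Cc_delta (y : X) : Cc (delta y).
Proof.
apply/CcP; exists [fset y]%fset => x; rewrite inE /delta => /negPf ->//.
Qed.

Lemma Cc_ell p f : (1 <= p)%E -> Cc f -> ell m p f.
Proof.
move=> p1 /CcP[A hA]; apply/(ellP).
have [B hB] := nb_cut p1 A f; exists B; apply: eq_nb hB => x.
by rewrite /cutoff; case: ifPn => // /hA.
Qed.

Lemma sumle_finite (u : X -> R) (A : {fset X}) : (forall x, 0 <= u x) ->
  (forall x, x \notin A -> u x = 0) -> exists B, sumle u B.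
Proof.
move=> u0 h; have [|B hB] := @summ_finite R X (fun x => (u x)%:C) A.
  by move=> x /h ->.
by exists B; apply: le_sumle hB => // x; rewrite normcR0.
Qed.

End FiniteSupport.

Section MagneticForm.
Variables (b : X -> X -> R) (o : X -> X -> R[i]) (c : X -> R).
Hypothesis b_graph : is_graph b.
Hypothesis o_mag : is_magnetic_potential o.
Implicit Types v : X -> R[i].
Local Notation Q := (Qform b o c).
Local Notation Qq := (Qquad b o c).
Local Notation nab := (nabla o).

Let b_ge0 x y : 0 <= b x y. Proof. by case: b_graph. Qed.
Let b_sym x y : b x y = b y x. Proof. by case: b_graph. Qed.

Lemma normc_nabla2 f z :
  normc (nab f z) ^+ 2 <= 2 * normc (f z.1) ^+ 2 + 2 * normc (f z.2) ^+ 2.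
Proof.
have h : normc (nab f z) <= normc (f z.1) + normc (f z.2).
  rewrite /nabla (le_trans (normcB _ _))// normcM.
  by case: o_mag => -> _; rewrite mul1r.
apply: le_trans (_ : (normc (f z.1) + normc (f z.2)) ^+ 2 <= _).
  by rewrite ler_pXn2r ?nnegrE ?addr_ge0 ?normc_ge0.
have := sqr_ge0 (normc (f z.1) - normc (f z.2)).
by rewrite sqrrB sqrrD; lra.
Qed.

(** By [normc_nabla2] the energy is controlled by two sums of [b |f|^2], one for each endpoint. The
    first is finite because vertex degrees are, the second by the symmetry of [b]. *)
Lemma nabla_sum f : Cc f ->
  exists B, sumle (fun z : X * X => b z.1 z.2 * normc (nab f z) ^+ 2) B.
Proof.
move=> /CcP[A hA]; have [_ _ _ b_fin] := b_graph.
pose deg x := fine (\esum_(y in [set: X]) (b x y)%:E).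
have hdeg x : sumle (b x) (deg x) by exact: sumle_esum.
have deg0 x : 0 <= deg x := sumle_ge0 (hdeg x).
have [||D hD] := @sumle_finite (fun x => normc (f x) ^+ 2 * deg x) A.
- by move=> x; rewrite mulr_ge0 ?sqr_ge0.
- by move=> x /hA ->; rewrite Normc.normc0 expr0n mul0r.
have s1 : sumle (fun z : X * X => b z.1 z.2 * normc (f z.1) ^+ 2) D.
  apply: (sumle_pair (k := fun x y => b x y * normc (f x) ^+ 2) _ _ hD).
    by move=> x y; rewrite mulr_ge0 ?sqr_ge0.
  move=> x; apply: le_sumle (sumleZ (sqr_ge0 _) (hdeg x)) => // y.
  by rewrite mulrC.
have s2 : sumle (fun z : X * X => b z.1 z.2 * normc (f z.2) ^+ 2) D.
  by apply: le_sumle (sumle_swap s1) => // z /=; rewrite b_sym.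
have two : 0 <= 2 :> R by [].
exists (2 * D + 2 * D); apply: le_sumle (sumleD (sumleZ two s1) (sumleZ two s2)) => // z.
have := ler_wpM2l (b_ge0 z.1 z.2) (normc_nabla2 f z); lra.
Qed.

Lemma nablaD f g z : nab (fun x => f x + g x) z = nab f z + nab g z.
Proof. by rewrite /nabla; ring. Qed.

Lemma nablaZ a f z : nab (fun x => a * f x) z = a * nab f z.
Proof. by rewrite /nabla; ring. Qed.

(** Sums that do not converge absolutely have junk values, so every algebraic rule for [Q] rests on
    this lemma and on [potential_summ]. *)
Lemma kinetic_summ f g : Cc f -> Cc g ->
  summ (fun z : X * X => (b z.1 z.2)%:C * nab f z * conjc (nab g z)).
Proof.
move=> /nabla_sum[B hB] /nabla_sum[C hC]; exists (B + C).
apply: le_sumle (sumleD hB hC) => // z.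
rewrite !normcM normc_conj normcR0// -mulrDr -mulrA ler_wpM2l//.
have := sqr_ge0 (normc (nab f z) - normc (nab g z)).
rewrite sqrrB; have := sqr_ge0 (normc (nab f z)); have := sqr_ge0 (normc (nab g z)).
have := mulr_ge0 (normc_ge0 (nab f z)) (normc_ge0 (nab g z)); lra.
Qed.

Lemma potential_summ f g : Cc f ->
  summ (fun x => (c x)%:C * f x * conjc (g x)).
Proof.
move=> /CcP[A hA]; apply: (@summ_finite _ _ _ A) => x /hA ->.
by rewrite mulr0 mul0r.
Qed.

Lemma QformDl f g h : Cc f -> Cc g -> Cc h ->
  Q (fun x => f x + g x) h = Q f h + Q g h.
Proof.
move=> hf hg hh; rewrite /Qform addrACA -mulrDr.
rewrite -csumD; [|exact: kinetic_summ..].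
rewrite -csumD; [|exact: potential_summ..].
congr (_ * _ + _); apply: eq_csum => x; first by rewrite nablaD; ring.
by ring.
Qed.

Lemma QformZl a f h : Cc f -> Cc h -> Q (fun x => a * f x) h = a * Q f h.
Proof.
move=> hf hh; rewrite /Qform mulrDr mulrCA.
rewrite -(csumZ a (kinetic_summ hf hh)) -(csumZ a (potential_summ h hf)).
by congr (_ * _ + _); apply: eq_csum => x; rewrite ?nablaZ; ring.
Qed.

Lemma Qform_conj f g : Cc f -> Cc g -> Q g f = conjc (Q f g).
Proof.
move=> hf hg; rewrite /Qform conjcD conjcM.
rewrite -(csum_conj (kinetic_summ hf hg)) -(csum_conj (potential_summ g hf)).
have -> : conjc (2^-1 : R[i]) = 2^-1.
  by rewrite (_ : 2^-1 = (2^-1 : R)%:C) ?conjcR// fmorphV rmorph_nat.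
by congr (_ * _ + _); apply: eq_csum => z; rewrite !conjcM conjcR conjcK mulrAC.
Qed.

Lemma QformDr f g h : Cc f -> Cc g -> Cc h ->
  Q h (fun x => f x + g x) = Q h f + Q h g.
Proof.
move=> hf hg hh; rewrite Qform_conj//; last exact: CcD.
by rewrite QformDl// conjcD (Qform_conj hf hh) (Qform_conj hg hh).
Qed.

Lemma QformZr a f h : Cc f -> Cc h -> Q h (fun x => a * f x) = conjc a * Q h f.
Proof.
move=> hf hh; rewrite Qform_conj//; last exact: CcMl.
by rewrite QformZl// conjcM (Qform_conj hf hh).
Qed.

Lemma QformBl f g h : Cc f -> Cc g -> Cc h ->
  Q (fun x => f x - g x) h = Q f h - Q g h.
Proof.
move=> hf hg hh; rewrite -[- Q g h]mulN1r -QformZl// -QformDl//; last exact: CcMl.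
by congr (Q _ h); apply/funext => x; rewrite mulN1r.
Qed.

Lemma QformBr f g h : Cc f -> Cc g -> Cc h ->
  Q h (fun x => f x - g x) = Q h f - Q h g.
Proof.
move=> hf hg hh; rewrite Qform_conj//; last exact: CcB.
by rewrite QformBl// conjcB (Qform_conj hf hh) (Qform_conj hg hh).
Qed.

Lemma Qform_self f : Cc f -> Q f f = (Qq f)%:C.
Proof.
move=> hf; have := Qform_conj hf hf; rewrite /Qquad; case: (Q f f) => x y /eqP.
rewrite eq_complex /= => /andP[_ /eqP h]; apply/eqP; rewrite eq_complex /= eqxx /=.
by apply/eqP; lra.
Qed.

Lemma Qquad_expand f g t : Cc f -> Cc g ->
  Qq (fun x => f x + t * g x) =
  Qq f + 2 * Re (conjc t * Q f g) + normc t ^+ 2 * Qq g.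
Proof.
move=> hf hg; have htg : Cc (fun x => t * g x) by exact: (CcMl (fun=> t)).
rewrite /Qquad QformDl ?QformDr//; try exact: CcD.
rewrite !QformZl// !QformZr// (Qform_self hf) (Qform_self hg) (Qform_conj hf hg).
rewrite (mulrA t (conjc t)) mulcJ; move: (Q f g) (Qq f) (Qq g) => z u v.
rewrite !ReD ReZ.
have -> : Re (t * conjc z) = Re (conjc t * z).
  by rewrite -Re_conjc conjcM conjcK.
by rewrite /=; ring.
Qed.

Lemma Qquad_kinetic f : Cc f ->
  Qq f = 2^-1 * Re (csum (fun z : X * X => (b z.1 z.2 * normc (nab f z) ^+ 2)%:C))
   + Re (csum (fun x => (c x * normc (f x) ^+ 2)%:C)).
Proof.
move=> hf; rewrite /Qquad /Qform ReD; congr (_ + _); last first.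
  by congr Re; apply: eq_csum => x; rewrite -mulrA mulcJ -rmorphM.
rewrite -ReZ fmorphV rmorph_nat; congr (Re (_ * _)).
by apply: eq_csum => z; rewrite -mulrA mulcJ -rmorphM.
Qed.

Hypothesis Q_pos : Q_positive b o c.

Lemma Qquad_ge0 f : Cc f -> 0 <= Qq f.
Proof. by move=> hf; have := Q_pos hf; rewrite Qform_self// ler0c. Qed.

Lemma Qform_CS f g : Cc f -> Cc g -> normc (Q f g) <= sqrt (Qq f) * sqrt (Qq g).
Proof.
move=> hf hg; rewrite -(@ler_pXn2r _ 2) ?nnegrE ?mulr_ge0 ?normc_ge0 ?sqrtr_ge0//.
rewrite [leRHS]exprMn (sqr_sqrtr (Qquad_ge0 hf)) (sqr_sqrtr (Qquad_ge0 hg)).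
apply: quad_discriminant.
  exact: Qquad_ge0.
move=> t; rewrite -Qquad_expand//; apply: Qquad_ge0; apply: CcD => //.
exact: (CcMl (fun=> t)).
Qed.

Lemma sqrt_QquadD f g : Cc f -> Cc g ->
  sqrt (Qq (fun x => f x + g x)) <= sqrt (Qq f) + sqrt (Qq g).
Proof.
move=> hf hg.
rewrite -(@ler_pXn2r _ 2) ?nnegrE ?addr_ge0 ?sqrtr_ge0//.
have hfg := CcD hf hg.
rewrite sqrrD !sqr_sqrtr ?Qquad_ge0//.
have := Qquad_expand 1 hf hg.
rewrite (_ : (fun x => f x + 1 * g x) = (fun x => f x + g x)); last first.
  by apply/funext => x; rewrite mul1r.
move=> ->; rewrite rmorph1 mul1r (_ : normc 1 = 1); last exact: Normc.normc1.
rewrite expr1n mul1r -mulr_natl.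
have := le_trans (le_Re_normc _) (Qform_CS hf hg); lra.
Qed.

Lemma QquadZ a f : Cc f -> Qq (fun x => a * f x) = normc a ^+ 2 * Qq f.
Proof.
move=> hf; rewrite /Qquad QformZl ?QformZr//; last exact: CcMl.
by rewrite mulrA mulcJ ReZ.
Qed.

Lemma sqrt_QquadB f g : Cc f -> Cc g ->
  sqrt (Qq (fun x => f x - g x)) <= sqrt (Qq f) + sqrt (Qq g).
Proof.
move=> hf hg; have hg' : Cc (fun x => -1 * g x) by exact: (CcMl (fun=> -1)).
have := sqrt_QquadD hf hg'.
rewrite (QquadZ _ hg) normcN (_ : normc 1 = 1) ?expr1n ?mul1r; last exact: Normc.normc1.
by congr (sqrt (Qq _) <= _); apply/funext => x; rewrite mulN1r.
Qed.

(** The squared [l^2] norm; [q] is then the squared form norm, in which all later estimates are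
    made. *)
Definition n2 f := Re (pairing m f f).
Definition q f := Qq f + n2 f.

Lemma n2_sum f : Cc f -> sumle (fun x => m x * normc (f x) ^+ 2) (n2 f).
Proof.
move=> /CcP[A hA].
have u0 x : 0 <= m x * normc (f x) ^+ 2 by rewrite mulr_ge0 ?sqr_ge0// ltW.
have [|B hB] := @sumle_finite _ A u0.
  by move=> x /hA ->; rewrite Normc.normc0 expr0n mulr0.
have := sumle_csum u0 hB; congr (sumle _ (Re _)).
by apply: eq_csum => x; rewrite -mulrA mulcJ rmorphM.
Qed.

Lemma Cc_psumm f g : Cc f -> Cc g -> psumm f g.
Proof.
by move=> hf hg; apply: psumm22; exact: Cc_ell.
Qed.

Lemma n2_expand f g t : Cc f -> Cc g ->
  n2 (fun x => f x + t * g x) =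
  n2 f + 2 * Re (conjc t * pairing m f g) + normc t ^+ 2 * n2 g.
Proof.
move=> hf hg; have htg : Cc (fun x => t * g x) by exact: (CcMl (fun=> t)).
have P := Cc_psumm; have hfg := CcD hf htg.
rewrite /n2 (pairingDl (P _ _ hf hfg) (P _ _ htg hfg)).
rewrite !(pairingDr (P _ _ _ hf) (P _ _ _ htg))//.
rewrite !(pairingZl)//; try exact: P.
rewrite !(pairingZr)//; try exact: P.
rewrite (pairing_conj (P _ _ hf hg)) mulrA mulcJ !ReD ReZ.
have -> : Re (t * conjc (pairing m f g)) = Re (conjc t * pairing m f g).
  by rewrite -Re_conjc conjcM conjcK.
by ring.
Qed.

Lemma n2_ge0 f : Cc f -> 0 <= n2 f.
Proof. by move=> /n2_sum /sumle_ge0. Qed.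

Lemma n2_le f B : nb 2%:E f B -> n2 f <= B ^+ 2.
Proof. exact: Re_pairing_self_le. Qed.

Lemma nb_n2 f : Cc f -> nb 2%:E f (sqrt (n2 f)).
Proof.
move=> hf; apply/(nb2E _ (sqrtr_ge0 _)).
by rewrite sqr_sqrtr ?n2_ge0//; exact: n2_sum.
Qed.

Lemma q_ge0 f : Cc f -> 0 <= q f.
Proof. by move=> hf; rewrite addr_ge0 ?Qquad_ge0 ?n2_ge0. Qed.

Lemma n2_le_q f : Cc f -> n2 f <= q f.
Proof. by move=> hf; rewrite lerDr Qquad_ge0. Qed.

Lemma Qquad_le_q f : Cc f -> Qq f <= q f.
Proof. by move=> hf; rewrite lerDl n2_ge0. Qed.

Lemma nb_sqrt_q f : Cc f -> nb 2%:E f (sqrt (q f)).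
Proof.
by move=> hf; apply: nbW (nb_n2 hf); rewrite ler_sqrt ?n2_le_q// q_ge0.
Qed.

Lemma Qform_le_q f g : Cc f -> Cc g ->
  normc (Q f g) <= sqrt (Qq f) * sqrt (q g).
Proof.
move=> hf hg; apply: le_trans (Qform_CS hf hg) _.
by rewrite ler_wpM2l ?sqrtr_ge0// ler_sqrt ?q_ge0// Qquad_le_q.
Qed.

Lemma q_eq0 f : Cc f -> q f = 0 -> forall x, f x = 0.
Proof.
move=> hf q0; apply: (nb_eq0 (p := 2%:E)); first exact: le12.
by have := nb_sqrt_q hf; rewrite q0 sqrtr0.
Qed.

Lemma sqrt_qD f g : Cc f -> Cc g ->
  sqrt (q (fun x => f x + g x)) <= sqrt (q f) + sqrt (q g).
Proof.
move=> hf hg.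
have hfg := CcD hf hg.
have s0 : 0 <= sqrt (q f) + sqrt (q g) by rewrite addr_ge0 ?sqrtr_ge0.
rewrite -(@ler_pXn2r _ 2) ?nnegrE ?sqrtr_ge0//.
rewrite sqrrD !sqr_sqrtr ?q_ge0// /q.
have CS : normc (Q f g + pairing m f g) <= sqrt (q f) * sqrt (q g).
  rewrite -(@ler_pXn2r _ 2) ?nnegrE ?normc_ge0 ?mulr_ge0 ?sqrtr_ge0//.
  rewrite [leRHS]exprMn (sqr_sqrtr (q_ge0 hf)) (sqr_sqrtr (q_ge0 hg)).
  apply: quad_discriminant => [|t]; first exact: q_ge0.
  have := q_ge0 (CcD hf (CcMl (fun=> t) hg)).
  rewrite /q (Qquad_expand _ hf hg) (n2_expand _ hf hg) => h.
  have -> : conjc t * (Q f g + pairing m f g) =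
      conjc t * Q f g + conjc t * pairing m f g by ring.
  by rewrite ReD; lra.
have := Qquad_expand 1 hf hg; have := n2_expand 1 hf hg.
rewrite (_ : (fun x => f x + 1 * g x) = (fun x => f x + g x)); last first.
  by apply/funext => x; rewrite mul1r.
move=> -> ->; rewrite (_ : conjc 1 = 1) ?rmorph1// !mul1r normc_one.
rewrite expr1n !mul1r -mulr_natl.
have := le_trans (le_Re_normc _) CS; rewrite ReD /q; lra.
Qed.

Lemma Cc_ell2 f : Cc f -> ell2 f.
Proof. exact: Cc_ell. Qed.

(** * The closure of the form and its operator *)

Lemma rcvg0P (u : nat -> R) : (forall n, 0 <= u n) ->
  (u @ \oo --> (0 : R)) <->
  forall e, 0 < e -> exists N, forall n, (N <= n)%N -> u n <= e.
Proof.
move=> u0; split=> [/cvgrPdist_le h e e0|h].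
  have /near_oo[N hN] := h _ e0; exists N => n /hN.
  by rewrite sub0r normrN ger0_norm.
apply/cvgrPdist_le => e e0; have [N hN] := h _ e0; apply/near_oo; exists N => n /hN.
by rewrite sub0r normrN ger0_norm.
Qed.

Lemma Q_approxP (phi : nat -> X -> R[i]) f : Q_approx m b o c phi f <->
  [/\ forall n, Cc (phi n),
   forall e, 0 < e -> exists N, forall i j, (N <= i)%N -> (N <= j)%N ->
     sqrt (Qq (fun x => phi i x - phi j x)) <= e
   & forall e, 0 < e -> exists N, forall n, (N <= n)%N ->
     nb2 (fun x => phi n x - f x) e].
Proof.
split=> [[h1 h2 h3]|[h1 h2 h3]]; split=> //.
- move=> e e0; have [N hN] := h2 (e ^+ 2) (exprn_gt0 2 e0); exists N => i j Ni Nj.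
  rewrite -(ger0_norm (ltW e0)) -sqrtr_sqr ler_sqrt ?sqr_ge0//.
  by apply: ltW; exact: hN.
- move=> e e0; have := h3; rewrite ecvg0P; last by move=> t; exact: lpnorm_ge0.
  by move=> /(_ _ e0) /near_oo.
- move=> e e0; have e2 : 0 < sqrt (e / 2) by rewrite sqrtr_gt0 divr_gt0.
  have [N hN] := h2 _ e2; exists N => i j Ni Nj.
  have := hN _ _ Ni Nj; rewrite ler_sqrt ?divr_ge0 ?(ltW e0)//.
  by move=> /le_lt_trans; apply; lra.
- rewrite ecvg0P; last by move=> t; exact: lpnorm_ge0.
  by move=> e e0; apply/near_oo; exact: h3.
Qed.

Lemma Q_approxB (phi psi : nat -> X -> R[i]) f g :
  Q_approx m b o c phi f -> Q_approx m b o c psi g ->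
  Q_approx m b o c (fun n x => phi n x - psi n x) (fun x => f x - g x).
Proof.
move=> /Q_approxP[h1 h2 h3] /Q_approxP[k1 k2 k3]; apply/Q_approxP; split.
- by move=> n; exact: CcB.
- move=> e e0; have e2 : 0 < e / 2 by rewrite divr_gt0.
  have [N hN] := h2 _ e2; have [M hM] := k2 _ e2; exists (maxn N M) => i j.
  rewrite !geq_max => /andP[Ni Mi] /andP[Nj Mj].
  have := sqrt_QquadB (CcB (h1 i) (h1 j)) (CcB (k1 i) (k1 j)).
  have := hN _ _ Ni Nj; have := hM _ _ Mi Mj.
  rewrite (_ : (fun x => phi i x - phi j x - (psi i x - psi j x)) =
    (fun x => phi i x - psi i x - (phi j x - psi j x))); first by lra.
  by apply/funext => x; ring.
- move=> e e0; have e2 : 0 < e / 2 by rewrite divr_gt0.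
  have [N hN] := h3 _ e2; have [M hM] := k3 _ e2; exists (maxn N M) => n.
  rewrite !geq_max => /andP[Nn Mn].
  have := nbB le12 (hN _ Nn) (hM _ Mn); rewrite -splitr.
  by apply: eq_nb => x; ring.
Qed.

Lemma Q_approx_cst psi : Cc psi -> Q_approx m b o c (fun=> psi) psi.
Proof.
move=> hp; apply/Q_approxP; split=> // e e0; exists 0%N => *.
  rewrite (_ : (fun x => psi x - psi x) = (fun x => 0 * psi x)); last first.
    by apply/funext => x; rewrite subrr mul0r.
  by rewrite (QquadZ _ hp) normc_zero expr0n mul0r sqrtr0 ltW.
by apply: nbW (ltW e0) _; apply: eq_nb (nb0 le12) => x; rewrite subrr.
Qed.

Lemma Q_approx_bounded (phi : nat -> X -> R[i]) f : Q_approx m b o c phi f ->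
  exists N B, forall n, (N <= n)%N -> sqrt (Qq (phi n)) <= B.
Proof.
move=> /Q_approxP[h1 h2 h3]; have [N hN] := h2 1 ltr01.
exists N, (1 + sqrt (Qq (phi N))) => n Nn.
have := sqrt_QquadD (CcB (h1 n) (h1 N)) (h1 N); have := hN _ _ Nn (leqnn N).
rewrite (_ : (fun x => phi n x - phi N x + phi N x) = phi n); first by lra.
by apply/funext => x; rewrite subrK.
Qed.

Hypothesis Q_clos : Q_closable m b o c.

(** Closability enters here, applied to the difference of the two sequences, which approximates
    [0]. *)
Lemma Q_approx_uniq (phi psi : nat -> X -> R[i]) f :
  Q_approx m b o c phi f -> Q_approx m b o c psi f ->
  forall e, 0 < e -> exists N, forall n, (N <= n)%N ->
    sqrt (Qq (fun x => phi n x - psi n x)) <= e.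
Proof.
move=> h k; have hk := Q_approxB h k.
have h0 : Q_approx m b o c (fun n x => phi n x - psi n x) (fun=> 0).
  by move: hk; congr (Q_approx m b o c _ _); apply/funext => x; rewrite subrr.
have [h1 _ _] := h0; have /rcvg0P H := Q_clos h0.
move=> e e0; have [|N hN] := H _ (e ^+ 2) (exprn_gt0 2 e0).
  by move=> n; exact: Qquad_ge0.
exists N => n Nn; rewrite -(ger0_norm (ltW e0)) -sqrtr_sqr ler_sqrt ?sqr_ge0//.
exact: hN.
Qed.

(* The operator of the closed form, described on its core: [f] is in the domain
   with image [h] iff [f] is an l^2-limit of [phi] in [Cc] on which
   [Q phi] and [<h, .>] are close for the form norm. *)
Definition form_graph f h : Prop :=
  [/\ ell2 f, ell2 h & forall e, 0 < e -> exists phi, [/\ Cc phi,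
     nb2 (fun x => phi x - f x) e &
     forall psi, Cc psi -> normc (Q phi psi - pairing m h psi) <= e * sqrt (q psi)]].

(** [Qbar_eq] provides a limit along some pair of sequences; [Q_approx_uniq] and Cauchy-Schwarz
    transfer it to the given [phi] and the constant sequence [psi]. *)
Let form_operator_approx f h (phi : nat -> X -> R[i]) psi : form_operator m b o c f h ->
  Q_approx m b o c phi f -> Cc psi ->
  forall e, 0 < e -> exists N, forall n, (N <= n)%N ->
    normc (Q (phi n) psi - pairing m h psi) <= e.
Proof.
move=> [_ eh hQ] hphi hpsi e e0.
have Dpsi : Qbar_dom m b o c psi.
  by split; [exact: Cc_ell2|exists (fun=> psi); exact: Q_approx_cst].
have [phi' [psi' [hphi' hpsi']]] := hQ _ Dpsi.
move=> /(rcvg0P (fun n => normc_ge0 _)) cv.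
have [N1 [B hB]] := Q_approx_bounded hphi'.
have B0 : 0 <= B := le_trans (sqrtr_ge0 _) (hB _ (leqnn _)).
have e3 : 0 < e / 3 by rewrite divr_gt0.
pose k := 1 + B + sqrt (Qq psi).
have k0 : 0 < k by rewrite /k -addrA ltr_pwDl// addr_ge0// sqrtr_ge0.
have e'0 : 0 < e / 3 / k by rewrite divr_gt0.
have [N2 h2] := Q_approx_uniq hphi hphi' e'0.
have [N3 h3] := Q_approx_uniq hpsi' (Q_approx_cst hpsi) e'0.
have [N4 h4] := cv _ e3.
exists (maxn (maxn N1 N2) (maxn N3 N4)) => n; rewrite !geq_max.
move=> /andP[/andP[/hB b1 /h2 b2] /andP[/h3 b3 /h4 b4]].
have [[c1 _ _] [c1' _ _] [d1 _ _]] := And3 hphi hphi' hpsi'.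
have E : Q (phi n) psi - pairing m h psi = Q (fun x => phi n x - phi' n x) psi
  - Q (phi' n) (fun x => psi' n x - psi x)
  + (Q (phi' n) (psi' n) - pairing m h psi).
  by rewrite QformBl// QformBr//; ring.
rewrite E; apply: le_trans (normcD _ _) _.
apply: le_trans (lerD (normcB _ _) b4) _.
have a1 := Qform_CS (CcB (c1 n) (c1' n)) hpsi.
have a2 := Qform_CS (c1' n) (CcB (d1 n) hpsi).
have s0 := sqrtr_ge0 (Qq psi).
have m1 : sqrt (Qq (fun x => phi n x - phi' n x)) * sqrt (Qq psi) <= e / 3 / k * k.
  apply: ler_pM => //; rewrite ?sqrtr_ge0// /k; lra.
have m2 : sqrt (Qq (phi' n)) * sqrt (Qq (fun x => psi' n x - psi x)) <= k * (e / 3 / k).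
  apply: ler_pM => //; rewrite ?sqrtr_ge0// /k; lra.
rewrite divfK ?gt_eqF// in m1; rewrite [leRHS]mulrC divfK ?gt_eqF// in m2.
lra.
Qed.

(** From left to right a late member of an approximating sequence serves. Conversely, the [phi] for
    [e = 1 / (n + 1)] form an approximating sequence, since testing their defects with their own
    differences makes them Cauchy for [Q]. *)
Lemma form_operatorP f h : form_operator m b o c f h <-> form_graph f h.
Proof.
split=> [hf|[ef eh H]].
  have [[ef [phi hphi]] eh _] := hf; split=> // e e0.
  have /Q_approxP[h1 h2 h3] := hphi.
  have [N hN] := h2 _ e0; have [M hM] := h3 _ e0.
  exists (phi (maxn N M)); split=> //; first by apply: hM; exact: leq_maxr.
  move=> psi hpsi; apply: le_all_eps => d d0.
  have [K hK] := form_operator_approx hf hphi hpsi d0.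
  pose k := maxn K N.
  have E : Q (phi (maxn N M)) psi - pairing m h psi =
    Q (fun x => phi (maxn N M) x - phi k x) psi + (Q (phi k) psi - pairing m h psi).
    by rewrite QformBl//; ring.
  rewrite E; apply: le_trans (normcD _ _) _; apply: lerD; last first.
    by apply: hK; exact: leq_maxl.
  apply: le_trans (Qform_le_q (CcB (h1 _) (h1 _)) hpsi) _.
  by rewrite ler_wpM2r ?sqrtr_ge0// hN ?leq_maxl ?leq_maxr.
have n0 (n : nat) : 0 < (n.+1%:R)^-1 :> R by rewrite invr_gt0.
have /choice[phi hphi] := fun n => H _ (n0 n).
have inv_small (e : R) : 0 < e -> exists N : nat, forall n, (N <= n)%N -> n.+1%:R^-1 <= e.
  move=> e0; have := truncnS_gt e^-1; set N := Num.truncn _ => Ne; exists N => n Nn.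
  rewrite invf_ple ?posrE//; apply: le_trans (ltW Ne) _; rewrite ler_nat.
  by rewrite ltnS.
have aphi : Q_approx m b o c phi f.
  apply/Q_approxP; split; first by move=> n; have [] := hphi n.
    move=> e e0; have e4 : 0 < e / 4 by rewrite divr_gt0.
    have [N hN] := inv_small _ e4; exists N => i j /hN Ni /hN Nj.
    have [ci ni Li] := hphi i; have [cj nj Lj] := hphi j.
    have cij := CcB ci cj; set psi := (fun x => phi i x - phi j x) in cij *.
    pose t := sqrt (q psi); have t0 : 0 <= t := sqrtr_ge0 _.
    (* The two defects are tested with [psi], the difference itself. Together with [n2E] this gives
       [t^2 <= (e / 2) t + (e / 2)^2], which is impossible for [t > e]. *)
    have QqE : Qq psi <= e / 2 * t.
      have : normc (Q psi psi) <= e / 2 * t.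
        rewrite {1}/psi QformBl//.
        rewrite (_ : _ - _ = (Q (phi i) psi - pairing m h psi) -
           (Q (phi j) psi - pairing m h psi)); last by ring.
        apply: le_trans (normcB _ _) _.
        apply: le_trans (lerD (Li _ cij) (Lj _ cij)) _; rewrite -/t.
        rewrite -mulrDl ler_wpM2r//; apply: le_trans (lerD Ni Nj) _; lra.
      by rewrite (Qform_self cij) normcR0 ?Qquad_ge0.
    have n2E : n2 psi <= (e / 2) ^+ 2.
      apply: n2_le; have := nbB le12 ni nj.
      move=> hh; apply: eq_nb (nbW _ hh); [move=> x; rewrite /psi; ring|].
      by apply: le_trans (lerD Ni Nj) _; lra.
    have tE : t ^+ 2 = Qq psi + n2 psi by rewrite /t sqr_sqrtr// q_ge0.
    have te : t <= e.
      rewrite leNgt; apply/negP => te.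
      have : e / 2 * t + (e / 2) ^+ 2 < t ^+ 2 by nra.
      lra.
    by apply: le_trans te; rewrite ler_sqrt ?q_ge0// Qquad_le_q.
  move=> e e0; have [N hN] := inv_small _ e0; exists N => n /hN Nn.
  by have [_ hn _] := hphi n; exact: nbW hn.
split=> //; first by split=> //; exists phi.
move=> psi [epsi [psi' hpsi']]; exists phi, psi'; split=> //.
have [N1 [B hB]] := Q_approx_bounded hpsi'.
have /Q_approxP[c1 _ h3] := hpsi'.
have [A hA] := (ellP _ _).1 epsi; have A0 := nb_ge0 hA.
have [D hD] := (ellP _ _).1 eh; have D0 := nb_ge0 hD.
have B0 : 0 <= B := le_trans (sqrtr_ge0 _) (hB _ (leqnn _)).
apply/(rcvg0P (fun n => normc_ge0 _)) => e e0.
have [N2 hN2] := h3 1 ltr01.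
pose k := 1 + B + A + D; have k0 : 0 < k by rewrite /k; lra.
have e2 : 0 < e / 2 / k by rewrite !divr_gt0.
have [N3 hN3] := h3 _ e2; have [N4 hN4] := inv_small _ e2.
exists (maxn (maxn N1 N2) (maxn N3 N4)) => n; rewrite !geq_max.
move=> /andP[/andP[/hB b1 /hN2 b2] /andP[/hN3 b3 /hN4 b4]].
have [cn _ /(_ _ (c1 n)) Ln] := hphi n.
have ps1 := psumm22 eh (Cc_ell2 (c1 n)).
have ps2 := psumm22 eh epsi.
have E : Q (phi n) (psi' n) - pairing m h psi =
  (Q (phi n) (psi' n) - pairing m h (psi' n)) + pairing m h (fun x => psi' n x - psi x).
  by rewrite (pairingBr)//; ring.
rewrite E; apply: le_trans (normcD _ _) _.
have p1 := pairing_le (psum22 hD b3).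
have sq : sqrt (q (psi' n)) <= k.
  have npsi : nb2 (psi' n) (1 + A).
    by apply: eq_nb (nbD le12 b2 hA) => x; rewrite subrK.
  have n2b := n2_le npsi.
  rewrite -(@ler_pXn2r _ 2) ?nnegrE ?sqrtr_ge0 ?(ltW k0)// sqr_sqrtr ?q_ge0//.
  have Qb : Qq (psi' n) <= B ^+ 2.
    have := b1; rewrite -(@ler_pXn2r _ 2) ?nnegrE ?sqrtr_ge0// sqr_sqrtr ?Qquad_ge0//.
  rewrite /q /k; nra.
have m1 : n.+1%:R^-1 * sqrt (q (psi' n)) <= e / 2 / k * k.
  by apply: ler_pM => //; rewrite ?sqrtr_ge0// invr_ge0.
have m2 : D * (e / 2 / k) <= k * (e / 2 / k).
  by rewrite ler_wpM2r ?(ltW e2)// /k; lra.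
rewrite divfK ?gt_eqF// in m1; rewrite [leRHS]mulrC divfK ?gt_eqF// in m2.
by rewrite [leRHS]splitr lerD// ?(le_trans Ln)// (le_trans p1).
Qed.

Lemma form_graph_lin f h g k a : form_graph f h -> form_graph g k ->
  form_graph (fun x => f x + a * g x) (fun x => h x + a * k x).
Proof.
move=> [ef eh Hf] [eg ek Hg].
have ea := ellZ le12 a.
split; [exact: (ellD le12 ef (ea _ eg))|exact: (ellD le12 eh (ea _ ek))|].
move=> e e0; have a1 : 0 < normc a + 1 by rewrite ltr_wpDl ?normc_ge0.
have e2 : 0 < e / 2 by rewrite divr_gt0.
have [phi [c1 n1 L1]] := Hf _ e2; have [psi [c2 n2' L2]] := Hg _ (divr_gt0 e2 a1).
have ca : Cc (fun x => a * psi x) by exact: (CcMl (fun=> a)).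
have bnda : normc a * (e / 2 / (normc a + 1)) <= e / 2.
  by rewrite mulrCA ler_piMr ?(ltW e2)// ler_pdivrMr// mul1r lerDl.
exists (fun x => phi x + a * psi x); split; first exact: CcD.
  apply: (@nbW _ _ (e / 2 + normc a * (e / 2 / (normc a + 1)))); first lra.
  apply: eq_nb (nbD le12 n1 (nbZ le12 a n2')) => x; ring.
move=> w hw; rewrite QformDl// QformZl//.
have ew := Cc_ell2 hw.
rewrite (pairingDl (psumm22 eh ew) (psumm22 (ea _ ek) ew)).
rewrite (pairingZl _ (psumm22 ek ew)).
rewrite (_ : _ - _ = (Q phi w - pairing m h w) + a * (Q psi w - pairing m k w)); last by ring.
apply: le_trans (normcD _ _) _; rewrite normcM.
apply: le_trans (lerD (L1 _ hw) (ler_wpM2l (normc_ge0 a) (L2 _ hw))) _.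
by rewrite mulrA -mulrDl ler_wpM2r ?sqrtr_ge0//; lra.
Qed.

(** The pairing is a limit of the numbers [Q phi phi >= 0]. Positivity comes from this directly and
    symmetry by polarization in [op_sym]. *)
Lemma form_graph_quad f h : form_graph f h ->
  exists2 r, 0 <= r & pairing m h f = r%:C.
Proof.
move=> [ef eh Hf].
have [F hF] := (ellP _ _).1 ef; have F0 := nb_ge0 hF.
have [D hD] := (ellP _ _).1 eh; have D0 := nb_ge0 hD.
pose A := D * (F + 1) + (F + 1) ^+ 2.
have A0 : 0 <= A by rewrite addr_ge0 ?sqr_ge0// mulr_ge0// addr_ge0.
pose M := 1 + A + D.
have key e : 0 < e -> e <= 1 -> exists2 r, 0 <= r & normc (pairing m h f - r%:C) <= e * M.
  move=> e0 e1; have [phi [cp np Lp]] := Hf _ e0.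
  exists (Qq phi); first exact: Qquad_ge0.
  have ep := Cc_ell2 cp.
  have np1 : nb2 phi (F + 1).
    apply: nbW (_ : e + F <= _) _; first lra.
    by apply: eq_nb (nbD le12 np hF) => x; rewrite subrK.
  pose t := sqrt (q phi); have t0 : 0 <= t := sqrtr_ge0 _.
  have L := Lp _ cp; rewrite -/t (Qform_self cp) in L.
  have P1 := pairing_le (psum22 hD np1).
  have Qb : Qq phi <= D * (F + 1) + e * t.
    rewrite -(normcR0 (Qquad_ge0 cp)).
    rewrite -[X in normc X](subrK (pairing m h phi)).
    by apply: le_trans (normcD _ _) _; rewrite addrC lerD.
  have et : e * t <= t by rewrite ler_piMl.
  (* A bound on the form norm of [phi] that does not depend on [e]: the previous estimates give
     [t^2 <= A + t]. *)
  have tA : t <= 1 + A.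
    have tE : t ^+ 2 = Qq phi + n2 phi by rewrite /t sqr_sqrtr// q_ge0.
    have := n2_le np1 => n2b; rewrite leNgt; apply/negP => tA.
    have : A + t < t ^+ 2 by nra.
    rewrite tE /A; lra.
  have P2 := pairing_le (psum22 hD np).
  rewrite (_ : _ - _ = - ((Qq phi)%:C - pairing m h phi)
    - pairing m h (fun x => phi x - f x)); last first.
    by rewrite (pairingBr (psumm22 eh ep) (psumm22 eh ef)); ring.
  apply: le_trans (normcB _ _) _; rewrite normcN.
  apply: le_trans (lerD L P2) _; rewrite /M (mulrC D) -mulrDr ler_wpM2l ?(ltW e0)//.
  by rewrite lerD2r.
have M0 : 0 < M by rewrite /M; lra.
have lim (u : R) : (forall e, 0 < e -> e <= 1 -> u <= e * M) -> u <= 0.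
  move=> H; apply: le_all_eps => e e0; rewrite add0r.
  have [le|le] := leP (e / M) 1.
    by have := H _ (divr_gt0 e0 M0) le; rewrite divfK ?gt_eqF.
  have := H 1 ltr01 (lexx _); rewrite mul1r.
  by move: le; rewrite ltr_pdivlMr// mul1r; lra.
exists (Re (pairing m h f)).
  rewrite -oppr_le0; apply: lim => e e0 e1; have [r r0] := key _ e0 e1.
  move=> /(le_trans (normRe _)); rewrite ReD ReN /= ler_norml => /andP[]; lra.
apply/eqP; rewrite eq_complex /= eqxx /= -normr_le0; apply: lim => e e0 e1.
have [r r0] := key _ e0 e1.
by move=> /(le_trans (normIm _)); rewrite ImD ImN /= subr0.
Qed.

(* Minimizing sequences of [Q u + mu |u|^2 - 2 Re <g, u>] on [Cc] converge in
   [l^2]. *)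
Lemma form_graph_riesz mu g : 0 < mu -> ell2 g ->
  exists f, form_graph f (fun x => g x - mu%:C * f x).
Proof.
move=> mu0 eg; have [G hG] := (ellP _ _).1 eg; have G0 := nb_ge0 hG.
pose qm v := Qq v + mu * n2 v.
have qm0 v : Cc v -> 0 <= qm v.
  by move=> cv; rewrite addr_ge0 ?Qquad_ge0// mulr_ge0 ?n2_ge0// ltW.
pose J v := qm v - 2 * Re (pairing m g v).
pose L phi psi := Q phi psi + mu%:C * pairing m phi psi - pairing m g psi.
(* Completing the square in the [l^2] norm of [v]; [mu > 0] is essential. *)
have Jlow v : Cc v -> - (G ^+ 2 / mu) <= J v.
  move=> cv; have P := pairing_le (psum22 hG (nb_n2 cv)).
  have := le_trans (le_Re_normc _) P; rewrite /J /qm.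
  set t := sqrt (n2 v); have t2 : n2 v = t ^+ 2 by rewrite sqr_sqrtr// n2_ge0.
  rewrite t2 => Pg; have := Qquad_ge0 cv; have := sqr_ge0 (mu * t - G) => sq Q0.
  have : 0 <= mu * t ^+ 2 - 2 * (G * t) + G ^+ 2 / mu.
    rewrite (_ : _ + _ = (mu * t - G) ^+ 2 / mu); last by field; rewrite gt_eqF.
    by rewrite divr_ge0// ltW.
  lra.
have Jexp phi psi t : Cc phi -> Cc psi ->
   J (fun x => phi x + t * psi x) = J phi + 2 * Re (conjc t * L phi psi) + normc t ^+ 2 * qm psi.
  move=> c1 c2; have ct : Cc (fun x => t * psi x) by exact: (CcMl (fun=> t)).
  rewrite /J /qm (Qquad_expand _ c1 c2) (n2_expand _ c1 c2).
  have e2 := Cc_ell2 c2.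
  rewrite (pairingDr (psumm22 eg (Cc_ell2 c1)) (psumm22 eg (Cc_ell2 ct))).
  rewrite (pairingZr _ (psumm22 eg e2)).
  have -> : conjc t * L phi psi = conjc t * Q phi psi
     + mu%:C * (conjc t * pairing m phi psi) + - (conjc t * pairing m g psi).
    by rewrite /L; ring.
  by rewrite !ReD ReN ReZ; ring.
pose V := [set J v | v in Cc (R := R) (X := X)].
have infV : has_inf V.
  split; first by exists (J (fun=> 0)), (fun=> 0) => //; exact: Cc0.
  by exists (- (G ^+ 2 / mu)) => _ [v cv <-]; exact: Jlow.
(* [L phi] is half the derivative of [J] at [phi]. If [J phi] is within [e^2] of the infimum,
   [quad_discriminant] bounds [L phi] by [e] in the norm of [qm]. *)
have almost e : 0 < e -> exists phi, Cc phi /\ forall psi, Cc psi ->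
    normc (L phi psi) <= e * sqrt (qm psi).
  move=> e0; have [_ [phi cp <-] Jp] := inf_adherent (exprn_gt0 2 e0) infV.
  exists phi; split=> // psi cs.
  rewrite -(@ler_pXn2r _ 2) ?nnegrE ?normc_ge0 ?mulr_ge0 ?sqrtr_ge0 ?(ltW e0)//.
  rewrite [leRHS]exprMn (sqr_sqrtr (qm0 _ cs)).
  apply: quad_discriminant (qm0 _ cs) _ => t.
  have ct : Cc (fun x => phi x + t * psi x).
    by apply: CcD => //; exact: (CcMl (fun=> t)).
  have : inf V <= J (fun x => phi x + t * psi x).
    by apply: (ge_inf infV.2); exists (fun x => phi x + t * psi x).
  rewrite Jexp//; lra.
have n0 (n : nat) : 0 < (n.+1%:R)^-1 :> R by rewrite invr_gt0.
have inv_small (e : R) : 0 < e -> exists N : nat, forall n, (N <= n)%N -> n.+1%:R^-1 <= e.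
  move=> e0; have := truncnS_gt e^-1; set N := Num.truncn _ => Ne; exists N => n Nn.
  rewrite invf_ple ?posrE//; apply: le_trans (ltW Ne) _; rewrite ler_nat.
  by rewrite ltnS.
have /choice[phi hphi] := fun n => almost _ (n0 n).
have cp n : Cc (phi n) by have [] := hphi n.
(* The term with [g] cancels in [L (phi i) - L (phi j)], and the value of this difference at
   [phi i - phi j] is [qm] of it. *)
have diff i j : nb2 (fun x => phi i x - phi j x) ((i.+1%:R^-1 + j.+1%:R^-1) / sqrt mu).
  have cij := CcB (cp i) (cp j); set psi := (fun x => _) in cij *.
  have sm : 0 < sqrt mu by rewrite sqrtr_gt0.
  pose t := sqrt (qm psi); have t0 : 0 <= t := sqrtr_ge0 _.
  have tb : t <= i.+1%:R^-1 + j.+1%:R^-1.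
    move: t0; rewrite le_eqVlt => /orP[/eqP<-|t0]; first by rewrite addr_ge0 ?(ltW (n0 _)).
    rewrite -(ler_pM2r t0) mulrDl -expr2 sqr_sqrtr ?qm0//.
    have := le_trans (le_trans (le_Re_normc _) (normcB (L (phi i) psi) (L (phi j) psi)))
      (lerD ((hphi i).2 _ cij) ((hphi j).2 _ cij)).
    apply: le_trans; rewrite le_eqVlt; apply/orP; left; apply/eqP.
    have -> : L (phi i) psi - L (phi j) psi = Q psi psi + mu%:C * pairing m psi psi.
      have P k := psumm22 (Cc_ell2 (cp k)) (Cc_ell2 cij).
      rewrite {3 5}/psi QformBl// (pairingBl (P i) (P j)).
      by rewrite /L; ring.
    by rewrite ReD ReZ.
  apply: nbW (nb_n2 cij); rewrite ler_pdivlMr// -sqrtrM ?n2_ge0//.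
  apply: le_trans tb; rewrite ler_sqrt ?qm0// /qm mulrC lerDr; exact: Qquad_ge0.
have [|f hf] := nb_complete le12 (u := phi).
  move=> e e0; have sm : 0 < sqrt mu by rewrite sqrtr_gt0.
  have e2 : 0 < e * sqrt mu / 2 by rewrite divr_gt0// mulr_gt0.
  have [N hN] := inv_small _ e2; exists N => i j /hN Ni /hN Nj.
  apply: nbW (diff i j); rewrite ler_pdivrMr//.
  by apply: le_trans (lerD Ni Nj) _; lra.
have ef : ell2 f.
  have [N hN] := hf 1 ltr01.
  have := ellB le12 (Cc_ell2 (cp N)) (nb_ell (hN _ (leqnn N))).
  by congr (ell m _ _); apply/funext => x; ring.
have eh : ell2 (fun x => g x - mu%:C * f x).
  exact: (ellB le12 eg (ellZ le12 mu%:C ef)).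
exists f; split=> // e e0.
have m1 : 0 < 1 + mu by lra.
have e2 : 0 < e / 2 / (1 + mu) by rewrite !divr_gt0.
have [N hN] := inv_small _ e2; have [M hM] := hf _ e2.
pose n := maxn N M; have a1 := hN _ (leq_maxl N M); have a2 := hM _ (leq_maxr N M).
rewrite -/n in a1 a2.
have e2e : e / 2 / (1 + mu) <= e by rewrite ler_pdivrMr//; nra.
exists (phi n); split=> //; first exact: nbW a2.
move=> psi cs; have es := Cc_ell2 cs; have en := Cc_ell2 (cp n).
have efn := ellB le12 en ef.
have P1 := psumm22 ef es; have P2 := psumm22 en es.
rewrite (pairingBl (psumm22 eg es) (psummZ _ P1)) (pairingZl _ P1).
rewrite (_ : _ - _ = L (phi n) psi - mu%:C * pairing m (fun x => phi n x - f x) psi); last first.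
  by rewrite (pairingBl P2 P1) /L; ring.
apply: le_trans (normcB _ _) _; rewrite normcM (normcR0 (ltW mu0)).
have P := pairing_le (psum22 a2 (nb_sqrt_q cs)).
set t := sqrt (q psi) in P *; have t0 : 0 <= t := sqrtr_ge0 _.
have qmt : sqrt (qm psi) <= (1 + mu) * t.
  rewrite -(@ler_pXn2r _ 2) ?nnegrE ?sqrtr_ge0 ?mulr_ge0 ?(ltW m1)//.
  rewrite exprMn !sqr_sqrtr ?qm0 ?q_ge0// /qm /q.
  have := Qquad_ge0 cs; have := n2_ge0 cs => u1 u2; have := mulr_ge0 (ltW mu0) u1.
  have := mulr_ge0 (ltW mu0) u2; have := mulr_ge0 (ltW mu0) (mulr_ge0 (ltW mu0) u1).
  have := mulr_ge0 (ltW mu0) (mulr_ge0 (ltW mu0) u2); lra.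
have Ln := (hphi n).2 _ cs.
have b1 : n.+1%:R^-1 * sqrt (qm psi) <= e / 2 / (1 + mu) * ((1 + mu) * t).
  by apply: ler_pM => //; rewrite ?sqrtr_ge0// ltW.
have b2 : mu * normc (pairing m (fun x => phi n x - f x) psi) <= (1 + mu) * (e / 2 / (1 + mu) * t).
  by apply: ler_pM => //; rewrite ?normc_ge0 ?(ltW mu0)//; lra.
rewrite mulrA divfK ?gt_eqF// in b1.
have E : (1 + mu) * (e / 2 / (1 + mu) * t) = e / 2 * t by field; rewrite gt_eqF.
rewrite E in b2; rewrite [e in leRHS]splitr mulrDl lerD//; exact: le_trans Ln b1.
Qed.

Lemma sumle_support (u : X -> R) (A : {fset X}) : (forall x, 0 <= u x) ->
  (forall x, x \notin A -> u x = 0) -> sumle u (\sum_(x <- A) u x).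
Proof.
move=> u0 h B; rewrite (big_fset_incl _ (fsubsetUl A B)) => [|x _ /h]//.
by apply: sub_sum_fset => //; exact: fsubsetUr.
Qed.

(** * Exponential decay of the resolvent *)

Definition cminus x := - Num.min (c x) 0.

Lemma cminus_ge0 x : 0 <= cminus x.
Proof. by rewrite oppr_ge0 ge_min lexx orbT. Qed.

Lemma form_bounded_sum : form_bounded m b o c -> exists2 M, 0 <= M &
  forall f, Cc f -> sumle (fun x => cminus x * normc (f x) ^+ 2) (M * q f).
Proof.
move=> [M [C [M0 C0 H]]]; exists (M + C); first exact: addr_ge0.
move=> f cf; pose g x := (sqrt (cminus x / m x))%:C * f x.
have cg : Cc g by exact: (CcMl (fun x => (sqrt (cminus x / m x))%:C)).
have [t ht] : exists t, lpnorm m 2%:E g = t%:E.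
  by eexists; exact: (nb_norm (nb_n2 cg)).
have [n hn] : exists n, lpnorm m 2%:E f = n%:E.
  by eexists; exact: (nb_norm (nb_n2 cf)).
have := H _ cf; rewrite -/g ht hn !expe2 -!EFinM -EFinD lee_fin => tle.
have gt : nb2 g t by rewrite /nb ht.
have t0 := nb_ge0 gt.
have n0 : 0 <= n by rewrite -lee_fin -hn lpnorm_ge0.
have nle : n * n <= n2 f.
  rewrite -expr2 -(sqr_sqrtr (n2_ge0 cf)) ler_pXn2r ?nnegrE ?sqrtr_ge0//.
  by rewrite -lee_fin -hn; exact: nb_n2.
have /(nb2E _ t0) := gt; apply: le_sumle.
  move=> x; rewrite /g normcM normcR0 ?sqrtr_ge0// exprMn.
  rewrite sqr_sqrtr ?divr_ge0 ?cminus_ge0 ?(ltW (m_gt0 x))//.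
  by rewrite [leRHS](_ : _ = cminus x * normc (f x) ^+ 2)//; field; rewrite gt_eqF.
rewrite expr2; apply: le_trans tle _; rewrite /q.
have := Qquad_ge0 cf; have := n2_ge0 cf => u1 u2.
have := ler_wpM2l C0 nle; have := mulr_ge0 M0 u1; have := mulr_ge0 C0 u2; lra.
Qed.

(** In [Q] the kinetic energy and the negative potential may cancel. Form boundedness controls the
    negative part [N] by [M q], and then half the kinetic energy plus the positive part is
    [Q + N <= (1 + M) q]. *)
Lemma energy_bound : form_bounded m b o c -> exists2 K, 0 < K & forall f, Cc f ->
  sumle (fun z : X * X => b z.1 z.2 * normc (nab f z) ^+ 2) (K * q f) /\
  sumle (fun x => `|c x| * normc (f x) ^+ 2) (K * q f).
Proof.
move=> /form_bounded_sum[M M0 H]; exists (2 * (1 + M)); first by rewrite mulr_gt0//; lra.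
move=> f cf; have [A hA] := (CcP _).1 cf.
pose P := \sum_(x <- A) Num.max (c x) 0 * normc (f x) ^+ 2.
pose N := \sum_(x <- A) cminus x * normc (f x) ^+ 2.
have NM : N <= M * q f by exact: H.
have P0 : 0 <= P.
  by apply: sumr_ge0 => x _; rewrite mulr_ge0 ?sqr_ge0// le_max lexx orbT.
have N0 : 0 <= N by apply: sumr_ge0 => x _; rewrite mulr_ge0 ?sqr_ge0// cminus_ge0.
have [B hB] := nabla_sum cf.
have k0 (z : X * X) : 0 <= b z.1 z.2 * normc (nab f z) ^+ 2 by rewrite mulr_ge0 ?sqr_ge0.
have hk := sumle_csum k0 hB.
have := Qquad_kinetic cf.
set kin := Re _ in hk *.
have -> : csum (fun x => (c x * normc (f x) ^+ 2)%:C) = (P - N)%:C.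
  rewrite (@csum_finite _ _ _ A); last by move=> x /hA ->; rewrite normc_zero expr0n mulr0.
  rewrite -rmorph_sum -sumrB; congr (_%:C); apply: eq_bigr => x _.
  by rewrite /cminus; case: (leP (c x) 0) => h; rewrite ?(max_r h) ?(max_l (ltW h)) /=; ring.
move=> /= QE; have q0 := q_ge0 cf; have kin0 : 0 <= kin := sumle_ge0 hk.
have Qqle : Qq f <= q f by rewrite lerDl n2_ge0.
split.
  by apply: le_sumle hk => //; lra.
have s0 x : 0 <= `|c x| * normc (f x) ^+ 2 by rewrite mulr_ge0 ?sqr_ge0.
apply: le_sumle (sumle_support (A := A) s0 _) => //; last first.
  by move=> x /hA ->; rewrite normc_zero expr0n mulr0.
rewrite (_ : \sum_(x <- A) _ = P + N); first by lra.
rewrite -big_split; apply: eq_bigr => x _ /=.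
by rewrite /cminus; case: (leP (c x) 0) => h;
  rewrite ?(max_r h) ?(max_l (ltW h)) ?(ler0_norm h) ?(gtr0_norm h); ring.
Qed.

Local Notation res z K := (resolves 2%:E form_graph z K).

Let sqrt_q_sq f : Cc f -> sqrt (q f) ^+ 2 = q f.
Proof. by move=> cf; rewrite sqr_sqrtr// q_ge0. Qed.

(* For nonreal [z] the choice [phi = v] works. For real [z] take [phi = v + eta]
   where [(H - z) eta = (z + 1) v], so that [Q(v, phi) - z <v, phi> = q v], with
   [eta] approximated in [Cc]. *)
Lemma inf_sup z K : res z K -> exists2 C, 0 < C & forall v, Cc v ->
  exists phi, [/\ Cc phi, sqrt (q phi) <= C * sqrt (q v) &
    q v <= C * normc (Q v phi - z * pairing m v phi)].
Proof.
move=> [K0 sur low]; have nz0 := normc_ge0 z.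
have [zI|zI] := eqVneq (Im z) 0; last first.
  have I0 : 0 < `|Im z| by rewrite normr_gt0.
  have M0 : 0 <= (normc z + 1) / `|Im z| by rewrite divr_ge0 ?addr_ge0.
  exists (1 + (normc z + 1) / `|Im z|); first by rewrite ltr_wpDr.
  move=> v cv; exists v; split=> //; first by rewrite ler_peMl ?sqrtr_ge0// lerDl.
  rewrite (Qform_self cv); set W := (_ - _).
  have vv : pairing m v v = (n2 v)%:C.
    apply/eqP; rewrite eq_complex (Im_pairing_self (Cc_ell2 cv)).
    by rewrite /= !eqxx.
  have n0 := n2_ge0 cv.
  (* As [Q v v] is real, the imaginary part controls [n2 v], and then the real part controls
     [Qq v]. *)
  have WI : `|Im W| = `|Im z| * n2 v.
    rewrite /W vv ImD ImN (mulrC z) ImZ /= sub0r normrN normrM (ger0_norm n0).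
    by rewrite mulrC.
  have WR : Qq v = Re W + Re z * n2 v.
    by rewrite /W vv ReD ReN (mulrC z) ReZ /=; ring.
  have b1 : n2 v <= normc W / `|Im z|.
    by rewrite ler_pdivlMr// mulrC -WI normIm.
  have b2 : Qq v <= normc W + normc z * n2 v.
    by rewrite WR lerD ?le_Re_normc// ler_wpM2r ?le_Re_normc.
  have z1 : 0 <= normc z + 1 by rewrite addr_ge0.
  have := ler_wpM2l z1 b1; rewrite [q v]/(Qq v + n2 v).
  have -> : (1 + (normc z + 1) / `|Im z|) * normc W =
    normc W + (normc z + 1) * (normc W / `|Im z|) by ring.
  move=> h; apply: le_trans (lerD b2 (lexx _)) _; lra.
have zc : conjc z = z by move: zI; case: (z) => u w /= ->; rewrite oppr0.
pose c1 := normc (z + 1).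
have c10 : 0 <= c1 := normc_ge0 _.
pose a := K * c1 + 1; pose a' := c1 + normc z * (K * c1).
have Kc0 : 0 <= K * c1 by rewrite mulr_ge0.
have a0 : 0 <= a by rewrite /a addr_ge0.
have a'0 : 0 <= a' by rewrite /a' addr_ge0// mulr_ge0.
exists (2 + a' * a + a ^+ 2).
  by have := mulr_ge0 a'0 a0; have := sqr_ge0 a; lra.
move=> v cv; set t := sqrt (q v).
have t0 : 0 <= t := sqrtr_ge0 _; have tt : t ^+ 2 = q v by rewrite sqrt_q_sq.
have CC : 2 <= 2 + a' * a + a ^+ 2.
  by have := mulr_ge0 a'0 a0; have := sqr_ge0 a; lra.
move: (t0); rewrite le_eqVlt => /orP[/eqP t00|tp].
  exists v; split=> //; first by rewrite -/t -t00 mulr0.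
  rewrite -tt -t00 expr0n /= mulr_ge0 ?normc_ge0//; lra.
have nv : nb2 v t := nb_sqrt_q cv.
have ev := Cc_ell2 cv; have ezv := ellZ le12 (z + 1) ev.
have [eta Heta] := sur _ ezv.
have neta : nb2 eta (K * (c1 * t)).
  apply: (low _ _ _ Heta); apply: eq_nb (nbZ le12 (z + 1) nv) => x; ring.
have [eeta eh Happ] := Heta.
have z10 : 0 < 1 + normc z by rewrite ltr_pwDl.
(* Chosen so that replacing [eta] by [et] costs at most [eps (1 + |z|) t = t^2 / 2], half of
   [q v]. *)
pose eps := t / (2 * (1 + normc z)).
have eps0 : 0 < eps by rewrite divr_gt0// mulr_gt0.
have epst : eps <= t by rewrite ler_pdivrMr ?mulr_gt0// ler_peMr//; lra.
have [et [cet net Let]] := Happ _ eps0.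
have eet := Cc_ell2 cet.
have nh : nb2 (fun x => (z + 1) * v x + z * eta x) (a' * t).
  rewrite (_ : a' * t = c1 * t + normc z * (K * (c1 * t))); last by rewrite /a'; ring.
  exact: (nbD le12 (nbZ le12 (z + 1) nv) (nbZ le12 z neta)).
have net' : nb2 et (a * t).
  apply: nbW (_ : eps + K * (c1 * t) <= _) _; first by rewrite /a; lra.
  by apply: eq_nb (nbD le12 net neta) => x; rewrite subrK.
set tau := sqrt (q et); have tau0 : 0 <= tau := sqrtr_ge0 _.
have tauE : tau ^+ 2 = Qq et + n2 et by rewrite sqrt_q_sq.
(* The approximate equation for [et] is tested with [et]: [tau^2 <= eps tau + (a' a + a^2) t^2],
   where [eps <= t]. *)
have tau_le : tau <= (1 + a' * a + a ^+ 2) * t.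
  have P := pairing_le (psum22 nh net').
  have L := Let _ cet; rewrite -/tau (Qform_self cet) in L.
  have Qb : Qq et <= eps * tau + a' * t * (a * t).
    rewrite -(normcR0 (Qquad_ge0 cet)) -[X in normc X](subrK (pairing m (fun x => (z + 1) * v x + z * eta x) et)).
    by apply: le_trans (normcD _ _) _; rewrite lerD.
  have n2b := n2_le net'.
  rewrite leNgt; apply/negP => lt.
  have M0 : 0 <= a' * a + a ^+ 2 by rewrite addr_ge0 ?sqr_ge0 ?mulr_ge0.
  have tlt : t <= tau.
    apply: le_trans (ltW lt); rewrite ler_peMl//; lra.
  have h1 : (1 + a' * a + a ^+ 2) * t * tau < tau ^+ 2.
    by rewrite expr2 ltr_pM2r//; apply: lt_le_trans tlt.
  have h2 : eps * tau <= t * tau by rewrite ler_wpM2r.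
  have h3 := ler_wpM2l M0 (ler_wpM2l t0 tlt).
  rewrite exprMn in n2b; lra.
have cphi := CcD cv cet.
exists (fun x => v x + et x); split=> //.
  by apply: le_trans (sqrt_qD cv cet) _; rewrite -/t -/tau; lra.
have E : Q v (fun x => v x + et x) - z * pairing m v (fun x => v x + et x) =
   (q v)%:C + conjc (Q et v - pairing m (fun x => (z + 1) * v x + z * eta x) v
      - z * pairing m (fun x => et x - eta x) v).
  rewrite QformDr// (pairingDr (psumm22 ev ev) (psumm22 ev eet)).
  rewrite (pairingBl (psumm22 eet ev) (psumm22 eeta ev)).
  have ezeta := ellZ le12 z eeta.
  rewrite (pairingDl (psumm22 ezv ev) (psumm22 ezeta ev)).
  rewrite (pairingZl _ (psumm22 ev ev)) (pairingZl _ (psumm22 eeta ev)).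
  have vv : pairing m v v = (n2 v)%:C.
    apply/eqP; rewrite eq_complex (Im_pairing_self ev).
    by rewrite /= !eqxx.
  rewrite (Qform_self cv) (Qform_conj cet cv) (pairing_conj (psumm22 eet ev)) vv.
  have -> : (q v)%:C = (Qq v)%:C + (n2 v)%:C by rewrite -rmorphD.
  have zc1 : conjc (z + 1) = z + 1.
    by rewrite conjcD zc; congr (_ + _); exact: rmorph1.
  move: (Q et v) (pairing m et v) (pairing m eta v) => w1 w2 w3.
  rewrite !(zc1, zc, conjcN, conjcD, conjcM, conjcR).
  by ring.
rewrite E; set err := conjc _.
have nerr : normc err <= t ^+ 2 / 2.
  rewrite normc_conj; apply: le_trans (normcB _ _) _.
  have P := pairing_le (psum22 net nv).
  have L := Let _ cv; rewrite -/t in L.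
  rewrite normcM; apply: le_trans (lerD L (ler_wpM2l nz0 P)) _.
  rewrite (_ : _ + _ = eps * (1 + normc z) * t); last by ring.
  rewrite /eps (_ : t / _ * _ = t / 2); last by field; rewrite gt_eqF.
  by rewrite expr2 mulrAC.
have : q v - t ^+ 2 / 2 <= normc ((q v)%:C + err).
  have := normcB ((q v)%:C + err) err; rewrite addrK normcR0 ?q_ge0//; lra.
have q0 := q_ge0 cv; rewrite tt => low'.
have nn := normc_ge0 ((q v)%:C + err).
have := ler_wpM2r nn CC; lra.
Qed.

Variable d : X -> X -> R.
Hypothesis d_intr : intrinsic_metric m b d.

(** This is how the intrinsic metric acts: errors of size [d(x, y) |f y|] along edges are bounded in
    energy by the [l^2] norm. *)
Lemma intrinsic_sum f : Cc f ->
  sumle (fun z : X * X => b z.1 z.2 * d z.1 z.2 ^+ 2 * normc (f z.2) ^+ 2) (n2 f).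
Proof.
move=> cf; have [[_ _ d_sym _] d_int] := d_intr.
have t0 x y : 0 <= b x y * d x y ^+ 2 by rewrite mulr_ge0 ?sqr_ge0.
have h1 x : sumle (fun y => b x y * d x y ^+ 2) (m x).
  apply/sumleP; have := d_int x; set E := esum _ _.
  rewrite -(@lee_pmul2l _ (m x)%:E)//; last by rewrite lte_fin m_gt0.
  by rewrite muleA -EFinM mulfV ?gt_eqF// mul1e mule1.
have h2 : sumle (fun z : X * X => b z.1 z.2 * d z.1 z.2 ^+ 2 * normc (f z.1) ^+ 2) (n2 f).
  apply: (sumle_pair (k := fun x y => b x y * d x y ^+ 2 * normc (f x) ^+ 2) _ _ (n2_sum cf)).
    by move=> x y; rewrite mulr_ge0 ?sqr_ge0.
  move=> x; have := sumleZ (sqr_ge0 (normc (f x))) (h1 x); rewrite mulrC.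
  by apply: le_sumle => // y; rewrite mulrC.
by apply: le_sumle (sumle_swap h2) => // z /=; rewrite b_sym d_sym.
Qed.

Let lim_eps (u w M : R) : 0 <= M -> (forall e, 0 < e -> u <= w + e * M) -> u <= w.
Proof.
move=> M0 h; apply: le_all_eps => e e0.
have M1 : 0 < M + 1 by lra.
apply: le_trans (h _ (divr_gt0 e0 M1)) _; rewrite lerD2l mulrAC -mulrA ler_piMr ?(ltW e0)//.
by rewrite ler_pdivrMr// mul1r lerDl.
Qed.

(** * Conjugating the form with a bounded weight *)

Section Weight.
Variables (K : R).
Hypothesis K_gt0 : 0 < K.
Hypothesis K_kin : forall f, Cc f ->
  sumle (fun z : X * X => b z.1 z.2 * normc (nab f z) ^+ 2) (K * q f).
Hypothesis K_pot : forall f, Cc f ->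
  sumle (fun x => `|c x| * normc (f x) ^+ 2) (K * q f).
Variables (rho : X -> R) (theta L : R).
Hypothesis rho_gt0 : forall x, 0 < rho x.
Hypothesis rho_le : forall x, rho x <= L.
Hypothesis theta_ge0 : 0 <= theta.
Hypothesis rho_lip : forall x y, 0 < b x y -> `|1 - rho x / rho y| <= theta * d x y.

Let d_sym x y : d x y = d y x. Proof. by case: d_intr => -[]. Qed.
Let d_ge0 x y : 0 <= d x y. Proof. by case: d_intr => -[]. Qed.
Let normo x y : normc (o x y) = 1. Proof. by case: o_mag. Qed.

Definition wmul f : X -> R[i] := fun x => (rho x)%:C * f x.
Definition wdiv f : X -> R[i] := fun x => ((rho x)^-1)%:C * f x.

Let beta x y : R[i] := (1 - rho x / rho y)%:C.

(** A discrete product rule with the weight always taken at [x]. In the product with the conjugate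
    of [nabla_wmul] the factors [rho x] cancel, and only relative increments [beta] remain. *)
Let nabla_wdiv f x y : nab (wdiv f) (x, y) =
  ((rho x)^-1)%:C * (nab f (x, y) + o x y * beta x y * f y).
Proof.
rewrite /nabla /wdiv /beta /= rmorphB rmorphM rmorph1.
have r1 : (rho x)%:C != 0 by rewrite fmorph_eq0 gt_eqF.
have r2 : (rho y)%:C != 0 by rewrite fmorph_eq0 gt_eqF.
by rewrite !fmorphV; field; rewrite r1 r2.
Qed.

Let nabla_wmul f x y : nab (wmul f) (x, y) =
  (rho x)%:C * (nab f (x, y) + o x y * beta y x * f y).
Proof.
rewrite /nabla /wmul /beta /= rmorphB rmorphM rmorph1.
have r1 : (rho x)%:C != 0 by rewrite fmorph_eq0 gt_eqF.
by rewrite !fmorphV; field; rewrite r1.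
Qed.

Let beta_le x y : 0 < b x y -> normc (beta x y) <= theta * d x y.
Proof. by move=> /rho_lip; rewrite /beta normcR. Qed.

Let beta_le' x y : 0 < b x y -> normc (beta y x) <= theta * d x y.
Proof. by rewrite b_sym d_sym; exact: beta_le. Qed.

(** A qualitative bound: [L] may be huge, but in [weighted_resolvent_bound] it only multiplies an
    approximation error that tends to [0]. *)
Lemma q_wmul f : Cc f -> q (wmul f) <= L ^+ 2 * (2 * K + theta ^+ 2 + 1) * q f.
Proof.
move=> cf; have cw : Cc (wmul f) by exact: (CcMl (fun x => (rho x)%:C)).
have L0 : 0 <= L by apply: le_trans (rho_le x0); exact: ltW.
have rL x : rho x ^+ 2 <= L ^+ 2 by rewrite ler_pXn2r ?nnegrE// ltW.
have LL : 0 <= L ^+ 2 := sqr_ge0 L.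
have n2w : n2 (wmul f) <= L ^+ 2 * n2 f.
  apply: le_trans (le_Re_normc _) _; apply: csum_le.
  apply: le_sumle (sumleZ LL (n2_sum cf)) => // x.
  rewrite -mulrA mulcJ -rmorphM normcR0; last by rewrite mulr_ge0 ?sqr_ge0// ltW.
  rewrite /wmul normcM normcR0 ?(ltW (rho_gt0 x))// exprMn mulrCA.
  by rewrite ler_wpM2r// mulr_ge0 ?sqr_ge0// ltW.
have t2 : 0 <= theta ^+ 2 := sqr_ge0 _.
have kw : sumle (fun z : X * X => b z.1 z.2 * normc (nab (wmul f) z) ^+ 2)
    (L ^+ 2 * (2 * (K * q f + theta ^+ 2 * n2 f))).
  have two : 0 <= 2 :> R by [].
  have := sumleZ LL (sumleZ two (sumleD (K_kin cf) (sumleZ t2 (intrinsic_sum cf)))).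
  apply: (le_sumle _ (lexx _)) => -[x y] /=.
  have := b_ge0 x y; rewrite le_eqVlt => /orP[/eqP<-|bxy]; first by rewrite !(mul0r, mulr0, addr0).
  rewrite nabla_wmul normcM normcR0 ?(ltW (rho_gt0 x))// exprMn.
  set N := normc (nab f (x, y)); set F := normc (f y).
  have h : normc (nab f (x, y) + o x y * beta y x * f y) <= N + theta * d x y * F.
    apply: le_trans (normcD _ _) _; rewrite lerD2l !normcM normo mul1r.
    by rewrite ler_wpM2r ?normc_ge0// beta_le'.
  have N0 : 0 <= N := normc_ge0 _; have F0 : 0 <= F := normc_ge0 _.
  have tdF : 0 <= theta * d x y * F by rewrite !mulr_ge0.
  have h2 : normc (nab f (x, y) + o x y * beta y x * f y) ^+ 2 <=
      2 * (N ^+ 2 + theta ^+ 2 * (d x y ^+ 2 * F ^+ 2)).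
    apply: le_trans (_ : (N + theta * d x y * F) ^+ 2 <= _).
      by rewrite ler_pXn2r ?nnegrE ?normc_ge0 ?addr_ge0.
    by have := sqr_ge0 (N - theta * d x y * F); rewrite sqrrB sqrrD !exprMn; lra.
  have h3 := ler_pM (sqr_ge0 _) (sqr_ge0 _) (rL x) h2.
  by have := ler_wpM2l (ltW bxy) h3; lra.
have pw : sumle (fun x => `|c x| * normc (wmul f x) ^+ 2) (L ^+ 2 * (K * q f)).
  apply: le_sumle (sumleZ LL (K_pot cf)) => // x.
  rewrite /wmul normcM normcR0 ?(ltW (rho_gt0 x))// exprMn mulrCA.
  by rewrite ler_wpM2r// mulr_ge0 ?sqr_ge0.
have Qw : Qq (wmul f) <= 2^-1 * (L ^+ 2 * (2 * (K * q f + theta ^+ 2 * n2 f)))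
    + L ^+ 2 * (K * q f).
  rewrite (Qquad_kinetic cw) lerD ?ler_wpM2l ?invr_ge0//.
    apply: le_trans (le_Re_normc _) _; apply: csum_le; apply: le_sumle kw => // z.
    by rewrite normcR0// mulr_ge0 ?sqr_ge0.
  apply: le_trans (le_Re_normc _) _; apply: csum_le; apply: le_sumle pw => // x.
  by rewrite normcR normrM (ger0_norm (sqr_ge0 _)).
have nq := n2_le_q cf; have q0 := q_ge0 cf.
have := ler_wpM2l LL nq; have := ler_wpM2l (mulr_ge0 LL t2) nq.
have -> : q (wmul f) = Qq (wmul f) + n2 (wmul f) by [].
lra.
Qed.

(** The potential terms agree. In the kinetic part three products with at least one increment
    remain; each increment contributes [theta d(x, y)], so [intrinsic_sum] and [K_kin] apply after
    separating products into squares. *)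
Lemma Q_conjugated f g : Cc f -> Cc g ->
  normc (Q (wdiv f) (wmul g) - Q f g) <=
    (theta * K + theta + theta ^+ 2) * (q f + q g).
Proof.
move=> cf cg; have cw : Cc (wmul g) by exact: (CcMl (fun x => (rho x)%:C)).
have cd : Cc (wdiv f) by exact: (CcMl (fun x => ((rho x)^-1)%:C)).
have potE : csum (fun x => (c x)%:C * wdiv f x * conjc (wmul g x)) =
            csum (fun x => (c x)%:C * f x * conjc (g x)).
  apply: eq_csum => x; rewrite /wdiv /wmul conjcM conjcR fmorphV.
  by field; rewrite fmorph_eq0 gt_eqF.
rewrite /Qform potE.
have -> : forall u v w : R[i], 2^-1 * u + w - (2^-1 * v + w) = 2^-1 * (u + -1 * v).
  by move=> u v w; ring.
rewrite -(csumZ (-1) (kinetic_summ cf cg)) -csumD; last 2 first.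
- exact: kinetic_summ.
- by apply: summZ; exact: kinetic_summ.
rewrite normcM.
have t2 : 0 <= theta / 2 by rewrite divr_ge0.
have t22 : 0 <= theta ^+ 2 / 2 by rewrite divr_ge0 ?sqr_ge0.
have kf := K_kin cf; have kg := K_kin cg.
have If := intrinsic_sum cf; have Ig := intrinsic_sum cg.
have hB := sumleD (sumleD (sumleZ t2 (sumleD kf Ig)) (sumleZ t2 (sumleD If kg)))
  (sumleZ t22 (sumleD If Ig)).
apply: (@le_trans _ _ (1 * (theta / 2 * (K * q f + n2 g) +
        theta / 2 * (n2 f + K * q g) + theta ^+ 2 / 2 * (n2 f + n2 g)))); last first.
  have a1 := n2_le_q cf; have a2 := n2_le_q cg.
  have b1 := ler_wpM2l theta_ge0 a1; have b2 := ler_wpM2l theta_ge0 a2.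
  have c1 := ler_wpM2l (sqr_ge0 theta) a1; have c2 := ler_wpM2l (sqr_ge0 theta) a2.
  have q1 := q_ge0 cf; have q2 := q_ge0 cg.
  have e1 := mulr_ge0 theta_ge0 q1; have e2 := mulr_ge0 theta_ge0 q2.
  have e3 := mulr_ge0 (ltW K_gt0) e1; have e4 := mulr_ge0 (ltW K_gt0) e2.
  have e5 := mulr_ge0 (sqr_ge0 theta) q1; have e6 := mulr_ge0 (sqr_ge0 theta) q2.
  lra.
apply: ler_pM; rewrite ?normc_ge0//.
  rewrite (_ : 2^-1 = (2^-1 : R)%:C); last by rewrite fmorphV rmorph_nat.
  by rewrite normcR0; lra.
apply: csum_le; apply: le_sumle hB => // -[x y] /=.
have := b_ge0 x y; rewrite le_eqVlt => /orP[/eqP<-|bxy].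
  by rewrite !(mul0r, mulr0, addr0) normc_zero.
rewrite nabla_wdiv nabla_wmul.
set N := nab f (x, y); set M := nab g (x, y); set u := o x y * beta x y * f y.
set v := o x y * beta y x * g y.
have -> : (b x y)%:C * (((rho x)^-1)%:C * (N + u)) * conjc ((rho x)%:C * (M + v))
   + -1 * ((b x y)%:C * N * conjc M) =
   (b x y)%:C * (N * conjc v + u * conjc M + u * conjc v).
  rewrite conjcM conjcR conjcD fmorphV; field.
  by rewrite fmorph_eq0 gt_eqF.
rewrite normcM normcR0//.
set t := theta * d x y.
have t0 : 0 <= t by rewrite mulr_ge0.
have nu : normc u <= t * normc (f y).
  by rewrite !normcM normo mul1r ler_wpM2r ?normc_ge0// beta_le.
have nv : normc v <= t * normc (g y).
  by rewrite !normcM normo mul1r ler_wpM2r ?normc_ge0// beta_le'.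
have n0 := @normc_ge0 R.
have h : normc (N * conjc v + u * conjc M + u * conjc v) <=
   normc N * (t * normc (g y)) + t * normc (f y) * normc M + t * normc (f y) * (t * normc (g y)).
  apply: le_trans (normcD _ _) _; apply: lerD; last first.
    by rewrite normcM normc_conj ler_pM.
  apply: le_trans (normcD _ _) _; rewrite (normcM N) (normcM u (conjc M)) !normc_conj.
  by apply: lerD; [apply: ler_wpM2l nv|apply: ler_wpM2r nu].
apply: le_trans (ler_wpM2l (ltW bxy) h) _.
move: (normc N) (normc M) (normc (f y)) (normc (g y)) => n k F G; rewrite /t.
have s1 := mulr_ge0 t2 (sqr_ge0 (n - d x y * G)).
have s2 := mulr_ge0 t2 (sqr_ge0 (d x y * F - k)).
have s3 := mulr_ge0 t22 (mulr_ge0 (sqr_ge0 (d x y)) (sqr_ge0 (F - G))).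
have s : 0 <= theta / 2 * (n ^+ 2 + d x y ^+ 2 * G ^+ 2)
  + theta / 2 * (d x y ^+ 2 * F ^+ 2 + k ^+ 2)
  + theta ^+ 2 / 2 * (d x y ^+ 2 * F ^+ 2 + d x y ^+ 2 * G ^+ 2)
  - (n * (theta * d x y * G) + theta * d x y * F * k
     + theta * d x y * F * (theta * d x y * G)) by lra.
by have := mulr_ge0 (ltW bxy) s; lra.
Qed.

Variables (C : R) (z : R[i]).
Hypothesis C_gt0 : 0 < C.
Hypothesis C_inf_sup : forall v, Cc v ->
  exists phi, [/\ Cc phi, sqrt (q phi) <= C * sqrt (q v) &
    q v <= C * normc (Q v phi - z * pairing m v phi)].
Hypothesis theta_small :
  C * ((theta * K + theta + theta ^+ 2) * (1 + C ^+ 2)) <= 2^-1.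

(** With [v = rho u] and [phi] from the inf-sup condition, the equation for [u] is tested with
    [rho phi]. As [rho y = 1], the source term is at most [sqrt (m y) C t] with [t^2 = q v]. The
    conjugation error is at most half of [q v] by [theta_small] and is absorbed. As [u] need not be
    finitely supported, this is done for approximants [ue]. *)
Lemma weighted_resolvent_bound y u : rho y = 1 ->
  form_graph u (fun x => delta y x + z * u x) ->
  forall x, sqrt (m x) * (rho x * normc (u x)) <= 2 * C ^+ 2 * sqrt (m y).
Proof.
move=> rhoy [eu eh Happ] x.
have [D hD] : exists D, forall f, Cc f -> sqrt (q (wmul f)) <= D * sqrt (q f).
  have Qw := q_wmul.
  set M := L ^+ 2 * (2 * K + theta ^+ 2 + 1) in Qw.
  exists (sqrt M) => f cf; have M0 : 0 <= M.
    rewrite /M mulr_ge0 ?sqr_ge0//; have := sqr_ge0 theta; have := K_gt0; lra.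
  rewrite -(sqrtrM _ M0) ler_sqrt; first exact: (Qw f cf).
  by rewrite mulr_ge0 ?q_ge0.
have D0 : 0 <= D.
  have cd := Cc_delta y; have := le_trans (sqrtr_ge0 _) (hD _ cd).
  rewrite pmulr_lge0// sqrtr_gt0 lt_def q_ge0// andbT.
  apply/eqP => /(q_eq0 cd)/(_ y); rewrite /delta eqxx => /eqP.
  by rewrite oner_eq0.
have nz0 := normc_ge0 z; have sx0 := sqrtr_ge0 (m x).
have sy0 := sqrtr_ge0 (m y).
have [cx cx0 hcx] := nb_pt le12 x.
have C2 : 0 <= 2 * C ^+ 2 by rewrite mulr_ge0 ?sqr_ge0.
pose M := 2 * C ^+ 2 * ((1 + normc z) * D) + sqrt (m x) * rho x * cx.
apply: (@lim_eps _ _ M) => [|e e0].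
  have r0 := ltW (rho_gt0 x); have nz1 : 0 <= 1 + normc z by rewrite addr_ge0.
  by rewrite /M addr_ge0// mulr_ge0// ?mulr_ge0// ltW.
have [ue [cue nue Lue]] := Happ _ e0.
have eue := Cc_ell2 cue.
pose v := wmul ue.
have cv : Cc v by exact: (CcMl (fun x => (rho x)%:C)).
have [phi [cphi qphi infv]] := C_inf_sup cv.
set t := sqrt (q v) in qphi; have t0 : 0 <= t := sqrtr_ge0 _.
have tt : t ^+ 2 = q v by rewrite sqrt_q_sq.
pose psi := wmul phi.
have cpsi : Cc psi by exact: (CcMl (fun x => (rho x)%:C)).
have rC w : (rho w)%:C != 0 by rewrite fmorph_eq0 gt_eqF.
have vue : wdiv v = ue.
  by apply/funext => w; rewrite /wdiv /v /wmul fmorphV; exact: (mulKf (rC w)).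
have conjQ := Q_conjugated cv cphi.
rewrite vue -/psi in conjQ.
have epsi := Cc_ell2 cpsi; have edel := Cc_ell2 (Cc_delta y).
have ezu := ellZ le12 z eu.
have pv : pairing m ue psi = pairing m v phi.
  by apply: eq_csum => w; rewrite /psi /v /wmul conjcM conjcR; ring.
have pd : normc (pairing m (delta y) psi) <= sqrt (m y) * (C * t).
  rewrite pairing_delta_l /psi /wmul rhoy rmorph1 mul1r normcM normc_conj.
  rewrite normcR0 ?(ltW (m_gt0 y))//.
  have h : sqrt (m y) * normc (phi y) <= C * t.
    apply: le_trans qphi; rewrite -(@ler_pXn2r _ 2) ?nnegrE ?mulr_ge0 ?sqrtr_ge0 ?normc_ge0//.
    rewrite exprMn !sqr_sqrtr ?q_ge0 ?(ltW (m_gt0 y))//.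
    apply: le_trans (n2_le_q cphi); exact: (sumle_pt y (n2_sum cphi)).
  rewrite -[X in X * _ <= _](sqr_sqrtr (ltW (m_gt0 y))) expr2 -mulrA.
  exact: ler_wpM2l h.
have nd : normc (pairing m (fun x => ue x - u x) psi) <= e * sqrt (q psi).
  exact: (pairing_le (psum22 nue (nb_sqrt_q cpsi))).
have Lp := Lue _ cpsi.
have E : Q v phi - z * pairing m v phi = pairing m (delta y) psi
   + (Q ue psi - pairing m (fun x => delta y x + z * u x) psi)
   - z * pairing m (fun x => ue x - u x) psi
   - (Q ue psi - Q v phi).
  rewrite (pairingDl (psumm22 edel epsi) (psumm22 ezu epsi)).
  rewrite (pairingZl _ (psumm22 eu epsi)).
  by rewrite (pairingBl (psumm22 eue epsi) (psumm22 eu epsi)) -pv; ring.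
have small := theta_small; set kap := theta * K + theta + theta ^+ 2 in conjQ small.
have kap0 : 0 <= kap.
  by rewrite /kap !addr_ge0 ?sqr_ge0// mulr_ge0// ltW.
have total : normc (Q v phi - z * pairing m v phi) <=
    sqrt (m y) * (C * t) + e * (1 + normc z) * (D * (C * t)) + kap * (1 + C ^+ 2) * q v.
  have qpsi : sqrt (q psi) <= D * (C * t).
    by apply: le_trans (hD _ cphi) _; rewrite ler_wpM2l.
  have k1 : kap * (q v + q phi) <= kap * (1 + C ^+ 2) * q v.
    rewrite -mulrA ler_wpM2l// mulrDl mul1r lerD2l -(sqrt_q_sq cphi) -tt -exprMn.
    by rewrite ler_pXn2r ?nnegrE ?sqrtr_ge0 ?mulr_ge0// ltW.
  rewrite E; apply: le_trans (normcB _ _) _; apply: lerD; last exact: le_trans conjQ k1.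
  apply: le_trans (normcB _ _) _; rewrite normcM.
  have n1 := normcD (pairing m (delta y) psi) (Q ue psi - pairing m (fun x => delta y x + z * u x) psi).
  have e1 := ler_wpM2l (ltW e0) qpsi.
  have e2 := ler_wpM2l nz0 (le_trans nd e1).
  have := le_trans Lp e1; lra.
have : t <= 2 * C ^+ 2 * (sqrt (m y) + e * (1 + normc z) * D).
  have B0 : 0 <= 2 * C ^+ 2 * (sqrt (m y) + e * (1 + normc z) * D).
    by rewrite (mulr_ge0 C2)// addr_ge0// mulr_ge0// mulr_ge0 ?(ltW e0)// addr_ge0.
  move: t0; rewrite le_eqVlt => /orP[/eqP<-//|tp].
  have tot := le_trans infv (ler_wpM2l (ltW C_gt0) total).
  have h := ler_wpM2r (q_ge0 cv) small.
  rewrite -(ler_pM2r tp); have := tt; rewrite expr2 => tq; lra.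
have ptx : sqrt (m x) * (rho x * normc (ue x)) <= t.
  rewrite -(@ler_pXn2r _ 2) ?nnegrE ?mulr_ge0 ?normc_ge0 ?(ltW (rho_gt0 x))//.
  rewrite exprMn (sqr_sqrtr (ltW (m_gt0 x))) tt.
  apply: le_trans (n2_le_q cv).
  have := sumle_pt x (n2_sum cv).
  by rewrite /v /wmul normcM normcR0 ?(ltW (rho_gt0 x)).
have := hcx _ _ nue => /= du.
have ux : normc (u x) <= normc (ue x) + cx * e.
  rewrite [X in normc X <= _](_ : u x = ue x - (ue x - u x)); last by ring.
  by apply: le_trans (normcB _ _) _; rewrite lerD2l.
have sr : 0 <= sqrt (m x) * rho x by rewrite mulr_ge0// ltW.
have := ler_wpM2l sr ux; rewrite /M; lra.
Qed.

End Weight.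

Variable s : R.
Hypothesis s_ge0 : 0 <= s.
Hypothesis d_jump : forall x y, 0 < b x y -> d x y <= s.

Lemma expR_sub1_le (a : R) : `|1 - expR a| <= `|a| * expR `|a|.
Proof.
have [a0|a0] := leP 0 a.
  rewrite (ger0_norm a0) ler0_norm; last by rewrite subr_le0 -expR0 ler_expR.
  have := expR_ge1Dx (- a); rewrite expRN => h.
  have e0 := expR_gt0 a.
  have := ler_wpM2r (ltW e0) h; rewrite mulVf ?gt_eqF//; lra.
rewrite (ltr0_norm a0) ger0_norm; last by rewrite subr_ge0 -expR0 ler_expR ltW.
have := expR_ge1Dx a => h.
have : 1 <= expR (- a) by rewrite -expR0 ler_expR; lra.
have na : 0 <= - a by lra.
move=> /(ler_wpM2l na); lra.
Qed.

(* Combes-Thomas, with the weight [exp (a min(d(., y), d(x, y)))]: it is bounded,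
   hence preserves the form domain, and it is [1] at [y] and [exp (a d(x, y))]
   at [x]. *)
Lemma resolvent_decay z K : form_bounded m b o c -> res z K ->
  exists a M, [/\ 0 < a, 0 <= M & forall x y u,
    form_graph u (fun w => delta y w + z * u w) ->
    sqrt (m x) * normc (u x) <= M * expR (- a * d x y) * sqrt (m y)].
Proof.
move=> hc rz; have [C C0 hC] := inf_sup rz.
have [K' K'0 hK'] := energy_bound hc.
have [[d_ge0 d_refl d_sym d_tri] _] := d_intr.
(* With [a = 1 / (D exp s)] one has [a <= 1], hence [theta = a exp (a s) <= 1 / D]. Using
   [theta^2 <= theta], this is the smallness required of [theta]. *)
pose D := 2 * (C * ((K' + 2) * (1 + C ^+ 2))) + 1.
have D1 : 1 <= D.
  rewrite lerDr !mulr_ge0 ?(ltW C0)//; have := sqr_ge0 C; lra.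
have D0 : 0 < D by lra.
pose a := (D * expR s)^-1.
have a0 : 0 < a by rewrite invr_gt0 mulr_gt0 ?expR_gt0.
have a1 : a <= 1.
  rewrite invf_le1 ?mulr_gt0 ?expR_gt0//.
  have : 1 <= expR s by rewrite -expR0 ler_expR.
  by move: D1; set E := expR s => ? ?; nra.
pose theta := a * expR (a * s).
have th0 : 0 <= theta by rewrite mulr_ge0 ?expR_ge0// ltW.
have thD : theta <= D^-1.
  rewrite /theta {1}/a invfM -mulrA ler_piMr ?invr_ge0 ?(ltW D0)//.
  by rewrite ler_pdivrMl ?expR_gt0// mulr1 ler_expR ler_piMl.
have th1 : theta <= 1 by apply: le_trans thD _; rewrite invf_le1.
have small : C * ((theta * K' + theta + theta ^+ 2) * (1 + C ^+ 2)) <= 2^-1.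
  have C1 : 0 <= 1 + C ^+ 2 by have := sqr_ge0 C; lra.
  apply: (@le_trans _ _ (C * ((theta * (K' + 2)) * (1 + C ^+ 2)))).
    rewrite ler_wpM2l ?(ltW C0)// ler_wpM2r//.
    have : theta ^+ 2 <= theta by rewrite expr2 ler_piMl.
    lra.
  rewrite (_ : C * _ = theta * (C * ((K' + 2) * (1 + C ^+ 2)))); last by ring.
  have P0 : 0 <= C * ((K' + 2) * (1 + C ^+ 2)).
    by rewrite !mulr_ge0 ?(ltW C0)//; lra.
  apply: le_trans (ler_wpM2r P0 thD) _.
  rewrite ler_pdivrMl// /D; lra.
exists a, (2 * C ^+ 2); split=> //; first by rewrite mulr_ge0 ?sqr_ge0.
move=> x y u Hu.
pose w (v : X) := a * Num.min (d v y) (d x y).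
have := @weighted_resolvent_bound K' K'0 (fun f cf => (hK' f cf).1) (fun f cf => (hK' f cf).2)
  (fun v : X => expR (w v)) theta (expR (a * d x y)) _ _ th0 _ C z C0 hC small y u _ Hu x.
have wx : w x = a * d x y by rewrite /w minxx.
rewrite wx => H.
rewrite mulNr expRN -mulrA mulrCA ler_pdivlMl ?expR_gt0//.
rewrite [leLHS](_ : _ = sqrt (m x) * (expR (a * d x y) * normc (u x))); last by ring.
apply: H.
- by move=> v; exact: expR_gt0.
- by move=> v; rewrite ler_expR /w ler_wpM2l ?(ltW a0)// ge_min lexx orbT.
- move=> v v' bv; rewrite -expRN -expRD.
  (* The linear factor gives [a d(v, v')] by the triangle inequality; the exponential factor is at
     most [exp (a s)] because edges have length at most [s]. *)
  apply: le_trans (expR_sub1_le _) _.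
  have ww : `|w v - w v'| <= a * d v v'.
    rewrite /w -mulrBr normrM (gtr0_norm a0) ler_wpM2l ?(ltW a0)//.
    have := d_tri v v' y; have := d_tri v' v y; rewrite (d_sym v' v) => h1 h2.
    rewrite ler_norml /Num.min; do 2 case: ltP => ? /=; apply/andP; split; lra.
  have ws : `|w v - w v'| <= a * s.
    by apply: le_trans ww _; rewrite ler_wpM2l ?(ltW a0)// d_jump.
  rewrite /theta mulrAC; apply: ler_pM; rewrite ?normr_ge0 ?expR_ge0//.
  by rewrite ler_expR.
by rewrite /w d_refl min_l ?mulr0 ?expR0.
Qed.

End MagneticForm.

(** * Volume growth and Schur sums of decaying kernels *)

Section Growth.
Variable d : X -> X -> R.
Hypothesis d_metric : pseudo_metric d.
Hypothesis growth : uniform_subexponential_growth m d.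

Lemma ball_volume e : 0 < e -> exists2 C, 0 < C & forall x r (A : {fset X}), 0 < r ->
  \sum_(y <- A | d x y <= r) m y <= C * expR (e * r) * m x.
Proof.
move=> /growth[C C0 H]; exists C => // x r A r0; rewrite -lee_fin.
apply: le_trans (ltW (H x r r0)).
rewrite /vol esum_mkcond; apply: esum_ge; exists [set` A].
  by split; [exact: finite_fset|].
rewrite fsbig_finite//= set_fsetK -sumEFin big_mkcond; apply: lee_sum => y _.
rewrite (_ : (y \in _) = (d x y <= r)); first by case: ifP.
by apply/idP/idP; rewrite inE.
Qed.

(** Decomposition into shells [i <= d(x, y) < i + 1], each inside the ball of radius [i + 1 > 0].
    Growth at rate [a / 2] against decay at rate [a] leaves a geometric series of ratio
    [exp (- a / 2)]. *)
Lemma exp_volume a : 0 < a -> exists2 C, 0 < C & forall x,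
  sumle (fun y => m y * expR (- a * d x y)) (C * m x).
Proof.
move=> a0; have a2 : 0 < a / 2 by rewrite divr_gt0.
have [C C0 H] := ball_volume a2; have [d_ge0 _ _ _] := d_metric.
pose t := expR (- (a / 2)).
have t0 : 0 < t := expR_gt0 _.
have t1 : t < 1 by rewrite /t expR_lt1; lra.
have t10 : 0 < 1 - t by lra.
exists (C * expR (a / 2) / (1 - t)); first by rewrite divr_gt0 ?mulr_gt0 ?expR_gt0.
move=> x A.
pose k y := Num.truncn (d x y).
have kP y : (k y)%:R <= d x y < (k y).+1%:R by exact: truncn_itv.
have [N hN] : exists N, forall y, y \in A -> (k y < N)%N.
  exists (\max_(y <- A) k y).+1 => y yA; rewrite ltnS.
  by rewrite (big_rem y yA) /= leq_maxl.
have geom n : \sum_(i < n) t ^+ i <= (1 - t)^-1.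
  rewrite -[X in _ <= X]mul1r ler_pdivlMr// mulrC -opprB mulNr -subrX1 opprB.
  by rewrite gerBl exprn_ge0 ?ltW.
apply: (@le_trans _ _ (\sum_(i < N) expR (- a * i%:R) * (C * expR (a / 2 * i.+1%:R) * m x))).
  apply: (@le_trans _ _ (\sum_(y <- A) \sum_(i < N) (if d x y <= i.+1%:R then expR (- a * i%:R) * m y else 0))).
    rewrite big_seq [leRHS]big_seq; apply: ler_sum => y yA.
    rewrite (bigD1 (Ordinal (hN _ yA)))//=; have /andP[k1 k2] := kP y.
    rewrite (ltW k2) -[leLHS]addr0 lerD//.
      by rewrite mulrC ler_wpM2r ?(ltW (m_gt0 y))// ler_expR !mulNr lerN2 ler_wpM2l// ltW.
    by apply: sumr_ge0 => i _; case: ifP => // _; rewrite mulr_ge0 ?expR_ge0 ?ltW.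
  rewrite exchange_big /=; apply: ler_sum => i _.
  rewrite -big_mkcond /= -mulr_sumr ler_wpM2l ?expR_ge0//; exact: H.
rewrite (_ : \sum_(i < N) _ = C * expR (a / 2) * m x * \sum_(i < N) t ^+ i).
  rewrite [leRHS](_ : _ = C * expR (a / 2) * m x * (1 - t)^-1); last by ring.
  by rewrite ler_wpM2l// !mulr_ge0 ?expR_ge0 ?(ltW C0) ?(ltW (m_gt0 x)).
rewrite mulr_sumr; apply: eq_bigr => i _.
rewrite /t -expRM_natl.
have -> : expR (- a * i%:R) * (C * expR (a / 2 * i.+1%:R) * m x) =
  C * (expR (- a * i%:R) * expR (a / 2 * i.+1%:R)) * m x by ring.
rewrite -expRD [RHS](_ : _ = C * (expR (a / 2) * expR (i%:R * - (a / 2))) * m x); last by ring.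
rewrite -expRD; congr (_ * expR _ * _); by rewrite -(natr1 i); field.
Qed.

(** For the row sums the factor [sqrt (m y / m x)] has to become [m y / m x], at the price of half
    the decay. The column sums are then row sums, since [m x k(x, y) = m y k(y, x)] for this
    kernel. *)
Lemma decay_schur a M : 0 < a -> 0 <= M -> exists C, [/\ 0 < C,
  forall x, sumle (fun y => M * expR (- a * d x y) * sqrt (m y) / sqrt (m x)) C &
  forall y, sumle (fun x => m x * (M * expR (- a * d x y) * sqrt (m y) / sqrt (m x))) (C * m y)].
Proof.
move=> a0 M0; have a2 : 0 < a / 2 by rewrite divr_gt0.
have [D D0 hD] := exp_volume a2; have [B B0 hB] := ball_volume a0.
have [d_ge0 d_refl d_sym _] := d_metric.
have s0 x : 0 < sqrt (m x) by rewrite sqrtr_gt0.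
have ss x : sqrt (m x) * sqrt (m x) = m x by rewrite -expr2 sqr_sqrtr// ltW.
(* Uniform growth compares masses of points: [x] lies in the ball around [y] of radius
   [d(x, y) + 1], where [1] is added to make the radius positive. *)
have comp x y : sqrt (m x) <= sqrt B * expR (a / 2 * (d x y + 1)) * sqrt (m y).
  have : m x <= B * expR (a * (d x y + 1)) * m y.
    have r0 : 0 < d x y + 1 by rewrite ltr_wpDl.
    have := hB y _ [fset x]%fset r0; rewrite big_mkcond big_seq_fset1 d_sym.
    by rewrite lerDl ler01.
  move=> h; rewrite -(@ler_pXn2r _ 2) ?nnegrE ?mulr_ge0 ?expR_ge0 ?(ltW (s0 _)) ?sqrtr_ge0//.
  rewrite !exprMn !sqr_sqrtr ?(ltW (m_gt0 _)) ?(ltW B0)// -expRM_natl.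
  by move: h; congr (_ <= _ * expR _ * _); field.
pose M' := M * sqrt B * expR (a / 2).
have M'0 : 0 <= M' by rewrite !mulr_ge0 ?expR_ge0 ?sqrtr_ge0.
have row x : sumle (fun y => M * expR (- a * d x y) * sqrt (m y) / sqrt (m x)) (M' * D + 1).
  have i0 : 0 <= M' / m x by rewrite divr_ge0// ltW.
  apply: le_sumle (sumleZ i0 (hD x)).
    move=> y.
    have -> : M * expR (- a * d x y) * sqrt (m y) / sqrt (m x) =
      M * expR (- a * d x y) * sqrt (m y) / m x * sqrt (m x).
      have := ss x; move: (sqrt (m x)) (s0 x) => S S0 <-.
      by field; rewrite gt_eqF.
    have E : expR (- a * d x y) * expR (a / 2 * (d x y + 1)) = expR (a / 2) * expR (- (a / 2) * d x y).
      by rewrite -!expRD; congr expR; field.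
    have h0 : 0 <= M * expR (- a * d x y) * sqrt (m y) / m x.
      by rewrite divr_ge0 ?(ltW (m_gt0 x))// !mulr_ge0 ?expR_ge0 ?sqrtr_ge0.
    apply: le_trans (ler_wpM2l h0 (comp x y)) _.
    rewrite [leLHS](_ : _ = M * sqrt B * (expR (- a * d x y) * expR (a / 2 * (d x y + 1)))
      * (sqrt (m y) * sqrt (m y)) / m x); last by ring.
    by rewrite E ss /M' le_eqVlt; apply/orP; left; apply/eqP; ring.
  rewrite mulrCA mulrA [X in X <= _](_ : _ = M' * D); last by field; rewrite gt_eqF.
  by rewrite lerDl.
exists (M' * D + 1); split=> //; first by rewrite ltr_wpDl// mulr_ge0// ltW.
move=> y; rewrite mulrC; apply: le_sumle (sumleZ (ltW (m_gt0 y)) (row y)) => // x.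
rewrite d_sym le_eqVlt; apply/orP; left; apply/eqP.
have := ss x; have := ss y; move: (sqrt (m x)) (s0 x) (sqrt (m y)) (s0 y).
by move=> S S0 T T0 <- <-; field; rewrite !gt_eqF.
Qed.

End Growth.

(** * Operators determined on finitely supported functions *)

Section Density.
Variable p : \bar R.
Hypothesis p1 : (1 <= p)%E.
Hypothesis p_fin : p != +oo%E.

Lemma cutoff_Cc (A : {fset X}) (f : fn) : ell m p f -> Cc (cutoff A f) /\ ell m p (cutoff A f).
Proof.
move=> /(ellP)[B hB]; split; first exact: Cc_cutoff.
by apply: (nb_ell); exact: (nb_cut_le p1 A hB).
Qed.

Lemma dense_eq (T1 T2 : fn -> fn) K1 K2 : lin p T1 -> lin p T2 ->
  bnd p T1 K1 -> bnd p T2 K2 -> (forall f, Cc f -> T1 f = T2 f) ->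
  forall f, ell m p f -> T1 f = T2 f.
Proof.
move=> l1 l2 b1 b2 h f ef; have [B hB] := (ellP _ _).1 ef.
apply/funext => x.
have /(nb_eq0 p1)/(_ x) /eqP : nb p (fun x => T1 f x - T2 f x) 0.
  apply: (nb_closed) => e e0; rewrite add0r.
  have LC : 0 < `|K1| + `|K2| + 1 by rewrite ltr_wpDl ?addr_ge0.
  have [A hA] := nb_dense p1 p_fin hB (divr_gt0 e0 LC).
  have [cA eA] := cutoff_Cc A ef.
  have n1 := b1 _ _ hA; have n2 := b2 _ _ hA.
  rewrite (linB l1 ef eA) in n1; rewrite (linB l2 ef eA) in n2.
  rewrite (h _ cA) in n1.
  have := nbB p1 n1 n2; rewrite -mulrDl => hh.
  apply: eq_nb (nbW _ hh); first by move=> w; ring.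
  rewrite mulrCA ler_piMr ?(ltW e0)// ler_pdivrMr// mul1r.
  have := ler_norm K1; have := ler_norm K2; lra.
by rewrite subr_eq0 => /eqP.
Qed.

Lemma lin_comp T1 T2 K2 : lin p T1 -> lin p T2 -> bnd p T2 K2 ->
  lin p (fun f => T1 (T2 f)).
Proof.
by move=> l1 l2 b2 a f g ef eg; rewrite l2// l1//; exact: (bnd_ell b2).
Qed.

Lemma bnd_comp (T1 T2 : fn -> fn) K1 K2 : bnd p T1 K1 -> bnd p T2 K2 ->
  bnd p (fun f => T1 (T2 f)) (K1 * K2).
Proof. by move=> b1 b2 f B hB; rewrite -mulrA; apply: b1; exact: b2. Qed.

End Density.

(** * Krein's symmetrization *)

Section Krein.
Variable p : \bar R.
Hypothesis p1 : (1 <= p)%E.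
Variables (T T' : fn -> fn) (k : R).
Hypothesis k_gt0 : 0 < k.
Hypotheses (T_bnd : bnd p T k) (T'_bnd : bnd p T' k).
Hypotheses (T_ell : forall f, ell2 f -> ell2 (T f)) (T'_ell : forall f, ell2 f -> ell2 (T' f)).
Hypothesis adj : forall f g, ell2 f -> ell2 g -> pairing m (T f) g = pairing m f (T' g).

Let adj' f g : ell2 f -> ell2 g -> pairing m (T' f) g = pairing m f (T g).
Proof.
move=> ef eg; rewrite (pairing_conj (psumm22 eg (T'_ell ef))) -adj//.
by rewrite (pairing_conj (psumm22 ef (T_ell eg))) conjcK.
Qed.

Let A f := T' (T f).
Let A_ell f : ell2 f -> ell2 (A f). Proof. by move=> /T_ell/T'_ell. Qed.
Let A_sym f g : ell2 f -> ell2 g -> pairing m (A f) g = pairing m f (A g).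
Proof. by move=> ef eg; rewrite /A adj' ?adj//; exact: T_ell. Qed.

Let it n f := iter n A f.
Let it_ell n f : ell2 f -> ell2 (it n f).
Proof. by move=> ef; elim: n => //= n /A_ell. Qed.

Let it_sym n f g : ell2 f -> ell2 g -> pairing m (it n f) g = pairing m f (it n g).
Proof.
elim: n f g => [|n ih] f g ef eg //; rewrite /it iterSr -/(it n _) ih//; last exact: A_ell.
by rewrite A_sym ?iterS//; exact: it_ell.
Qed.

Let it_bnd n f B : nb p f B -> nb p (it n f) ((k ^+ 2) ^+ n * B).
Proof.
move=> hB; elim: n => [|n ih]; first by rewrite expr0 mul1r.
by rewrite exprS -mulrA (expr2 k) -mulrA; apply: T'_bnd; exact: T_bnd.
Qed.

(** Only finitely many point evaluations occur, so the [l^p] bounds on the iterates can be tested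
    for every [p] in the same way. *)
Let Cc_pairing_bound f : Cc f -> exists D, forall u b, nb p u b ->
  normc (pairing m u f) <= D * b.
Proof.
move=> /CcP[F hF]; have pt x : exists c, forall f B, nb p f B -> normc (f x) <= c * B.
  by have [c _ hc] := nb_pt p1 x; exists c.
have [c hc] := choice pt.
exists (\sum_(x <- F) m x * (c x * normc (f x))) => u b hu.
rewrite /pairing (@csum_finite _ _ _ F); last by move=> x /hF ->; rewrite rmorph0 mulr0.
apply: le_trans (normc_sum _ _) _; rewrite mulr_suml; apply: ler_sum => x _.
have le := hc x _ _ hu.
rewrite !normcM normc_conj normcR0 ?(ltW (m_gt0 x))//.
have := ler_wpM2l (mulr_ge0 (ltW (m_gt0 x)) (normc_ge0 (f x))) le; lra.
Qed.

(* Krein: a bound on some [l^p] of an operator and its adjoint bounds it on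
   [l^2], because [<(T' T)^(2^n) f, f>] grows at least like the [2^n]-th power
   of [|T f|^2 / |f|^2] by Cauchy-Schwarz. *)
Lemma krein_bound f : Cc f ->
  Re (pairing m (T f) (T f)) <= k ^+ 2 * Re (pairing m f f).
Proof.
move=> cf; have ef := Cc_ell le12 cf.
set N := Re (pairing m f f).
pose al n := Re (pairing m (it (2 ^ n) f) f).
have sq_nb u : ell2 u -> nb 2%:E u (sqrt (Re (pairing m u u))).
  exact: pairing_self_ge.
have re_ge0 u : ell2 u -> 0 <= Re (pairing m u u).
  move=> eu; rewrite leNgt; apply/negP => lt; have := sq_nb _ eu; rewrite ltr0_sqrtr//.
  move=> /(nb_eq0 le12) u0; move: lt; rewrite /pairing.
  rewrite (@csum_finite _ _ _ fset0) ?big_seq_fset0 ?ltxx// => x _.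
  by rewrite u0 mulr0 mul0r.
have alE n : Re (pairing m (it (2 ^ n) f) (it (2 ^ n) f)) = al n.+1.
  rewrite /al expnS mul2n -addnn -it_sym//; last exact: it_ell.
  by rewrite /it -iterD.
have al0 : al 0%N = Re (pairing m (T f) (T f)).
  by rewrite /al expn0 -[it 1 f]/(T' (T f)) adj'//; exact: T_ell.
have N0 : 0 <= N := re_ge0 _ ef.
have alge n : 0 <= al n.
  case: n => [|n]; first by rewrite al0; apply: re_ge0; exact: T_ell.
  by rewrite -alE; apply: re_ge0; exact: it_ell.
have step n : al n ^+ 2 <= al n.+1 * N.
  have e := it_ell (2 ^ n) ef.
  have h := pairing_le (psum22 (sq_nb _ e) (sq_nb _ ef)).
  rewrite alE in h.
  have := le_trans (le_Re_normc _) h; rewrite -/(al n) -/N => h2.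
  rewrite -(sqr_sqrtr (alge n.+1)) -(sqr_sqrtr N0) -exprMn.
  by rewrite ler_pXn2r ?nnegrE ?mulr_ge0 ?sqrtr_ge0.
rewrite -al0; move: N0; rewrite le_eqVlt => /orP[/eqP N0|N0].
  have := step 0%N; rewrite -N0 !mulr0 => h.
  by have := sqr_ge0 (al 0%N); have /eqP := le_anti (introT andP (conj h (sqr_ge0 (al 0%N))));
    rewrite sqrf_eq0 => /eqP ->.
have [D hD] := Cc_pairing_bound cf; have [B hB] := (ellP p f).1 (Cc_ell p1 cf).
have k2 : 0 < k ^+ 2 by rewrite exprn_gt0.
rewrite -ler_pdivrMr// leNgt; apply/negP => lt.
(* If [t > 1], then [al n >= N (t k^2)^(2^n)] by repeated squaring, while the [l^p] bound gives
   [al n <= D B (k^2)^(2^n)]; the powers of [t] would be bounded. *)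
pose t := al 0%N / N / k ^+ 2.
have t1 : 1 < t by rewrite ltr_pdivlMr// mul1r.
have grow n : t ^+ (2 ^ n) * (k ^+ 2) ^+ (2 ^ n) <= al n / N.
  rewrite -exprMn divfK ?gt_eqF//; elim: n => [|n ih]; first by rewrite expn0 expr1.
  rewrite expnS mulnC exprM; apply: (@le_trans _ _ ((al n / N) ^+ 2)).
    by rewrite ler_pXn2r ?nnegrE ?exprn_ge0// divr_ge0// ltW.
  rewrite exprMn expr2 ler_pdivlMr// exprVn expr2.
  rewrite (_ : _ * _ = al n * al n / N); last by field; rewrite gt_eqF.
  by rewrite ler_pdivrMr// -expr2.
have bound n : t ^+ (2 ^ n) <= D * B / N.
  have := hD _ _ (it_bnd (2 ^ n) hB) => h.
  have := le_trans (le_Re_normc _) h; rewrite -/(al n) => h2.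
  have kn : 0 < (k ^+ 2) ^+ (2 ^ n) by rewrite exprn_gt0.
  rewrite -(ler_pM2r kn); apply: le_trans (grow n) _.
  rewrite ler_pdivrMr//; apply: le_trans h2 _.
  rewrite le_eqVlt; apply/orP; left; apply/eqP; field; rewrite gt_eqF//.
have [j hj] := expr_unbounded (D * B / N) t1.
have := bound j; rewrite leNgt => /negP; apply.
apply: lt_le_trans hj _; rewrite ler_eXn2l//; exact: (ltnW (ltn_expl _ _)).
Qed.

End Krein.

(** * The resolvent of a positive self-adjoint operator *)

Section SymmetricOperator.
Variable H : operator R X.
Hypothesis H_ell : forall f h, H f h -> ell2 f /\ ell2 h.
Hypothesis H_lin : forall f h g k a, H f h -> H g k ->
  H (fun x => f x + a * g x) (fun x => h x + a * k x).
Hypothesis H_quad : forall f h, H f h ->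
  exists2 r, 0 <= r & pairing m h f = r%:C.
Hypothesis H_riesz : forall mu g, 0 < mu -> ell2 g ->
  exists f, H f (fun x => g x - mu%:C * f x).

Lemma op_sub f h f' h' : H f h -> H f' h' ->
  H (fun x => f x - f' x) (fun x => h x - h' x).
Proof.
move=> k k'; have := H_lin (-1) k k'.
by congr (H _ _); apply/funext => x; rewrite mulN1r.
Qed.

(** Polarization: [H_quad] makes the cross terms for [f + a g] real, and [a = 1], [a = i] give the
    two components. Symmetry and the surjectivity in [H_riesz] are the form in which
    self-adjointness is used. *)
Lemma op_sym f h g k : H f h -> H g k -> pairing m h g = pairing m f k.
Proof.
move=> Hf Hg; have [ef eh] := H_ell Hf; have [eg ek] := H_ell Hg.
have [r r0 hr] := H_quad Hf; have [s s0 hs] := H_quad Hg.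
have key a : Im (conjc a * pairing m h g + a * pairing m k f) = 0.
  have [t t0] := H_quad (H_lin a Hf Hg).
  have eag := ellZ le12 a eg; have eak := ellZ le12 a ek.
  have e1 := ellD le12 ef eag.
  rewrite (pairingDl (psumm22 eh e1) (psumm22 eak e1)).
  rewrite (pairingDr (psumm22 eh ef) (psumm22 eh eag)).
  rewrite (pairingDr (psumm22 eak ef) (psumm22 eak eag)).
  rewrite (pairingZr _ (psumm22 eh eg)) (pairingZr _ (psumm22 eak eg)).
  rewrite (pairingZl _ (psumm22 ek ef)) (pairingZl _ (psumm22 ek eg)).
  rewrite hr hs => E.
  have -> : conjc a * pairing m h g + a * pairing m k f =
     t%:C - r%:C - (a * conjc a) * s%:C by rewrite -E; ring.
  by rewrite mulcJ; simpc => /=; rewrite ?mulr0 ?mul0r; ring.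
rewrite (pairing_conj (psumm22 ek ef)).
have := key 1; have := key 'i%C.
case: (pairing m h g) (pairing m k f) => [u v] [u' v'] /=.
move=> k1 k2; apply/eqP; rewrite eq_complex /=; apply/andP; split; apply/eqP; lra.
Qed.

(** The Neumann series as a fixed point: [(H - z) f = g] holds if [f] is the solution at [z0] for
    the right-hand side [g + (z - z0) f], a contraction of ratio [|z - z0| K]. *)
Lemma res_shift z0 K z : resolves 2%:E H z0 K -> normc (z - z0) * K < 1 ->
  exists K', resolves 2%:E H z K'.
Proof.
move=> [K0 sur low] zK; set d := normc (z - z0) in zK.
have d0 : 0 <= d := normc_ge0 _.
have k1 : 0 < 1 - d * K by lra.
exists (K / (1 - d * K)); split.
- by rewrite divr_ge0// ltW.
- move=> g eg.
  have /choice[R0 hR0] : forall u, exists f, ell2 u -> H f (fun x => u x + z0 * f x).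
    move=> u; have [eu|neu] := pselect (ell2 u); last by exists u.
    by have [f hf] := sur _ eu; exists f.
  pose T u := R0 (fun x => g x + (z - z0) * u x).
  have earg u : ell2 u -> ell2 (fun x => g x + (z - z0) * u x).
    by move=> eu; exact: (ellD le12 eg (ellZ le12 (z - z0) eu)).
  have [|||f ef Tf] := banach_fixpoint le12 _ zK (T := T).
  + exact: mulr_ge0.
  + by move=> u /earg/hR0/H_ell[].
  + move=> u v B eu ev uv.
    have := op_sub (hR0 _ (earg _ eu)) (hR0 _ (earg _ ev)) => /low; rewrite -/(T u) -/(T v).
    rewrite (mulrC d) -mulrA; apply; apply: eq_nb (nbZ le12 (z - z0) uv) => x; ring.
  exists f; have := hR0 _ (earg _ ef); rewrite -/(T f) Tf; congr (H _ _).
  by apply/funext => x; ring.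
move=> f h B Hf hB; have [ef eh] := H_ell Hf.
have := nb_self ef; set F := fine _ => hF.
have F0 := nb_ge0 hF.
have : nb2 f (K * (B + d * F)).
  apply: (low _ _ _ Hf).
  by apply: eq_nb (nbD le12 hB (nbZ le12 (z - z0) hF)) => x; ring.
rewrite {1}/nb (nb_norm hF) -/F lee_fin => FB.
apply: nbW hF; rewrite mulrAC ler_pdivlMr//; lra.
Qed.

Let self_norm f : ell2 f -> exists t, [/\ 0 <= t, nb2 f t & pairing m f f = (t ^+ 2)%:C].
Proof.
move=> ef; exists (sqrt (Re (pairing m f f))); split; first exact: sqrtr_ge0.
  exact: pairing_self_ge.
have := pairing_self_ge ef => /(Re_pairing_self_le) le.
have [F hF] := (ellP _ _).1 ef.
have r0 : 0 <= Re (pairing m f f).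
  rewrite leNgt; apply/negP => lt; move: (le); rewrite ltr0_sqrtr// expr0n /= => _.
  have := pairing_self_ge ef; rewrite ltr0_sqrtr//.
  move=> /(nb_eq0 le12) f0; move: lt; rewrite /pairing.
  rewrite (@csum_finite _ _ _ fset0) ?big_seq_fset0 ?ltxx// => x _.
  by rewrite f0 mulr0 mul0r.
rewrite sqr_sqrtr//; apply/eqP; rewrite eq_complex (Im_pairing_self ef).
by rewrite /= !eqxx.
Qed.

Lemma res_negative mu : 0 < mu -> resolves 2%:E H (- mu%:C) mu^-1.
Proof.
move=> mu0; split; first by rewrite invr_ge0 ltW.
  move=> g eg; have [f hf] := H_riesz mu0 eg; exists f; move: hf; congr (H _ _).
  by apply/funext => x; rewrite mulNr.
move=> f h B Hf hB; have [ef eh] := H_ell Hf.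
have [t [t0 nt tt]] := self_norm ef; have [r r0 hr] := H_quad Hf.
have ez := ellZ le12 (- mu%:C) ef.
have := le_trans (le_Re_normc _) (pairing_le (psum22 hB nt)).
rewrite (pairingBl (psumm22 eh ef) (psumm22 ez ef)).
rewrite (pairingZl _ (psumm22 ef ef)) tt hr mulNr opprK ReD ReZ /= => le.
have B0 := nb_ge0 hB; apply: nbW nt; rewrite mulrC ler_pdivlMr//.
move: t0; rewrite le_eqVlt => /orP[/eqP<-|t0]; first by rewrite mul0r.
by rewrite -(ler_pM2r t0); lra.
Qed.

Lemma res_nonreal_low z f h B : Im z != 0 -> H f h ->
  nb2 (fun x => h x - z * f x) B -> nb2 f (`|Im z|^-1 * B).
Proof.
move=> z0 Hf hB; have [ef eh] := H_ell Hf.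
have [t [t0 nt tt]] := self_norm ef; have [r r0 hr] := H_quad Hf.
have ez := ellZ le12 z ef.
have := le_trans (normIm _) (pairing_le (psum22 hB nt)).
rewrite (pairingBl (psumm22 eh ef) (psumm22 ez ef)).
rewrite (pairingZl _ (psumm22 ef ef)) tt hr ImD ImN (mulrC z) ImZ /= sub0r => le.
have B0 := nb_ge0 hB; apply: nbW nt; rewrite mulrC ler_pdivlMr ?normr_gt0//.
move: t0; rewrite le_eqVlt => /orP[/eqP<-|t0]; first by rewrite mul0r.
rewrite -(ler_pM2r t0) mulrAC -expr2; apply: le_trans le.
by rewrite normrN normrM ger0_norm// sqr_ge0.
Qed.

(* The discs [|z + mu| < mu] exhaust the half plane. *)
Lemma res_half_plane z : Re z < 0 -> exists K, resolves 2%:E H z K.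
Proof.
(* With this [mu], [|z + mu|^2 = |z|^2 + 2 mu Re z + mu^2 = mu^2 - |z|^2 < mu^2]. *)
move=> z0; pose mu := normc z ^+ 2 / - Re z.
have nz : 0 < normc z.
  by rewrite lt_def normc_ge0 andbT normc_eq0; apply: contraTneq z0 => ->; rewrite ltxx.
have z0' : 0 < - Re z by lra.
have mu0 : 0 < mu by rewrite divr_gt0// exprn_gt0.
apply: (res_shift (res_negative mu0)).
rewrite ltr_pdivrMr// mul1r -(@ltr_pXn2r _ 2) ?nnegrE ?normc_ge0 ?(ltW mu0)//.
rewrite sqr_normc opprK ReD ImD /= addr0.
have e1 : mu * - Re z = normc z ^+ 2 by rewrite divfK// gt_eqF.
have := sqr_normc z; have := exprn_gt0 2 nz; rewrite sqrrD; lra.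
Qed.

(** The bound holds a priori, so only solvability is at stake. It spreads along the horizontal line
    through [z] from the left half plane in steps of [|Im z| / 2], less than the radius [|Im z|] of
    the disc of convergence; the induction counts the steps. *)
Lemma res_nonreal z : Im z != 0 -> resolves 2%:E H z `|Im z|^-1.
Proof.
move=> zI; have y0 : 0 < `|Im z| by rewrite normr_gt0.
suff [K [_ sur _]] : exists K, resolves 2%:E H z K.
  split; [by rewrite invr_ge0 ltW|exact: sur|].
  by move=> f h B; exact: res_nonreal_low.
have := truncnS_gt (Re z / (`|Im z| / 2)).
move: (Num.truncn _).+1 => n; elim: n z zI y0 => [|n ih] z zI y0.
  by rewrite mulr0n ltr_pdivrMr ?divr_gt0// mul0r; exact: res_half_plane.
rewrite ltr_pdivrMr ?divr_gt0// => zn.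
pose w := z - (`|Im z| / 2)%:C.
have wI : Im w = Im z by rewrite ImD ImN /= subr0.
have [K [_ sur _]] : exists K, resolves 2%:E H w K.
  apply: ih; rewrite ?wI//.
  by rewrite ltr_pdivrMr ?divr_gt0// ReD ReN /=; rewrite -natr1 in zn; lra.
have res_w : resolves 2%:E H w `|Im z|^-1.
  split; [by rewrite invr_ge0 ltW|exact: sur|].
  by move=> f h B; rewrite -wI; apply: res_nonreal_low; rewrite wI.
apply: (res_shift res_w).
rewrite /w opprB addrC subrK normcR0 ?divr_ge0// mulrAC divff ?gt_eqF//; lra.
Qed.

Lemma res_conj z K : resolves 2%:E H z K -> exists K', resolves 2%:E H (conjc z) K'.
Proof.
move=> rz; have [z0|z0] := eqVneq (Im z) 0.
  exists K; suff -> : conjc z = z by [].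
  by case: z z0 {rz} => u v /= ->; rewrite oppr0.
by exists `|Im (conjc z)|^-1; apply: res_nonreal; rewrite Im_conjc oppr_eq0.
Qed.

Lemma resolvent_sym z f g u v : ell2 f -> ell2 g ->
  H u (fun x => f x + z * u x) -> H v (fun x => g x + conjc z * v x) ->
  pairing m u g = pairing m f v.
Proof.
move=> ef eg Hu Hv; have [eu _] := H_ell Hu; have [ev _] := H_ell Hv.
have := op_sym Hu Hv; have ezu := ellZ le12 z eu; have ezv := ellZ le12 (conjc z) ev.
rewrite (pairingDl (psumm22 ef ev) (psumm22 ezu ev)).
rewrite (pairingDr (psumm22 eu eg) (psumm22 eu ezv)).
rewrite (pairingZl _ (psumm22 eu ev)) (pairingZr _ (psumm22 eu ev)) conjcK.
by move=> /addIr.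
Qed.

(** [rk y] is the column [(H - z)^-1 delta_y]. The sum carries no weight [m] because [f] is expanded
    in the functions [delta y]. *)
Definition kernel_op (rk : X -> fn) f : fn := fun x => csum (fun y => f y * rk y x).

Definition resolvent_kernel (z : R[i]) (rk : X -> fn) (C : R) : Prop :=
  [/\ 0 < C, forall x, sumle (fun y => normc (rk y x)) C,
     forall y, sumle (fun x => m x * normc (rk y x)) (C * m y) &
     forall y, H (rk y) (fun x => delta y x + z * rk y x)].

(** * The operator of a resolvent kernel *)

Section ResolventKernel.
Variables (rk : X -> fn) (C : R) (z : R[i]).
Hypothesis rkP : resolvent_kernel z rk C.

Let C_gt0 : 0 < C. Proof. by case: rkP. Qed.
Let K_row x : sumle (fun y => normc (rk y x)) C. Proof. by case: rkP. Qed.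
Let K_col y : sumle (fun x => m x * normc (rk y x)) (C * m y).
Proof. by case: rkP. Qed.
Let rk_res y : H (rk y) (fun x => delta y x + z * rk y x).
Proof. by case: rkP. Qed.
Let rk_ge0 x y : 0 <= normc (rk y x). Proof. exact: normc_ge0. Qed.

Section exponent.
Variable p : \bar R.
Hypothesis p1 : (1 <= p)%E.

Lemma kernel_summ f x : ell m p f -> summ (fun y => f y * rk y x).
Proof.
move=> /(ellP)[B hB].
have [D hD] := schur_summ p1 C_gt0 rk_ge0 K_row K_col x hB.
exists D; apply: le_sumle hD => // y.
by rewrite normcM mulrC ler_wpM2r ?normc_ge0.
Qed.

Lemma kernel_bnd : bnd p (kernel_op rk) C.
Proof.
move=> f B hB; apply: (schur p1 C_gt0 rk_ge0 K_row K_col hB) => x D hD.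
apply: csum_le; apply: le_sumle hD => // y.
by rewrite normcM mulrC ler_wpM2r ?normc_ge0.
Qed.

Lemma kernel_lin : lin p (kernel_op rk).
Proof.
move=> a f g ef eg; apply/funext => x; rewrite /kernel_op.
rewrite -csumZ; last exact: kernel_summ.
rewrite -csumD; [|by apply: summZ; exact: kernel_summ|exact: kernel_summ].
by apply: eq_csum => y; ring.
Qed.

Lemma kernel_ell f : ell m p f -> ell m p (kernel_op rk f).
Proof. by move=> ef; exact: (bnd_ell kernel_bnd ef). Qed.

End exponent.

Variable L : R.
Hypothesis H_res : resolves 2%:E H z L.

Lemma resolvent_uniq f u v : H u (fun x => f x + z * u x) ->
  H v (fun x => f x + z * v x) -> u = v.
Proof.
move=> Hu Hv; case: H_res => _ _ low; apply/funext => x.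
have := low _ _ 0 (op_sub Hu Hv); rewrite mulr0 => h.
have /(nb_eq0 le12)/(_ x) /eqP : nb 2%:E (fun x => u x - v x) 0.
  apply: h; apply: eq_nb (nb0 le12) => w; ring.
by rewrite subr_eq0 => /eqP.
Qed.

Let H0 : H (fun=> 0) (fun=> 0).
Proof.
have := op_sub (rk_res x0) (rk_res x0).
by congr (H _ _); apply/funext => x; rewrite subrr.
Qed.

Lemma kernel_op_finite f (A : {fset X}) : (forall x, x \notin A -> f x = 0) ->
  H (kernel_op rk f) (fun x => f x + z * kernel_op rk f x).
Proof.
move=> fA.
have : forall B : {fset X}, H (fun x => \sum_(y <- B) f y * rk y x)
   (fun x => cutoff B f x + z * (\sum_(y <- B) f y * rk y x)).
  elim/fset1U_rect => [|y B yB ih].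
    have := H0; congr (H _ _); apply/funext => x; rewrite big_seq_fset0//.
    by rewrite /cutoff inE mulr0 addr0.
  have := H_lin (f y) ih (rk_res y).
  have E x : \sum_(w <- (y |` B)%fset) f w * rk w x = \sum_(w <- B) f w * rk w x + f y * rk y x.
    by rewrite big_fsetU1//= addrC.
  congr (H _ _); apply/funext => x; rewrite E//.
  rewrite /cutoff /delta !inE; case: eqP => [->|_] /=; first by rewrite (negPf yB); ring.
  by ring.
move=> /(_ A); congr (H _ _); apply/funext => x.
  by rewrite /kernel_op (@csum_finite _ _ _ A)// => y /fA ->; rewrite mul0r.
rewrite /kernel_op (@csum_finite _ _ _ A)//; last by move=> y /fA ->; rewrite mul0r.
by congr (_ + _); rewrite /cutoff; case: ifPn => // /fA.
Qed.

(** Instead of an appeal to closedness of [H]: a solution [u] exists, and the kernel operator and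
    the solution operator are both bounded on [l^2] and agree on truncations of [f]. *)
Lemma kernel_opP f : ell2 f -> H (kernel_op rk f) (fun x => f x + z * kernel_op rk f x).
Proof.
move=> ef; have [B hB] := (ellP _ _).1 ef.
case: H_res => L0 sur low; have [u Hu] := sur _ ef.
suff -> : kernel_op rk f = u by [].
apply/funext => x.
have /(nb_eq0 le12)/(_ x) /eqP : nb 2%:E (fun x => kernel_op rk f x - u x) 0.
  apply: (nb_closed) => e e0; rewrite add0r.
  have LC : 0 < C + L by rewrite ltr_pwDl.
  have [A hA] := nb_dense le12 (isT : 2%:E != +oo%E) hB (divr_gt0 e0 LC).
  have fA w : w \notin A -> cutoff A f w = 0 by move=> /negPf h; rewrite /cutoff h.
  have Hc := kernel_op_finite fA.
  have ec : ell2 (cutoff A f) by apply: (nb_ell); exact: (nb_cut_le le12 A hB).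
  have n1 := kernel_bnd le12 hA; rewrite (linB (kernel_lin le12) ef ec) in n1.
  have n2 : nb 2%:E (fun x => u x - kernel_op rk (cutoff A f) x) (L * (e / (C + L))).
    by apply: (low _ _ _ (op_sub Hu Hc)); apply: eq_nb hA => w; ring.
  have := nbB le12 n1 n2; rewrite -mulrDl mulrC divfK ?gt_eqF//.
  by apply: eq_nb => w; ring.
by rewrite subr_eq0 => /eqP.
Qed.

End ResolventKernel.

Let delta_ell y : ell2 (delta y).
Proof. exact: (Cc_ell le12 (Cc_delta y)). Qed.

(** The resolvents at [z] and [conjc z] are adjoint on [l^2]; evaluated at point masses, this is an
    identity of kernels and can be used on other spaces. *)
Lemma kernel_dual z rk C rk' C' : resolvent_kernel z rk C -> resolvent_kernel (conjc z) rk' C' ->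
  forall x y, (m x)%:C * rk' y x = (m y)%:C * conjc (rk x y).
Proof.
move=> [_ _ _ h] [_ _ _ h'] x y.
have := resolvent_sym (delta_ell x) (delta_ell y) (h x) (h' y).
rewrite pairing_delta pairing_delta_l => /(congr1 (@conjc R)).
by rewrite !conjcM conjcK !conjc_real.
Qed.

(** * Resolvents of the generators on [l^p] *)

Variable S : R -> R -> fn -> fn.
Hypothesis S_cons : consistent_semigroups m H S.

Let one2 : 1 <= 2 :> R. Proof. by rewrite ler1n. Qed.

Lemma S_C0 r : 1 <= r -> C0_semigroup m r%:E (S r).
Proof. by case: S_cons => _ h _; exact: h. Qed.

Lemma S_agree r t f : 1 <= r -> 0 <= t -> ell m r%:E f -> ell2 f ->
  S r t f = S 2 t f.
Proof. by case: S_cons => _ _ h *; exact: h. Qed.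

Lemma generator2P u h : generator m 2%:E (S 2) u (fun x => - h x) <-> H u h.
Proof.
case: S_cons => -[_ gen] _ _; rewrite gen /opp_operator.
have -> : - (fun x => - h x) = h :> (X -> R[i]); last by [].
by apply/funext => x; rewrite /GRing.opp /= opprK.
Qed.

Lemma Hop_ell p f h : (1 <= p)%E -> Hop m S p f h -> ell m p f /\ ell m p h.
Proof.
case: p => [r| |]// p1; last by case.
move=> /(C0_generatorP p1)[ef enh _]; split=> //.
have := ellZ p1 (-1) enh; congr (ell m _ _); apply/funext => x.
exact: (eq_trans (mulN1r _) (opprK (h x))).
Qed.

Let Hop_subr r f h f' h' : (1 <= r%:E)%E -> Hop m S r%:E f h -> Hop m S r%:E f' h' ->
  Hop m S r%:E (fun x => f x - f' x) (fun x => h x - h' x).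
Proof.
move=> p1 Hf Hf'; have [ef eh] := Hop_ell p1 Hf; have [ef' eh'] := Hop_ell p1 Hf'.
have [_ _ g] := (C0_generatorP p1 _ _ _).1 Hf.
have [_ _ g'] := (C0_generatorP p1 _ _ _).1 Hf'.
have r1 : 1 <= r by move: p1; rewrite lee_fin.
have Sr := S_C0 r1.
apply/(C0_generatorP p1); split; first exact: (ellB p1 ef ef').
  have := ellB p1 eh' eh; congr (ell m _ _); apply/funext => x.
  by rewrite -[RHS]/(- (h x - h' x)) opprB.
move=> e e0; have e2 : 0 < e / 2 by rewrite divr_gt0.
have [d d0 hd] := g _ e2; have [d' d'0 hd'] := g' _ e2.
exists (Num.min d d'); first by rewrite lt_min d0.
move=> t t0; rewrite lt_min => /andP[td td'].
have := nbB p1 (hd _ t0 td) (hd' _ t0 td').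
rewrite -mulrDr -splitr (linB (C0_lin Sr (ltW t0)) ef ef').
apply: eq_nb => x.
rewrite -[(- h) x]/(- h x) -[(- h') x]/(- h' x) -[(- (fun x => h x - h' x)) x]/(- (h x - h' x)).
by ring.
Qed.

Let Hop_suby f h f' h' : Hop m S +oo%E f h -> Hop m S +oo%E f' h' ->
  Hop m S +oo%E (fun x => f x - f' x) (fun x => h x - h' x).
Proof.
move=> [ef eh a] [ef' eh' a'].
have le1y : (1 <= +oo :> \bar R)%E by rewrite leey.
split; [exact: (ellB le1y ef ef')|exact: (ellB le1y eh eh')|].
move=> u v uv; have [eu ev] := @Hop_ell 1%:E u v (lexx _) uv.
have P := psumm1y.
rewrite (pairingBr (P _ _ ev ef) (P _ _ ev ef')).
by rewrite (pairingBr (P _ _ eu eh) (P _ _ eu eh')) (a _ _ uv) (a' _ _ uv).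
Qed.

Lemma Hop_sub p f h f' h' : (1 <= p)%E -> Hop m S p f h -> Hop m S p f' h' ->
  Hop m S p (fun x => f x - f' x) (fun x => h x - h' x).
Proof.
case: p => [r| |] p1; [exact: Hop_subr|exact: Hop_suby|by case].
Qed.

Section kernel.
Variables (rk : X -> fn) (C : R) (z : R[i]) (L : R).
Hypothesis rkP : resolvent_kernel z rk C.
Hypothesis H_res : resolves 2%:E H z L.
Let C_gt0 : 0 < C. Proof. by case: rkP. Qed.
Local Notation G := (kernel_op rk).

Let G_lin p (p1 : (1 <= p)%E) : lin p G := kernel_lin rkP p1.
Let G_bnd p (p1 : (1 <= p)%E) : bnd p G C := kernel_bnd rkP p1.
Let G_ell p (p1 : (1 <= p)%E) f (ef : ell m p f) : ell m p (G f) := bnd_ell (G_bnd p1) ef.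
Let GP f (ef : ell2 f) : H (G f) (fun x => f x + z * G f x) :=
  kernel_opP rkP H_res ef.

Section exponent.
Variable r : R.
Hypothesis r1 : 1 <= r.
Let p1 : (1 <= r%:E)%E. Proof. by rewrite lee_fin. Qed.
Let pf : r%:E != +oo%E. Proof. by []. Qed.
Let Sr := S_C0 r1.
Let S2 := S_C0 one2.

(** The semigroup commutes with its generator, so both sides solve the resolvent equation with
    right-hand side [S 2 t f]. *)
Lemma resolvent2_commute t f : 0 <= t -> ell2 f -> S 2 t (G f) = G (S 2 t f).
Proof.
move=> t0 ef; have eSf := C0_ell S2 t0 ef.
apply: (resolvent_uniq H_res _ (GP eSf)).
have eG := G_ell le12 ef; have [_ eh] := H_ell (GP ef).
have := C0_generator_commute le12 S2 t0 ((generator2P _ _).2 (GP ef)).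
have lS := C0_lin S2 t0; have ezG := ellZ le12 z eG.
rewrite (_ : S 2 t (fun x => - _) = (fun x => - (S 2 t f x + z * S 2 t (G f) x))).
  by move=> /generator2P.
have -> : (fun x => - (f x + z * G f x)) = (fun x => -1 * (f x + z * G f x)).
  by apply/funext => x; rewrite mulN1r.
rewrite (linZ le12 _ lS eh) (linD lS ef ezG) (linZ le12 _ lS eG).
by apply/funext => x; rewrite mulN1r.
Qed.

Lemma resolvent_commute t f : 0 <= t -> ell m r%:E f -> S r t (G f) = G (S r t f).
Proof.
move=> t0; have [M hM] := C0_bnd Sr t0; have lS := C0_lin Sr t0.
apply: (dense_eq p1 pf (lin_comp lS (G_lin p1) (G_bnd p1))
  (lin_comp (G_lin p1) lS hM) (bnd_comp hM (G_bnd p1)) (bnd_comp (G_bnd p1) hM)).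
move=> g cg; have er := Cc_ell p1 cg; have e2 := Cc_ell le12 cg.
rewrite (S_agree r1 t0 (G_ell p1 er) (G_ell le12 e2)) resolvent2_commute//.
by rewrite (S_agree r1 t0 er e2).
Qed.

(** This is [H G f] when [f] is in [l^2]; in general [- F f] is the candidate for the derivative at
    [0] of the orbit of [G f]. *)
Let F f x := f x + z * G f x.

Let F_lin : lin r%:E F.
Proof.
move=> a f g ef eg; apply/funext => x; rewrite /F (G_lin p1)//; ring.
Qed.

Let F_bnd : bnd r%:E F (1 + normc z * C).
Proof.
move=> f B hB; rewrite mulrDl mul1r -mulrA.
exact: (nbD p1 hB (nbZ p1 z (G_bnd p1 hB))).
Qed.

(** [generator_transfer_bound] needs data in both [l^2] and [l^r], hence a truncation [g] of [f].
    The limit [g -> f] is taken at fixed [t], which is possible because the admissible range of [t]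
    does not depend on the function. *)
Let orbit_bound : exists2 d, 0 < d & forall f t W, ell m r%:E f ->
    0 <= t -> t < d -> 0 <= W ->
    (forall s, 0 <= s -> s <= t -> nb r%:E (fun x => S r s (F f) x - F f x) W) ->
    nb r%:E (fun x => S r t (G f) x - G f x - t%:C * - F f x) (t * W).
Proof.
have [d2 [M2 [d20 M20 hM2]]] := C0_locally_bounded p1 Sr.
have agree t f : 0 <= t -> ell m r%:E f -> ell2 f -> S r t f = S 2 t f.
  by move=> *; exact: S_agree.
have bound := generator_transfer_bound p1 le12 Sr S2 agree.
have [d1 d10 hd1] := bound; exists (Num.min d1 d2); first by rewrite lt_min d10.
move=> f t W ef t0; rewrite lt_min => /andP[td1 td2] W0 hW.
have [B hB] := (ellP _ _).1 ef.
have D0 : 0 <= 1 + normc z * C by rewrite addr_ge0// mulr_ge0 ?normc_ge0// ltW.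
set D := 1 + normc z * C in D0.
(* The sum of all coefficients of [eps] in the final estimate. *)
pose k := M2 * C + C + t * (D + (M2 * D + D)).
have k0 : 0 <= k.
  have C0 := ltW C_gt0; have := mulr_ge0 M20 C0; have := mulr_ge0 t0 D0.
  by have := mulr_ge0 t0 (mulr_ge0 M20 D0); rewrite /k; lra.
apply: (nb_closed) => e e0.
have k1 : 0 < k + 1 by rewrite ltr_wpDl.
set eps := e / (k + 1); have eps0 : 0 < eps by rewrite divr_gt0.
have [A hA] := nb_dense p1 pf hB eps0.
set g := cutoff A f in hA.
have [cg eg] := cutoff_Cc p1 A ef.
have eg2 := Cc_ell le12 cg.
have nF : nb r%:E (fun x => F f x - F g x) (D * eps).
  by have := F_bnd hA; rewrite (linB F_lin ef eg).
have nG : nb r%:E (fun x => G f x - G g x) (C * eps).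
  by have := G_bnd p1 hA; rewrite (linB (G_lin p1) ef eg).
have eGf := G_ell p1 ef; have eGg := G_ell p1 eg.
have eFf := bnd_ell F_bnd ef; have eFg := bnd_ell F_bnd eg.
have eNFg : ell m r%:E (fun x => - F g x).
  by have := ellZ p1 (-1) eFg; congr (ell m _ _); apply/funext => x; rewrite mulN1r.
have gen : generator m 2%:E (S 2) (G g) (fun x => - F g x).
  by apply/generator2P; exact: GP.
have ngt : nb r%:E (fun x => S r t (G g) x - G g x - t%:C * - F g x)
    (t * (W + (M2 * (D * eps) + D * eps))).
  apply: (hd1 _ _ eGg eNFg gen) => //.
    have De := mulr_ge0 D0 (ltW eps0); have := mulr_ge0 M20 De; lra.
  move=> s s0 st; have lS := C0_lin Sr s0.
  have -> : S r s (fun x => - F g x) = (fun x => - S r s (F g) x).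
    have := linZ p1 (-1) lS eFg.
    rewrite (_ : (fun x => -1 * F g x) = (fun x => - F g x)).
      by move=> ->; apply/funext => x; rewrite mulN1r.
    by apply/funext => x; rewrite mulN1r.
  have h1 := hM2 s s0 (le_trans st (ltW td2)) _ _ nF.
  rewrite (linB lS eFf eFg) in h1.
  have := nbB p1 (nbB p1 h1 nF) (hW s s0 st).
  by rewrite addrC; apply: eq_nb => x; ring.
have lS := C0_lin Sr t0.
have h2 := hM2 t t0 (ltW td2) _ _ nG; rewrite (linB lS eGf eGg) in h2.
have h3 := nbZ p1 t%:C nF; rewrite normcR0// in h3.
have := nbD p1 ngt (nbD p1 (nbB p1 h2 nG) h3).
rewrite [X in nb _ _ X](_ : _ = t * W + k * eps); last by rewrite /k; ring.
move=> /(nbW (C := t * W + e)) hh; apply: eq_nb (hh _); first by move=> x; ring.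
rewrite lerD2l /eps mulrCA ler_piMr ?(ltW e0)// ler_pdivrMr// mul1r lerDl//.
Qed.

Lemma resolvent_generator f : ell m r%:E f ->
  generator m r%:E (S r) (G f) (fun x => - F f x).
Proof.
move=> ef; have eF := bnd_ell F_bnd ef; have eG := G_ell p1 ef.
have [d d0 hd] := orbit_bound.
apply/(C0_generatorP p1); split=> //.
  by apply/(ellP); have [B /(nbN p1) hB] := (ellP _ _).1 eF; exists B.
move=> e e0; have [d1 d10 h1] := C0_cont p1 Sr eF e0.
exists (Num.min d d1); first by rewrite lt_min d0.
move=> t t0; rewrite lt_min => /andP[td td1].
apply: hd => //; [exact: ltW..|].
by move=> s s0 st; apply: h1 => //; exact: le_lt_trans st td1.
Qed.

Lemma Hop_resolvent f : ell m r%:E f ->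
  Hop m S r%:E (G f) (fun x => f x + z * G f x).
Proof. exact: resolvent_generator. Qed.

(** [G] commutes with the semigroup, hence maps the pair [f, - h] of the generator to [G f, - G h].
    But the generator sends [G f] to [- F f], and comparing the two images gives the claim. *)
Lemma Hop_left_inverse f h : Hop m S r%:E f h -> G (fun x => h x - z * f x) = f.
Proof.
move=> gen; have /(C0_generatorP p1)[ef enh _] := gen.
have eh : ell m r%:E h.
  have := ellZ p1 (-1) enh; congr (ell m _ _); apply/funext => x.
  exact: (eq_trans (mulN1r _) (opprK (h x))).
have := generator_bnd_commute p1 Sr (G_lin p1) (G_bnd p1) resolvent_commute gen.
move=> /(generator_uniq p1)/(_ (resolvent_generator ef)).
have -> : - h = (fun x => -1 * h x) by apply/funext => x; rewrite mulN1r.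
rewrite (linZ p1 _ (G_lin p1) eh) => E.
have ezf := ellZ p1 z ef.
rewrite (linB (G_lin p1) eh ezf) (linZ p1 _ (G_lin p1) ef).
apply/funext => x; have := congr1 (fun u : fn => u x) E; rewrite /F /= => Ex.
have -> : G h x = - (-1 * G h x) by ring.
by rewrite Ex; ring.
Qed.

End exponent.
End kernel.

(** * The exponent infinity, by duality with [l^1] *)

Section infinite_exponent.
Variables (rk rk' : X -> fn) (C C' : R) (z : R[i]) (L' : R).
Hypotheses (rkP : resolvent_kernel z rk C) (rkP' : resolvent_kernel (conjc z) rk' C').
Hypothesis H_res' : resolves 2%:E H (conjc z) L'.
Let C_gt0 : 0 < C. Proof. by case: rkP. Qed.
Let C'_gt0 : 0 < C'. Proof. by case: rkP'. Qed.
Let rk_dual := kernel_dual rkP rkP'.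
Local Notation G := (kernel_op rk).
Local Notation G' := (kernel_op rk').

Let one1 : 1 <= 1 :> R. Proof. by []. Qed.
Let le11 : (1 <= 1%:E :> \bar R)%E. Proof. by []. Qed.
Let le1y : (1 <= +oo :> \bar R)%E. Proof. by rewrite leey. Qed.
Let ell1 := ell m 1%:E.
Let elly := ell m +oo%E.

Let G'_ell u : ell1 u -> ell1 (G' u).
Proof. exact: (kernel_ell rkP' le11). Qed.

Let G_elly g : elly g -> elly (G g).
Proof. exact: (kernel_ell rkP le1y). Qed.

Let G'_delta y : G' (delta y) = rk' y.
Proof.
apply/funext => x; rewrite /kernel_op (@csum1 _ _ _ y); last first.
  by move=> w /negPf wy; rewrite /delta wy mul0r.
by rewrite /delta eqxx mul1r.
Qed.

Let rk'_ell y : ell1 (rk' y).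
Proof. by rewrite -G'_delta; apply: G'_ell; exact: Cc_ell (Cc_delta y). Qed.

Let pairing_delta_G y g : elly g -> pairing m (rk' y) g = pairing m (delta y) (G g).
Proof.
move=> eg; rewrite pairing_delta_l /kernel_op.
have sm := kernel_summ rkP le1y y eg.
rewrite -csum_conj// -csumZ; last exact: summ_conj.
by apply: eq_csum => x; rewrite rk_dual conjcM; ring.
Qed.

(** Finitely supported functions are dense in [l^1] but in general not in [l^oo], so only [u] is
    approximated. On [delta y] the identity is [kernel_dual]. *)
Lemma kernel_duality u g : ell1 u -> elly g -> pairing m (G' u) g = pairing m u (G g).
Proof.
move=> eu eg; have eGg := G_elly eg.
have step : forall A : {fset X}, ell1 (fun x => \sum_(y <- A) u y * rk' y x) /\
    pairing m (fun x => \sum_(y <- A) u y * rk' y x) g = pairing m (cutoff A u) (G g).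
  elim/fset1U_rect => [|y A yA [e1 ih]].
    have -> : (fun x => \sum_(y <- fset0) u y * rk' y x) = (fun=> 0).
      by apply/funext => x; rewrite big_seq_fset0.
    split; first exact: ell0.
    by apply: eq_csum => x; rewrite /cutoff inE !mulr0 !mul0r.
  have -> : (fun x => \sum_(w <- (y |` A)%fset) u w * rk' w x) =
      (fun x => \sum_(w <- A) u w * rk' w x + u y * rk' y x).
    by apply/funext => x; rewrite big_fsetU1//= addrC.
  have e2 := ellZ le11 (u y) (rk'_ell y).
  split; first exact: (ellD le11 e1 e2).
  have -> : cutoff (y |` A)%fset u = (fun x => cutoff A u x + u y * delta y x).
    apply/funext => x; rewrite /cutoff /delta !inE; case: eqP => [->|_] /=.
      by rewrite (negPf yA) add0r mulr1.
    by rewrite mulr0 addr0.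
  have eA := (cutoff_Cc le11 A eu).2.
  have ed : ell1 (delta y) by exact: (Cc_ell le11 (Cc_delta y)).
  have ed2 := ellZ le11 (u y) ed.
  rewrite (pairingDl (psumm1y e1 eg) (psumm1y e2 eg)) ih.
  rewrite (pairingDl (psumm1y eA eGg) (psumm1y ed2 eGg)).
  rewrite (pairingZl _ (psumm1y (rk'_ell y) eg)).
  by rewrite (pairingZl _ (psumm1y ed eGg)) pairing_delta_G.
have [B hB] := (ellP _ _).1 eu; have [D hD] := (ellP _ _).1 eg.
have D0 := nb_ge0 hD; have C0 := ltW C_gt0; have C'0 := ltW C'_gt0.
apply: normc_eps_eq => e e0.
pose k := (C' + C) * D + 1.
have k0 : 0 < k by rewrite ltr_wpDl// mulr_ge0// addr_ge0.
have [A hA] := nb_dense le11 isT hB (divr_gt0 e0 k0).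
have eA := (cutoff_Cc le11 A eu).2.
have GA : G' (cutoff A u) = (fun x => \sum_(y <- A) u y * rk' y x).
  apply/funext => x; rewrite /kernel_op (@csum_finite _ _ _ A).
    by apply: eq_big_seq => w wA; rewrite /cutoff wA.
  by move=> w /negPf wA; rewrite /cutoff wA mul0r.
have [_ EA] := step A; rewrite -GA in EA.
have n1 := kernel_bnd rkP' le11 hA.
have l1 := kernel_lin rkP' le11.
rewrite (linB l1 eu eA) in n1.
have ny := kernel_bnd rkP le1y hD.
have -> : pairing m (G' u) g - pairing m u (G g) =
   pairing m (fun x => G' u x - G' (cutoff A u) x) g
   - pairing m (fun x => u x - cutoff A u x) (G g).
  rewrite (pairingBl (psumm1y (G'_ell eu) eg) (psumm1y (G'_ell eA) eg)).
  by rewrite (pairingBl (psumm1y eu eGg) (psumm1y eA eGg)) EA; ring.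
apply: le_trans (normcB _ _) _.
have P1 := pairing_le (psum1y n1 hD).
have P2 := pairing_le (psum1y hA ny).
apply: le_trans (lerD P1 P2) _.
rewrite (_ : _ + _ = e * (((C' + C) * D) / k)); last by field; rewrite gt_eqF.
by rewrite ler_piMr ?(ltW e0)// ler_pdivrMr// mul1r lerDl.
Qed.

Let Hop1_resolvent u : ell1 u -> Hop m S 1%:E (G' u) (fun x => u x + conjc z * G' u x).
Proof.
exact: (Hop_resolvent rkP' H_res' one1).
Qed.

Let Hop1_left_inverse f h : Hop m S 1%:E f h -> G' (fun x => h x - conjc z * f x) = f.
Proof.
exact: (Hop_left_inverse rkP' H_res' one1).
Qed.

Lemma Hopy_resolvent k : elly k -> Hop m S +oo%E (G k) (fun x => k x + z * G k x).
Proof.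
move=> ek; have eG := G_elly ek; have ezG := ellZ le1y z eG.
have es := ellD le1y ek ezG.
split=> // f h Hf; have [ef eh] := Hop_ell le11 Hf.
have ezf := ellZ le11 (conjc z) ef; have ed := ellB le11 eh ezf.
have := kernel_duality ed ek; rewrite (Hop1_left_inverse Hf).
rewrite (pairingDr (psumm1y ef ek) (psumm1y ef ezG)) (pairingZr _ (psumm1y ef eG)).
rewrite (pairingBl (psumm1y eh eG) (psumm1y ezf eG)) (pairingZl _ (psumm1y ef eG)).
by move=> ->; ring.
Qed.

(** The adjoint relation is tested with the functions [G' (delta y)] in the domain of [H_1], which
    reads off the values at [y]. *)
Lemma Hopy_left_inverse g k : Hop m S +oo%E g k -> G (fun x => k x - z * g x) = g.
Proof.
move=> [eg ek adj]; apply/funext => y.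
have ed : ell1 (delta y) by exact: (Cc_ell le11 (Cc_delta y)).
have := adj _ _ (Hop1_resolvent ed); rewrite G'_delta.
have er := rk'_ell y; have ezr := ellZ le11 (conjc z) er.
have ezg := ellZ le1y z eg; have es := ellB le1y ek ezg.
rewrite (pairingDl (psumm1y ed eg) (psumm1y ezr eg)).
rewrite (pairingZl _ (psumm1y er eg)) => E.
have := pairing_delta_G y es.
rewrite (pairingBr (psumm1y er ek) (psumm1y er ezg)) (pairingZr _ (psumm1y er eg)) -E.
rewrite addrK !pairing_delta_l => /mulfI.
have mC : (m y)%:C != 0 by rewrite fmorph_eq0 gt_eqF.
move=> /(_ mC) /(congr1 (@conjc R)); rewrite !conjcK => ->//.
Qed.

End infinite_exponent.

(** * The two inclusions of the spectra *)

Hypothesis H_kernel : forall z L, resolves 2%:E H z L ->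
  exists rk C, resolvent_kernel z rk C.

Lemma kernel_inverts_Hop z L rk C p : resolves 2%:E H z L -> resolvent_kernel z rk C ->
  (1 <= p)%E ->
  (forall k, ell m p k -> Hop m S p (kernel_op rk k) (fun x => k x + z * kernel_op rk k x)) /\
  (forall f h, Hop m S p f h -> kernel_op rk (fun x => h x - z * f x) = f).
Proof.
move=> rz ker.
case: p => [r| |] p1; last by move: p1; rewrite leNgt ltNyr.
  have r1 : 1 <= r by rewrite -lee_fin.
  split=> [k ek|f h Hf].
    by have := (Hop_resolvent ker rz r1 ek).
  exact: (Hop_left_inverse ker rz r1 Hf).
have [L' rz'] := res_conj rz.
have [rk' [C' ker']] := H_kernel rz'.
split=> [k ek|f h Hf].
  exact: (Hopy_resolvent ker ker' rz' ek).
exact: (Hopy_left_inverse ker ker' rz' Hf).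
Qed.

Lemma resolves_Hop z L p : (1 <= p)%E -> resolves 2%:E H z L ->
  exists K, resolves p (Hop m S p) z K.
Proof.
move=> p1 rz; have [rk [C ker]] := H_kernel rz; have [C0 _ _ _] := ker.
have [right left] := kernel_inverts_Hop rz ker p1.
exists C; split; [exact: ltW|by move=> g eg; exists (kernel_op rk g); exact: right|].
move=> f h B Hf hB; rewrite -(left _ _ Hf).
exact: (kernel_bnd ker p1 hB).
Qed.

(** The norm [N] of the solution at [w] satisfies [N <= K (B + |w - z| N)], and
    [|w - z| K <= 1 / 4]. Writing [K + 1] keeps the constant positive. *)
Lemma kernel_bnd_near z K w L rk C p : (1 <= p)%E -> resolves p (Hop m S p) z K ->
  resolves 2%:E H w L -> resolvent_kernel w rk C ->
  normc (w - z) * (K + 1) <= 4^-1 -> bnd p (kernel_op rk) (4 / 3 * (K + 1)).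
Proof.
move=> p1 [K0 _ low] rw ker wz f B hB.
have ef : ell m p f := nb_ell hB; have B0 := nb_ge0 hB.
have [right _] := kernel_inverts_Hop rw ker p1; have Hu := right _ ef.
set u := kernel_op rk f in Hu *.
have eu : ell m p u := kernel_ell ker p1 ef.
have nu := nb_self eu; set N := fine _ in nu; have N0 := nb_ge0 nu.
have hw : nb p (fun x => f x + w * u x - z * u x) (B + normc (w - z) * N).
  have := nbD p1 hB (nbZ p1 (w - z) nu).
  by apply: eq_nb => x; ring.
have := low _ _ _ Hu hw => hu.
have NE : N <= K * (B + normc (w - z) * N).
  by move: hu; rewrite /nb (nb_norm nu) lee_fin.
apply: nbW nu.
have d0 : 0 <= normc (w - z) := normc_ge0 _.
have h1 := ler_wpM2r N0 wz; have h2 := mulr_ge0 d0 N0; have h3 := mulr_ge0 K0 B0.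
have h4 := mulr_ge0 K0 h2; nra.
Qed.

Lemma resolves_from_Hop z K p : (1 <= p)%E -> resolves p (Hop m S p) z K ->
  exists L, resolves 2%:E H z L.
Proof.
move=> p1 rz; have [z0|z0] := eqVneq (Im z) 0; last first.
  by exists `|Im z|^-1; exact: res_nonreal.
have K0 : 0 <= K by case: rz.
have K1 : 0 < K + 1 by rewrite ltr_wpDl.
(* Serves twice: [kernel_bnd_near] applies at [w] and [conjc w], and the Neumann series from [w]
   back to [z] has ratio [eta * 4 / 3 * (K + 1) = 1 / 3]. *)
pose eta := (4 * (K + 1))^-1; have eta0 : 0 < eta by rewrite invr_gt0 mulr_gt0.
pose w : R[i] := (Re z +i* eta)%C.
have etaK : eta * (K + 1) = 4^-1 by rewrite /eta; field; rewrite gt_eqF.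
have nz (t : R) : normc (0 +i* t)%C = `|t|.
  by rewrite /Normc.normc /= expr0n /= add0r sqrtr_sqr.
have dw : w - z = (0 +i* eta)%C.
  by apply/eqP; rewrite eq_complex /w; case: (z) z0 => u v /= ->; rewrite subrr subr0 !eqxx.
have dw' : conjc w - z = (0 +i* - eta)%C.
  by apply/eqP; rewrite eq_complex /w; case: (z) z0 => u v /= ->; rewrite subrr subr0 !eqxx.
have near : normc (w - z) * (K + 1) <= 4^-1 by rewrite dw nz gtr0_norm// etaK.
have near' : normc (conjc w - z) * (K + 1) <= 4^-1.
  by rewrite dw' nz normrN gtr0_norm// etaK.
have wI : Im w != 0 by rewrite gt_eqF.
have wI' : Im (conjc w) != 0 by rewrite Im_conjc oppr_eq0.
have rw := res_nonreal wI.
have rw' := res_nonreal wI'.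
have [rk [C ker]] := H_kernel rw; have [rk' [C' ker']] := H_kernel rw'.
have b1 := kernel_bnd_near p1 rz rw ker near.
have b2 := kernel_bnd_near p1 rz rw' ker' near'.
have [C0 _ _ _] := ker.
pose T := kernel_op rk; pose T' := kernel_op rk'.
have T2 : bnd 2%:E T C := kernel_bnd ker le12.
have Tl : lin 2%:E T := kernel_lin ker le12.
have Te f (ef : ell2 f) : ell2 (T f) := kernel_ell ker le12 ef.
have Te' f (ef : ell2 f) : ell2 (T' f) := kernel_ell ker' le12 ef.
have TP f (ef : ell2 f) := kernel_opP ker rw ef.
have TP' f (ef : ell2 f) := kernel_opP ker' rw' ef.
have adj f g (ef : ell2 f) (eg : ell2 g) : pairing m (T f) g = pairing m f (T' g) :=
  resolvent_sym ef eg (TP f ef) (TP' g eg).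
set k := 4 / 3 * (K + 1) in b1 b2.
have k0 : 0 < k by rewrite mulr_gt0// divr_gt0.
(* Krein's bound holds on finitely supported functions. The Schur constant [C] may be far too large
   for the Neumann series, but it provides the continuity that extends the good constant [k] to
   [l^2]. *)
have Tc f B : Cc f -> nb2 f B -> nb2 (T f) (k * B).
  move=> cf hB; have B0 := nb_ge0 hB.
  have ef := nb_ell hB.
  apply: nbW (pairing_self_ge (Te _ ef)).
  have kB : 0 <= k * B by rewrite mulr_ge0// ltW.
  rewrite -(ger0_norm kB) -sqrtr_sqr ler_wsqrtr// exprMn.
  apply: le_trans (krein_bound p1 k0 b1 b2 Te Te' adj cf) _.
  by rewrite ler_wpM2l ?sqr_ge0//; exact: Re_pairing_self_le.
have Tb : bnd 2%:E T k.
  move=> f B hB; apply: (nb_closed) => e e0.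
  have Ck : 0 < C + k by rewrite addr_gt0.
  have [A hA] := nb_dense le12 (isT : 2%:E != +oo%E) hB (divr_gt0 e0 Ck).
  have ef := nb_ell hB.
  have [cA eA] := cutoff_Cc le12 A ef.
  have n1 := T2 _ _ hA; rewrite (linB Tl ef eA) in n1.
  have n2 := Tc _ _ cA (nb_cut_le le12 A hB).
  have := nbD le12 n2 n1 => h; apply: eq_nb (nbW _ h); first by move=> x; ring.
  rewrite lerD2l mulrCA ler_piMr ?(ltW e0)// ler_pdivrMr// mul1r lerDl; exact: ltW.
apply: (res_shift (z0 := w) (K := k)).
  have [_ sur _] := rw; split; [exact: ltW|exact: sur|].
  move=> f h B Hf hB; have eg := nb_ell hB.
  suff -> : f = T (fun x => h x - w * f x) by exact: Tb.
  apply: (resolvent_uniq rw _ (TP _ eg)).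
  by move: Hf; congr (H _ _); apply/funext => x; rewrite subrK.
rewrite -opprB normcN dw nz gtr0_norm// /k mulrCA etaK; lra.
Qed.

Lemma spectrum_Hop p : (1 <= p)%E -> spectrum m 2%:E H = spectrum m p (Hop m S p).
Proof.
move=> p1; rewrite /spectrum; congr (~` _); apply/seteqP.
have Hsub := op_sub.
have Hp_ell f h : Hop m S p f h -> ell m p f /\ ell m p h by exact: Hop_ell.
have Hp_sub := @Hop_sub p.
have P2 z := resolvent_setP z le12 H_ell Hsub.
have Pp z := resolvent_setP z p1 Hp_ell (fun f h f' h' => Hp_sub f h f' h' p1).
split=> z /=.
  by move=> /P2[L rz]; apply/Pp; exact: resolves_Hop rz.
by move=> /Pp[L rz]; apply/P2; exact: resolves_from_Hop rz.
Qed.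

End SymmetricOperator.

End WeightedSpace.

Theorem theorem4p4 (R : realType) (X : choiceType) (m : X -> R)
  (b : X -> X -> R) (o : X -> X -> R[i]) (c : X -> R) (d : X -> X -> R) (s : R)
  (S : R -> R -> (X -> R[i]) -> (X -> R[i]))
  (hm : forall x, 0 < m x)
  (hb : is_graph b)
  (ho : is_magnetic_potential o)
  (hpos : Q_positive b o c)
  (hclos : Q_closable m b o c)
  (hd : intrinsic_metric m b d)
  (hs : 0 < s)
  (hjump : jump_size b d = s%:E)
  (hc : form_bounded m b o c)
  (hgrowth : uniform_subexponential_growth m d)
  (hS : consistent_semigroups m (form_operator m b o c) S) :
  forall p : \bar R, (1 <= p)%E ->
    spectrum m 2%:E (form_operator m b o c) = spectrum m p (Hop m S p).
Proof.
(* For empty [X] the jump size is the supremum of the empty set, [-oo], and not a real number. *)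
have [[x0 _]|noX] := pselect (exists x : X, True); last first.
  have := hjump; rewrite /jump_size (_ : [set z : X * X | _] = set0).
    by rewrite image_set0 ereal_sup0.
  by apply/seteqP; split=> // -[x y] _; apply: noX; exists x.
have jump x y : 0 < b x y -> d x y <= s.
  move=> bxy; rewrite -lee_fin -hjump; apply: ereal_sup_ubound.
  by exists (x, y).
have E : form_operator m b o c = form_graph m b o c.
  apply/funext => f; apply/funext => h; apply/propext; exact: form_operatorP.
rewrite E in hS *.
apply: (spectrum_Hop hm x0 (H := form_graph m b o c) _ _ _ _ hS).
- by move=> f h [].
- by move=> f h g k a; exact: (form_graph_lin hm x0 hb ho).
- by move=> f h; exact: (form_graph_quad hm x0 hb ho hpos).
- by move=> mu g; exact: (form_graph_riesz hm x0 hb ho hpos).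
move=> z L rz.
have [a [M [a0 M0 decay]]] := resolvent_decay hm x0 hb ho hpos hd (ltW hs) jump hc rz.
have [C [C0 row col]] := decay_schur hm hd.1 hgrowth a0 M0.
have [_ sur _] := rz.
have ed y : ell m 2%:E (delta R y).
  by apply: (Cc_ell hm x0 _ (Cc_delta R y)); rewrite lee_fin ler1n.
have [rk hrk] := choice (fun y => sur _ (ed y)).
have le x y : normc (rk y x) <= M * expR (- a * d x y) * Num.sqrt (m y) / Num.sqrt (m x).
  by rewrite ler_pdivlMr ?sqrtr_gt0// mulrC; exact: decay.
exists rk, C; split=> //.
  by move=> x; apply: le_sumle (row x).
by move=> y; apply: le_sumle (col y) => // x; rewrite ler_wpM2l// ltW.
Qed.
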